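(* Let $S^3$ be the unit 3-sphere with its standard Riemannian metric. For a smooth unit vector field $\sigma$ on $S^3$ let $E^v(\sigma)=\frac12\int_{S^3}|\nabla\sigma|^2\,dx$. Then the absolute minimum of $E^v$ over all smooth unit vector fields on $S^3$ is $2\pi^2$, and a smooth unit vector field $\sigma$ on $S^3$ satisfies $E^v(\sigma)=2\pi^2$ if and only if $\sigma$ is a Hopf vector field.
   Context: $\nabla$ is the Levi-Civita connection of $S^3$, $|\nabla\sigma|^2=\sum_j|\nabla_{E_j}\sigma|^2$ for a local orthonormal frame $\{E_j\}$, and $dx$ is the Riemannian volume measure. $E^v$ is the vertical energy functional: if $\sigma$ is regarded as a map from $S^3$ into its unit tangent bundle with the Sasaki metric, the vertical component $d^v\sigma$ of its differential satisfies $|d^v\sigma|^2=|\nabla\sigma|^2$. The canonical Hopf vector field on $S^3\subset\mathbb{R}^4\cong\mathbb{C}^2$ is $x\mapsto ix$. A Hopf vector field on $S^3$ is any unit vector field congruent to the canonical one, i.e. its image under an isometry of $S^3$ (an element of $O(4)$). *)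

(* Defs.v *)
From HB Require Import structures.
From mathcomp Require Import all_boot all_order all_algebra.
From mathcomp Require Import all_classical all_reals all_analysis.
From mathcomp Require Import ring.
Set Implicit Arguments.
Unset Strict Implicit.
Unset Printing Implicit Defensive.
Import Order.TTheory GRing.Theory Num.Theory numFieldNormedType.Exports.
Local Open Scope classical_set_scope.
Local Open Scope ring_scope.

Section Smooth.
Context {R : realType} {V W : normedModType R}.

(* [U] is meant to be open, so that the values of f outside of U are
   irrelevant. *)
Fixpoint Ck (k : nat) (U : set V) (f : V -> W) : Prop :=
  if k is k'.+1 then
    (forall x, U x -> differentiable f x) /\ (forall v, Ck k' U ('D_v f))
  else forall x, U x -> {for x, continuous f}.

Definition smooth_on (U : set V) (f : V -> W) : Prop :=
  forall k, Ck k U f.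

End Smooth.

Section Sphere.
Context {R : realType}.
Local Notation E4 := 'cV[R]_4.

(* The norm [`|x|] that the library puts on matrices is the sup norm; the
   Euclidean structure is expressed by [dot]. *)
Definition dot (x y : E4) : R := \sum_i x i ord0 * y i ord0.

Definition S3 : set E4 := [set x | dot x x = 1].

Definition tangent (p v : E4) : Prop := dot p v = 0.

(* Functions and vector fields on S3 are represented by functions on the
   ambient space, of which only the values on S3 are relevant. *)

Definition smoothS3 {W : normedModType R} (f : E4 -> W) : Prop :=
  forall p, S3 p -> exists (U : set E4) (F : E4 -> W),
    [/\ open U, U p, smooth_on U F & forall x, U x -> S3 x -> F x = f x].

Definition vector_field (X : E4 -> E4) : Prop :=
  smoothS3 X /\ forall p, S3 p -> tangent p (X p).

Definition unit_vector_field (X : E4 -> E4) : Prop :=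
  vector_field X /\ forall p, S3 p -> dot (X p) (X p) = 1.

Definition retract (x : E4) : E4 := (Num.sqrt (dot x x))^-1 *: x.

(* For p in S3 and v tangent at p, this is the derivative at t = 0 of f along
   the curve t |-> (p + t v) / |p + t v| of S3, whose velocity at 0 is v. *)
Definition dS3 {W : normedModType R} (f : E4 -> W) (p v : E4) : W :=
  'D_v (f \o retract) p.

(* [nabla p v Y] stands for the covariant derivative at p of the field Y in the
   direction of the tangent vector v. *)
Definition connection := E4 -> E4 -> (E4 -> E4) -> E4.

Record is_connection (nabla : connection) : Prop := {
  conn_field : forall X Y, vector_field X -> vector_field Y ->
    vector_field (fun p => nabla p (X p) Y) ;
  conn_linear : forall p Y (a : R) v w, S3 p -> vector_field Y ->
    tangent p v -> tangent p w ->
    nabla p (a *: v + w) Y = a *: nabla p v Y + nabla p w Y ;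
  conn_add : forall p v Y Z, S3 p -> tangent p v ->
    vector_field Y -> vector_field Z ->
    nabla p v (fun x => Y x + Z x) = nabla p v Y + nabla p v Z ;
  conn_leibniz : forall p v (f : E4 -> R) Y, S3 p -> tangent p v ->
    smoothS3 f -> vector_field Y ->
    nabla p v (fun x => f x *: Y x) = dS3 f p v *: Y p + f p *: nabla p v Y }.

Definition metric_connection (nabla : connection) : Prop :=
  forall p v Y Z, S3 p -> tangent p v -> vector_field Y -> vector_field Z ->
  dS3 (fun x => dot (Y x) (Z x)) p v
  = dot (nabla p v Y) (Z p) + dot (Y p) (nabla p v Z).

(* nabla_X Y - nabla_Y X = [X, Y], as derivations of functions. *)
Definition torsion_free (nabla : connection) : Prop :=
  forall p X Y (f : E4 -> R), S3 p -> vector_field X -> vector_field Y ->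
  smoothS3 f ->
  dS3 f p (nabla p (X p) Y - nabla p (Y p) X)
  = dS3 (fun x => dS3 f x (Y x)) p (X p) - dS3 (fun x => dS3 f x (X x)) p (Y p).

Definition levi_civita (nabla : connection) : Prop :=
  [/\ is_connection nabla, metric_connection nabla & torsion_free nabla].

Definition vec4 (a b c d : R) : E4 := \col_(i < 4) [:: a; b; c; d]`_i.

(* Left multiplications by the quaternions i, j, k, for the identification
   x = x0 + x1 i + x2 j + x3 k.  When R^4 is identified to C^2 by
   (x0 + x1 i, x2 + x3 i), [imul] is the multiplication by the complex number i,
   hence the canonical Hopf field. *)
Definition imul (x : E4) : E4 := vec4 (- x 1 0) (x 0 0) (- x 3 0) (x 2 0).
Definition jmul (x : E4) : E4 := vec4 (- x 2 0) (x 3 0) (x 0 0) (- x 1 0).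
Definition kmul (x : E4) : E4 := vec4 (- x 3 0) (- x 2 0) (x 1 0) (x 0 0).

Definition orthonormal_basis (p : E4) (e : 'I_3 -> E4) : Prop :=
  (forall i, tangent p (e i)) /\ forall i j, dot (e i) (e j) = (i == j)%:R.

Definition frame (j : 'I_3) (p : E4) : E4 :=
  nth 0 [:: imul p; jmul p; kmul p] j.

(* |nabla sigma|^2, computed in the global orthonormal frame [frame]; by
   [normsq_covE] below any other orthonormal frame gives the same value. *)
Definition normsq_cov (nabla : connection) (sigma : E4 -> E4) (p : E4) : R :=
  \sum_j dot (nabla p (frame j p) sigma) (nabla p (frame j p) sigma).

(* Parametrization of S3 by (eta, xi1, xi2); it is a diffeomorphism from
   [chart_domain] onto S3 minus a closed null set. *)
Definition hopf_chart (y : R * R * R) : E4 :=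
  let: (eta, xi1, xi2) := y in
  vec4 (cos eta * cos xi1) (cos eta * sin xi1)
       (sin eta * cos xi2) (sin eta * sin xi2).

Definition chart_domain : set (R * R * R) :=
  `]0, pi / 2[ `*` `]0, 2 * pi[ `*` `]0, 2 * pi[.

Definition basis3 (i : 'I_3) : R * R * R :=
  ((i == 0)%:R, (i == 1)%:R, (i == 2)%:R).

(* Matrix (g_ij) of the Riemannian metric in the coordinates (eta, xi1, xi2). *)
Definition metric_matrix (y : R * R * R) : 'M[R]_3 :=
  \matrix_(i, j) dot ('D_(basis3 i) hopf_chart y) ('D_(basis3 j) hopf_chart y).

(* Integral with respect to the Riemannian volume sqrt (det g) dy. *)
Definition integralS3 (f : E4 -> R) : \bar R :=
  (\int[lebesgue_measure \x lebesgue_measure \x lebesgue_measure]_(y in chart_domain)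
    (f (hopf_chart y) * Num.sqrt (\det (metric_matrix y)))%:E)%E.

Definition vertical_energy (nabla : connection) (sigma : E4 -> E4) : \bar R :=
  ((2^-1)%:E * integralS3 (normsq_cov nabla sigma))%E.

Definition orthogonal (A : 'M[R]_4) : Prop := A^T *m A = 1%:M.

Definition image_field (A : 'M[R]_4) (X : E4 -> E4) (x : E4) : E4 :=
  A *m X (invmx A *m x).

Definition hopf_field (sigma : E4 -> E4) : Prop :=
  exists A : 'M[R]_4, orthogonal A /\
    forall x, S3 x -> sigma x = image_field A imul x.

Lemma dotC x y : dot x y = dot y x.
Proof. by apply: eq_bigr => i _; rewrite mulrC. Qed.

Lemma dotDl x y z : dot (x + y) z = dot x z + dot y z.
Proof. by rewrite -big_split /=; apply: eq_bigr => i _; rewrite mxE mulrDl. Qed.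

Lemma dotZl (a : R) x z : dot (a *: x) z = a * dot x z.
Proof. by rewrite mulr_sumr; apply: eq_bigr => i _; rewrite mxE mulrA. Qed.

Lemma dot0l z : dot 0 z = 0.
Proof. by rewrite -(scale0r 0) dotZl mul0r. Qed.

Lemma dot_suml n (x : 'I_n -> E4) z : dot (\sum_i x i) z = \sum_i dot (x i) z.
Proof. by elim/big_rec2: _ => [|i u v _ <-]; rewrite ?dot0l ?dotDl. Qed.

Lemma dot4 (x y : E4) : dot x y =
  x 0 0 * y 0 0 + x 1 0 * y 1 0 + x 2 0 * y 2 0 + x 3 0 * y 3 0.
Proof.
rewrite /dot !big_ord_recr big_ord0 /= add0r.
by do ![congr (_ + _)]; congr (x _ _ * y _ _); apply/val_inj.
Qed.

Lemma vec4E (a b c d : R) : (vec4 a b c d 0 0 = a) *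
  (vec4 a b c d 1 0 = b) * (vec4 a b c d 2 0 = c) * (vec4 a b c d 3 0 = d).
Proof. by rewrite /vec4 !mxE. Qed.

Lemma frame_orthonormal (p : E4) :
  S3 p -> orthonormal_basis p (fun i => frame i p).
Proof.
rewrite /S3 /= dot4 => Sp; split.
  by case=> -[|[|[|//]]] i /=; rewrite /tangent /frame dot4 /= !vec4E; ring.
by case=> -[|[|[|//]]] i [] [|[|[|//]]] j /=; rewrite /frame dot4 /= !vec4E;
  (ring || (rewrite -Sp; ring)).
Qed.

Lemma orthonormal_basis_expand p e v :
  S3 p -> orthonormal_basis p e -> tangent p v -> v = \sum_i dot v (e i) *: e i.
Proof.
move=> Sp [te oe] tv.
pose E (i : 'I_(1 + 3)) : E4 :=
  match fintype.split i with inl _ => p | inr j => e j end.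
pose B : 'M[R]_(1 + 3) := \matrix_(i < 1 + 3, j < 4) E i j ord0.
have BB : B *m B^T = 1%:M.
  apply/matrixP => i j; rewrite !mxE; under eq_bigr do rewrite !mxE.
  rewrite -/(dot (E i) (E j)) /E -(inj_eq (can_inj (@splitK 1 3))).
  case: (fintype.split i) => i'; case: (fintype.split j) => j' //=.
  - by rewrite Sp !ord1 eqxx.
  - by rewrite te.
  - by rewrite dotC te.
have {}BB : B^T *m B = 1%:M by exact: mulmx1C.
have Ev : v = \sum_(i < 1 + 3) dot v (E i) *: E i.
  have E1 : v = (1%:M : 'M[R]_(1 + 3)) *m v by rewrite mul1mx.
  rewrite {1}E1 -BB -mulmxA; apply/matrixP => k l; rewrite ord1 summxE !mxE.
  apply: eq_bigr => i _; rewrite !mxE mulrC; congr (_ * _).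
  by apply: eq_bigr => m _; rewrite !mxE mulrC.
rewrite {1}Ev big_split_ord /= big_ord1 {1}/E.
have -> : fintype.split (lshift 3 (0 : 'I_1)) = inl 0.
  exact: (unsplitK (inl 0)).
rewrite dotC tv scale0r add0r; apply: eq_bigr => i _.
have -> // : E (rshift 1 i) = e i.
rewrite /E; have -> // : fintype.split (rshift 1 i) = inr i.
exact: (unsplitK (inr i)).
Qed.

Lemma normsq_covE (nabla : connection) (sigma : E4 -> E4) (p : E4)
  (e : 'I_3 -> E4) :
  is_connection nabla -> vector_field sigma -> S3 p -> orthonormal_basis p e ->
  normsq_cov nabla sigma p
  = \sum_j dot (nabla p (e j) sigma) (nabla p (e j) sigma).
Proof.
move=> nc vs Sp oe; have of_ := frame_orthonormal Sp.
have [te ee] := oe; have [tf ff] := of_.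
pose L v := nabla p v sigma; rewrite /normsq_cov -/L.
have L0 : L 0 = 0.
  have t0 : tangent p 0 by rewrite /tangent dotC dot0l.
  have := conn_linear nc 1 Sp vs t0 t0; rewrite !scale1r addr0 => /eqP.
  by rewrite -subr_eq subrr eq_sym => /eqP.
have LS (a : 'I_3 -> R) : L (\sum_i a i *: e i) = \sum_i a i *: L (e i).
  have [] : tangent p (\sum_i a i *: e i) /\
      L (\sum_i a i *: e i) = \sum_i a i *: L (e i).
    elim/big_rec2: _ => [|i w u _ [tu <-]].
      by split=> //; rewrite /tangent dotC dot0l.
    split; last exact: conn_linear.
    rewrite /tangent dotC dotDl dotZl [dot (e i) p]dotC te mulr0 add0r.
    by rewrite dotC.
  by [].
pose c i j := dot (frame i p) (e j).
have Lf i : L (frame i p) = \sum_j c i j *: L (e j).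
  by rewrite {1}(orthonormal_basis_expand Sp oe (tf i)) LS.
have cc j k : \sum_i c i j * c i k = (j == k)%:R.
  rewrite -ee {1}(orthonormal_basis_expand Sp of_ (te j)) dot_suml.
  by apply: eq_bigr => i _; rewrite dotZl /c (dotC (e j)).
under eq_bigr => i _ do rewrite -/(L _) Lf dot_suml.
under eq_bigr => i _.
  under eq_bigr => j _.
    rewrite dotZl dotC dot_suml mulr_sumr.
    under eq_bigr => k _ do rewrite dotZl mulrA.
    over.
  over.
rewrite exchange_big; apply: eq_bigr => j _ /=.
rewrite exchange_big /=.
under eq_bigr => k _ do rewrite -mulr_suml cc.
rewrite (bigD1 j) //= eqxx mul1r big1 ?addr0 // => k kj.
by rewrite eq_sym (negbTE kj) mul0r.
Qed.

End Sphere.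

(* Main.v *)
From HB Require Import structures.
Require Import Defs.
From mathcomp Require Import all_boot all_order all_algebra.
From mathcomp Require Import all_classical all_reals all_analysis.
From mathcomp Require Import measurable_realfun ring lra.
Set Implicit Arguments.
Unset Strict Implicit.
Unset Printing Implicit Defensive.
Import Order.TTheory GRing.Theory Num.Theory numFieldNormedType.Exports.
Local Open Scope classical_set_scope.
Local Open Scope ring_scope.

(** In the left invariant frame, write s for the components of a unit field
    sigma and N for those of its covariant derivative.  The second elementary
    symmetric function of N satisfies (tr N)^2 - tr (N^2) = 2 + div V for an
    explicit field V, hence has integral 4 pi^2 (Bochner), and it is bounded
    above by |N|^2, since sigma has length 1 and N is thus of rank at most 2;
    this gives the lower bound 2 pi^2.  In case of equality sigma is geodesic
    and N is conformal on the orthogonal of sigma, so that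
    E_a s_c = al (delta_ac - s_a s_c) + ga eps_acd s_d.  The commutation relations
    of the frame then show that al is harmonic, hence constant; as 2 al is the
    divergence of sigma, al = 0; then ga is constant, equal to 0 or to -2.  In
    the first case sigma is left invariant, in the second one it is right
    invariant.  In both cases sigma x = J x for an orthogonal complex structure J,
    and all these are conjugate under O(4). *)

(** * Calculus of functions of class C^k *)

(** Functions on the sphere are replaced by their radial extensions to the punctured space. The
    frame is linear and tangent to all spheres centred at 0, so the covariant calculus reduces to
    directional derivatives of functions homogeneous of degree 0, with [E_a, E_b] = - 2 eps_abd E_d
    and nabla_(E_a) E_b = - eps_abd E_d. The constant 2 next to div V is the Ricci curvature in the
    direction sigma, and V = (div sigma) sigma - nabla_sigma sigma. As the sphere has volume 2 pi^2,
    half the integral of 2 is the bound. The divergence theorem is proved for each field of the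
    frame in Hopf coordinates: boundary terms cancel by periodicity in the two angles, and because
    the density vanishes at both ends of the eta interval. It is used for the bound, for the
    integral of |grad al|^2 when al is harmonic, and for that of al^2, since div (al sigma) = 2 al^2
    for constant al. Once al = 0, integrability leaves ga (ga + 2) = 0, the origin of the two
    cases. *)

Section CkTheory.
Context {R : realType} {V W : normedModType R}.
Implicit Types (U : set V) (f g : V -> W).

(** [g - f] vanishes near [x], so the zero map satisfies the expansion that characterizes its
    differential, and [g] is a sum of two differentiable functions. *)
Lemma differentiable_near_eq f g x :
  (\forall y \near x, f y = g y) -> differentiable f x -> differentiable g x.
Proof.
move=> fg df.
have -> : g = f + (g - f) by rewrite addrC subrK.
apply: differentiableD => //.
have h0 : \forall y \near x, (g - f) y = 0.
  by near=> y; rewrite !fctE (near fg y)// subrr.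
have hE : (g - f) \o shift x = cst ((g - f) x) + (0 : V -> W) +o_ 0 id.
  rewrite addr0 (nbhs_singleton h0).
  apply/eqaddoP => _ /posnumP[e]; near=> y.
  have -> : (((g - f) \o shift x) - cst 0) y = 0.
    have : (g - f) (y + x) = 0.
      near: y; rewrite (near_shift 0 x) in h0.
      by apply: filterS h0 => y /=; rewrite subr0.
    by rewrite !fctE => ->; rewrite subr0.
  by rewrite normr0 mulr_ge0.
have hu : 'd (g - f) x = (0 : V -> W) :> (V -> W).
  by apply: (@diff_unique _ _ _ _ \0) => //; exact: cst_continuous.
by apply/diff_locallyP; rewrite hu; split => //; exact: cst_continuous.
Unshelve. all: by end_near. Qed.

Lemma Ck_subset k U U' f : U' `<=` U -> Ck k U f -> Ck k U' f.
Proof.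
move=> UU'; elim: k f => [|k IH] f /=; first by move=> cf x /UU' /cf.
by case=> df Df; split=> [x /UU' /df//|v]; exact: IH.
Qed.

Lemma open_near_eq U f g x : open U -> U x -> {in U, f =1 g} ->
  \forall y \near x, f y = g y.
Proof.
move=> oU Ux fg; near=> y; apply: fg; rewrite inE; near: y.
exact: open_nbhs_nbhs.
Unshelve. all: by end_near. Qed.

Lemma Ck_eq k U f g : open U -> {in U, f =1 g} -> Ck k U f -> Ck k U g.
Proof.
move=> oU; elim: k f g => [|k IH] f g fg /=.
  move=> cf x Ux; rewrite /prop_for /continuous_at -(fg x) ?inE//.
  apply: cvg_trans (cf x Ux); apply: near_eq_cvg.
  by apply: filterS (open_near_eq oU Ux fg) => y.
case=> df Df; split=> [x Ux|v].
  exact: differentiable_near_eq (open_near_eq oU Ux fg) (df x Ux).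
apply: IH (Df v) => x; rewrite inE => Ux.
exact: near_eq_derive (open_near_eq oU Ux fg).
Qed.

(** Each clause of [Ck] is a condition at a single point on a function defined everywhere, so the
    sets [U'] need not be compared with one another. *)
Lemma Ck_local k U f :
  (forall x, U x -> exists U', U' x /\ Ck k U' f) -> Ck k U f.
Proof.
elim: k f => [|k IH] f /= loc; first by move=> x /loc[U' [U'x]]; exact.
split=> [x /loc[U' [U'x []]]|v]; first by move=> + _; exact.
by apply: IH => x /loc[U' [U'x [_ Df]]]; exists U'.
Qed.

Lemma CkS k U f : Ck k.+1 U f -> Ck k U f.
Proof.
elim: k f => [|k IH] f /=.
  by case=> df _ x Ux; apply: differentiable_continuous; exact: df.
by case=> df Df; split=> // v; apply: IH; exact: Df.
Qed.

Lemma Ck_cst k U (a : W) : Ck k U (cst a).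
Proof.
elim: k a => [|k IH] a /=; first by move=> x _; exact: cst_continuous.
split=> // v.
have -> : 'D_v (cst a) = cst 0 :> (V -> W) by apply/funext => x; exact: derive_cst.
exact: IH.
Qed.

Lemma CkD k U f g : open U -> Ck k U f -> Ck k U g -> Ck k U (f + g).
Proof.
move=> oU; elim: k f g => [|k IH] f g /=.
  by move=> cf cg x Ux; apply: continuousD; [exact: cf|exact: cg].
move=> [df Df] [dg Dg]; split=> [x Ux|v].
  by apply: differentiableD; [exact: df|exact: dg].
apply: Ck_eq (IH _ _ (Df v) (Dg v)) => // x; rewrite inE => Ux.
by rewrite deriveD//; apply: diff_derivable; [exact: df|exact: dg].
Qed.

End CkTheory.

Section CkScalar.
Context {R : realType} {V : normedModType R}.
Implicit Types (U : set V) (f g : V -> R).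

Lemma CkM k U f g : open U -> Ck k U f -> Ck k U g -> Ck k U (f * g).
Proof.
move=> oU; elim: k f g => [|k IH] f g Cf Cg.
  by move=> x Ux; apply: continuousM; [exact: Cf|exact: Cg].
move: (Cf) (Cg) => [df Df] [dg Dg]; split=> [x Ux|v].
  by apply: differentiableM; [exact: df|exact: dg].
apply: (@Ck_eq _ _ _ _ _ (f * 'D_v g + g * 'D_v f)) => //.
  move=> x; rewrite inE => Ux.
  by rewrite deriveM//; apply: diff_derivable; [exact: df|exact: dg].
by apply: CkD => //; apply: IH; [exact: CkS Cf|exact: Dg|exact: CkS Cg|exact: Df].
Qed.

Lemma Ck_sum k U n (f : 'I_n -> V -> R) : open U ->
  (forall i, Ck k U (f i)) -> Ck k U (\sum_i f i).
Proof.
move=> oU Cf; elim/big_ind: _ => [|? ? ? ?|i _].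
- exact: (Ck_cst _ _ (0 : R)).
- exact: CkD.
- exact: Cf.
Qed.

End CkScalar.

(** * Regularity of maps into R^4 through their coordinates *)

Section E4.
Context {R : realType}.
Local Notation E4 := 'cV[R]_4.
Implicit Types (U : set E4) (f g : E4 -> R).

Definition coord4 (i : 'I_4) : E4 -> R := fun x => x i ord0.
Definition ebase (i : 'I_4) : E4 := delta_mx i ord0.

Lemma ebase_sum (v : E4) : v = \sum_i v i ord0 *: ebase i.
Proof.
rewrite [LHS]matrix_sum_delta; apply: eq_bigr => i _.
by rewrite big_ord_recl big_ord0 addr0 /ebase; congr (v _ _ *: delta_mx _ _).
Qed.

Lemma is_derive_coord4 (i : 'I_4) (x v : E4) :
  is_derive x v (coord4 i) (v i ord0).
Proof.
have dc : derivable (coord4 i) x v.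
  by apply: diff_derivable; exact: differentiable_coord.
apply: DeriveDef => //.
have := @derive_mx R E4 4 1 id x v (@derivable_id _ _ x v).
rewrite derive_id => /matrixP/(_ i ord0).
by rewrite mxE.
Qed.

Lemma Ck_coord4 k U i : Ck k U (coord4 i).
Proof.
case: k => [|k].
  by move=> x _; apply: differentiable_continuous; exact: differentiable_coord.
split=> [x _|v]; first exact: differentiable_coord.
have -> : 'D_v (coord4 i) = cst (v i ord0) :> (E4 -> R).
  by apply/funext => x; have [] := is_derive_coord4 i x v.
exact: Ck_cst.
Qed.

Lemma derive_sum_ebase f x v : differentiable f x ->
  'D_v f x = \sum_i v i ord0 * 'D_(ebase i) f x.
Proof.
move=> df; rewrite {1}(ebase_sum v) deriveE// linear_sum.
by apply: eq_bigr => i _; rewrite linearZ/= deriveE.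
Qed.

Lemma differentiable_mxP (V : normedModType R) (g : V -> E4) x :
  (forall i, differentiable (coord4 i \o g) x) -> differentiable g x.
Proof.
move=> dg; have -> : g = \sum_i (fun y => (coord4 i \o g) y *: ebase i).
  by apply/funext => y; rewrite fct_sumE [LHS]ebase_sum.
by apply: differentiable_sum => i; exact: differentiableZl.
Qed.

Lemma continuous_mxP (T : topologicalType) (g : T -> E4) x :
  (forall i, {for x, continuous (coord4 i \o g)}) -> {for x, continuous g}.
Proof.
move=> cg; have -> : g = \sum_i (fun y => (coord4 i \o g) y *: ebase i).
  by apply/funext => y; rewrite fct_sumE [LHS]ebase_sum.
elim/big_ind: _ => [|? ? ? ?|i _].
- exact: (@cst_continuous _ _ (0 : E4)).
- exact: continuousD.
- exact: continuousZr_tmp (cg i).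
Qed.

(** The chain rule, written as the sum of the D_v g_i * (d_i f o g), involves only compositions with
    the same [g], so the induction hypothesis applies to the partial derivatives of [f]. *)
Lemma Ck_comp (V : normedModType R) k (U : set V) (U' : set E4) f (g : V -> E4) :
  open U -> (forall x, U x -> U' (g x)) ->
  Ck k U' f -> (forall i, Ck k U (coord4 i \o g)) -> Ck k U (f \o g).
Proof.
move=> oU gU; elim: k f g gU => [|k IH] f g gU Cf Cg.
  move=> x Ux; apply: continuous_comp; last by apply: Cf; exact: gU.
  by apply: continuous_mxP => i; exact: Cg.
have dg x : U x -> differentiable g x.
  by move=> Ux; apply: differentiable_mxP => i; case: (Cg i) => + _; apply.
case: (Cf) => df Df; split=> [x Ux|v].
  by apply: differentiable_comp; [exact: dg|apply/df/gU].
apply: (@Ck_eq _ _ _ _ _ (\sum_i ('D_v (coord4 i \o g)) * ('D_(ebase i) f \o g))) => //.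
  move=> x; rewrite inE => Ux; have dfx := df _ (gU _ Ux).
  have dgx := dg _ Ux.
  rewrite deriveE; last exact: differentiable_comp.
  rewrite diff_comp//= -deriveE// derive_sum_ebase// fct_sumE.
  apply: eq_bigr => i _; rewrite fctE; congr (_ * _).
  rewrite -deriveE// (@derive_mx _ _ _ _ g x v) ?mxE//.
  exact: diff_derivable dgx.
apply: Ck_sum => // i; apply: CkM => //; first by case: (Cg i) => _; apply.
by apply: IH => // [|j]; [exact: Df|exact: CkS (Cg j)].
Qed.

End E4.

(** * Symmetry of second derivatives *)

Section Schwarz.
Context {R : realType} {V : normedModType R}.
Implicit Types (U : set V) (f : V -> R).

Lemma is_derive_line (W : normedModType R) (f : V -> W) (y v : V) (s : R) :
  derivable f (y + s *: v) v ->
  is_derive s 1 (fun t : R => f (y + t *: v)) ('D_v f (y + s *: v)).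
Proof.
move=> df.
have E : (fun h : R => h^-1 *: (((fun t : R => f (y + t *: v)) \o shift s) (h *: 1)
     - f (y + s *: v))) =
  (fun h => h^-1 *: ((f \o shift (y + s *: v)) (h *: v) - f (y + s *: v))).
  apply/funext => h /=; congr (_ *: (f _ - _)).
  by rewrite scalerDl addrCA [h *: 1]mulr1.
by apply: DeriveDef; rewrite /derivable /derive E.
Qed.

Lemma line_mvt f (y v : V) (h : R) : 0 < h ->
  (forall s, 0 <= s <= h -> differentiable f (y + s *: v)) ->
  exists2 c, 0 <= c <= h & f (y + h *: v) - f y = h * 'D_v f (y + c *: v).
Proof.
move=> h0 df.
have dl s : 0 <= s <= h -> is_derive s 1 (fun t : R => f (y + t *: v)) ('D_v f (y + s *: v)).
  by move=> /df dfs; apply: is_derive_line; exact: diff_derivable dfs.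
have [||c] := @MVT_segment R (fun t : R => f (y + t *: v)) (fun t => 'D_v f (y + t *: v)) 0 h (ltW h0).
- by move=> s /[!in_itv]/= /andP[s0 sh]; apply: dl; rewrite !ltW.
- apply: derivable_within_continuous => s /[!in_itv]/= sh.
  by have [] := dl _ sh.
move=> /[!in_itv]/= ch; rewrite scale0r addr0 subr0 => ->.
by exists c => //; rewrite mulrC.
Qed.

(** The mean value theorem is applied twice: in the direction [u] to the increment [g] of [f] along
    [h *: v], then in the direction [v] to ['D_u f]. *)
Lemma second_difference U f (x u v : V) (h : R) : 0 < h -> Ck 2 U f ->
  (forall s t, 0 <= s <= h -> 0 <= t <= h -> U (x + s *: u + t *: v)) ->
  exists s t, [/\ 0 <= s <= h, 0 <= t <= h &
    f (x + h *: u + h *: v) - f (x + h *: u) - (f (x + h *: v) - f x)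
    = h * (h * 'D_v ('D_u f) (x + s *: u + t *: v))].
Proof.
move=> h0 [df Df] Uh.
have h0h : 0 <= h <= h by rewrite ltW//=.
have z0h : 0 <= (0 : R) <= h by rewrite lexx ltW.
pose g (y : V) := f (y + h *: v) - f y.
have dg s : 0 <= s <= h -> is_derive s 1 (fun t : R => g (x + t *: u))
    ('D_u f (x + s *: u + h *: v) - 'D_u f (x + s *: u)).
  move=> sh; rewrite /g; apply: is_deriveB.
    have -> : (fun t : R => f (x + t *: u + h *: v)) = (fun t : R => f (x + h *: v + t *: u)).
      by apply/funext => t; rewrite addrAC.
    rewrite addrAC; apply: is_derive_line.
    by apply: diff_derivable; apply: df; rewrite addrAC; exact: Uh.
  apply: is_derive_line; apply: diff_derivable; apply: df.
  by have := Uh _ _ sh z0h; rewrite scale0r addr0.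
have [||s] := @MVT_segment R (fun t : R => g (x + t *: u))
  (fun s => 'D_u f (x + s *: u + h *: v) - 'D_u f (x + s *: u)) 0 h (ltW h0).
- by move=> s /[!in_itv]/= /andP[s0 sh]; apply: dg; rewrite !ltW.
- apply: derivable_within_continuous => s /[!in_itv]/= sh.
  by have [] := dg _ sh.
move=> /[!in_itv]/= sh; rewrite scale0r addr0 subr0 => gE.
have [|t th tE] := @line_mvt ('D_u f) (x + s *: u) v h h0.
  by move=> t th; case: (Df u) => + _; apply; exact: Uh.
exists s, t; split => //.
by rewrite -tE [RHS]mulrC -gE.
Qed.

Lemma derive_commute U f (x u v : V) : open U -> U x -> Ck 2 U f ->
  'D_u ('D_v f) x = 'D_v ('D_u f) x.
Proof.
move=> oU Ux Cf.
have [_ Df] := Cf.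
have cuv : {for x, continuous ('D_u ('D_v f))} by exact: (Df v).2 u x Ux.
have cvu : {for x, continuous ('D_v ('D_u f))} by exact: (Df u).2 v x Ux.
apply/eqP; rewrite -subr_eq0 -normr_le0; apply/ler_addgt0Pl => e e0; rewrite addr0.
have e20 : 0 < e / 2 by rewrite divr_gt0.
have N1 : nbhs x U by exact: open_nbhs_nbhs.
have N2 : nbhs x [set y | `|'D_u ('D_v f) x - 'D_u ('D_v f) y| < e / 2].
  by apply: (cvgrPdist_lt _ _).1 e20; exact: cuv.
have N3 : nbhs x [set y | `|'D_v ('D_u f) x - 'D_v ('D_u f) y| < e / 2].
  by apply: (cvgrPdist_lt _ _).1 e20; exact: cvu.
have NN := filterI N1 (filterI N2 N3).
have [d /= d0 dP] := (nbhs_ballP _ _).1 (NN _ _).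
(* The summand 1 keeps the denominator positive when [u] and [v] vanish; the factor 1/2 makes the
   estimate in [small] strict. *)
pose h := d / (`|u| + `|v| + 1) / 2.
have n0 : 0 < `|u| + `|v| + 1 by rewrite ltr_wpDl// addr_ge0.
have h0 : 0 < h by rewrite !divr_gt0.
have small s t : 0 <= s <= h -> 0 <= t <= h -> ball x d (x + s *: u + t *: v).
  move=> /andP[s0 sh] /andP[t0 th]; rewrite -ball_normE/= -addrA opprD addrA subrr add0r normrN.
  rewrite (le_lt_trans (ler_normD _ _))// !normrZ !ger0_norm//.
  apply: (@le_lt_trans _ _ (h * (`|u| + `|v| + 1))).
    rewrite !mulrDr mulr1 -[leLHS]addr0 lerD ?(ltW h0)// lerD// ler_wpM2r//.
  by rewrite /h mulrAC divfK ?gt_eqF// ltr_pdivrMr// ltr_pMr// ltr1n.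
have Uuv s t : 0 <= s <= h -> 0 <= t <= h -> U (x + s *: u + t *: v).
  by move=> sh th; have [] := dP _ (small _ _ sh th).
have Uvu s t : 0 <= s <= h -> 0 <= t <= h -> U (x + s *: v + t *: u).
  by move=> sh th; rewrite addrAC; exact: Uuv.
have [s [t [sh th E1]]] := second_difference h0 Cf Uuv.
have [s' [t' [sh' th' E2]]] := second_difference h0 Cf Uvu.
(* The second difference is symmetric in [u] and [v]: the two mixed derivatives, taken at two points
   near [x], are equal after cancelling [h] twice. *)
have := E1; rewrite [x + h *: u + _]addrAC.
have -> (a b c d' : R) : a - b - (c - d') = a - c - (b - d') by ring.
rewrite E2 => /(mulfI (lt0r_neq0 h0)) /(mulfI (lt0r_neq0 h0)) E.
have [_ [_ B1]] := dP _ (small _ _ sh th).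
have := small _ _ th' sh'; rewrite addrAC => /dP[_ [B2 _]].
set A := 'D_u _ x; set B := 'D_v _ x.
have -> : A - B = (A - 'D_u ('D_v f) (x + s' *: v + t' *: u))
    - (B - 'D_v ('D_u f) (x + s *: u + t *: v)) by rewrite E; ring.
rewrite (splitr e).
exact: le_trans (ler_normB _ _) (ltW (ltrD B2 B1)).
Qed.

End Schwarz.

(** * The left invariant frame *)

Section SmoothFun.
Context {R : realType}.
Local Notation E4 := 'cV[R]_4.
Implicit Types (f g : E4 -> R) (x v : E4).

(** The domain of the radial extensions of functions on the sphere. *)
Definition U0 : set E4 := [set x | x != 0].

Definition smooth f := smooth_on U0 f.

Lemma open_U0 : open U0.
Proof.
have -> : U0 = ~` [set 0] by apply/seteqP; split => x /eqP.
by rewrite openC; apply: accessible_closed_set1; exact/hausdorff_accessible/norm_hausdorff.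
Qed.

Lemma smoothD f g : smooth f -> smooth g -> smooth (f + g).
Proof. by move=> sf sg k; apply: CkD; [exact: open_U0|exact: sf|exact: sg]. Qed.

Lemma smoothM f g : smooth f -> smooth g -> smooth (f * g).
Proof. by move=> sf sg k; apply: CkM; [exact: open_U0|exact: sf|exact: sg]. Qed.

Lemma smooth_cst (a : R) : smooth (cst a).
Proof. by move=> k; exact: Ck_cst. Qed.

Lemma smoothN f : smooth f -> smooth (- f).
Proof.
have -> : - f = cst (-1) * f by apply/funext => x; rewrite !fctE mulN1r.
by apply: smoothM; exact: smooth_cst.
Qed.

Lemma smooth_coord i : smooth (coord4 i).
Proof. by move=> k; exact: Ck_coord4. Qed.

Lemma smooth_eq f g : {in U0, f =1 g} -> smooth f -> smooth g.
Proof. by move=> fg sf k; apply: Ck_eq (sf k) => //; exact: open_U0. Qed.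

Lemma smooth_differentiable f x : smooth f -> U0 x -> differentiable f x.
Proof. by move=> sf; have [+ _] := sf 1%N; apply. Qed.

Lemma smooth_derivable f x v : smooth f -> U0 x -> derivable f x v.
Proof. by move=> sf Ux; exact: diff_derivable (smooth_differentiable sf Ux). Qed.

Lemma smooth_derive f v : smooth f -> smooth ('D_v f).
Proof. by move=> sf k; have [_ +] := sf k.+1; apply. Qed.

Lemma smooth_continuous f x : smooth f -> U0 x -> {for x, continuous f}.
Proof. by move=> sf Ux; exact: (sf 0%N). Qed.

Definition Lie (a : 'I_3) f : E4 -> R := fun x => 'D_(frame a x) f x.

Lemma frame0E x : frame 0 x = imul x. Proof. by []. Qed.
Lemma frame1E x : frame 1 x = jmul x. Proof. by []. Qed.
Lemma frame2E x : frame 2 x = kmul x. Proof. by []. Qed.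

Lemma I3P (P : 'I_3 -> Prop) : P 0 -> P 1 -> P 2 -> forall i, P i.
Proof.
move=> P0 P1 P2 [[|[|[|//]]] i].
- by have -> : Ordinal i = 0 by exact: val_inj.
- by have -> : Ordinal i = 1 by exact: val_inj.
- by have -> : Ordinal i = 2 by exact: val_inj.
Qed.

Lemma I4P (P : 'I_4 -> Prop) : P 0 -> P 1 -> P 2 -> P 3 -> forall i, P i.
Proof.
move=> P0 P1 P2 P3 [[|[|[|[|//]]]] i].
- by have -> : Ordinal i = 0 by exact: val_inj.
- by have -> : Ordinal i = 1 by exact: val_inj.
- by have -> : Ordinal i = 2 by exact: val_inj.
- by have -> : Ordinal i = 3 by exact: val_inj.
Qed.

Lemma sum4E (V : nmodType) (F : 'I_4 -> V) : \sum_i F i = F 0 + F 1 + F 2 + F 3.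
Proof.
rewrite !big_ord_recr big_ord0 /= add0r.
by do ![congr (_ + _)]; congr (F _); exact/val_inj.
Qed.

Lemma sum3E (V : nmodType) (F : 'I_3 -> V) : \sum_i F i = F 0 + F 1 + F 2.
Proof.
rewrite !big_ord_recr big_ord0 /= add0r.
by do ![congr (_ + _)]; congr (F _); exact/val_inj.
Qed.

Lemma E4_eq x v : x 0 0 = v 0 0 -> x 1 0 = v 1 0 -> x 2 0 = v 2 0 ->
  x 3 0 = v 3 0 -> x = v.
Proof. by move=> ? ? ? ?; apply/matrixP => i j; rewrite ord1; move: i; apply: I4P. Qed.

Local Notation d_ i f := ('D_(ebase i) f).

Lemma derive4E f x v : smooth f -> U0 x -> 'D_v f x =
  v 0 0 * d_ 0 f x + v 1 0 * d_ 1 f x + v 2 0 * d_ 2 f x + v 3 0 * d_ 3 f x.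
Proof. by move=> sf Ux; rewrite derive_sum_ebase ?sum4E//; exact: smooth_differentiable. Qed.

Definition frame_coord (a : 'I_3) (i : 'I_4) : E4 -> R := fun x => frame a x i 0.

Lemma frame_coordE :
  (frame_coord 0 0 = - coord4 1) * (frame_coord 0 1 = coord4 0) *
  (frame_coord 0 2 = - coord4 3) * (frame_coord 0 3 = coord4 2) *
  (frame_coord 1 0 = - coord4 2) * (frame_coord 1 1 = coord4 3) *
  (frame_coord 1 2 = coord4 0) * (frame_coord 1 3 = - coord4 1) *
  (frame_coord 2 0 = - coord4 3) * (frame_coord 2 1 = - coord4 2) *
  (frame_coord 2 2 = coord4 1) * (frame_coord 2 3 = coord4 0).
Proof.
by do ![split]; apply/funext => x; rewrite /frame_coord ?frame0E ?frame1E ?frame2E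
  /imul /jmul /kmul vec4E.
Qed.

Lemma smooth_frame_coord a i : smooth (frame_coord a i).
Proof.
by move: a i; apply: I3P; apply: I4P; rewrite frame_coordE;
  do ?apply: smoothN; exact: smooth_coord.
Qed.

Lemma LieE a f x : smooth f -> U0 x -> Lie a f x =
  (frame_coord a 0 * d_ 0 f + frame_coord a 1 * d_ 1 f
   + frame_coord a 2 * d_ 2 f + frame_coord a 3 * d_ 3 f) x.
Proof. by move=> sf Ux; rewrite /Lie derive4E. Qed.

Lemma Lie_eq a f g x : {in U0, f =1 g} -> U0 x -> Lie a f x = Lie a g x.
Proof.
by move=> fg Ux; apply: near_eq_derive; exact: (open_near_eq open_U0 Ux fg).
Qed.

Lemma smooth_Lie a f : smooth f -> smooth (Lie a f).
Proof.
move=> sf; apply: (@smooth_eq (frame_coord a 0 * d_ 0 f + frame_coord a 1 * d_ 1 f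
   + frame_coord a 2 * d_ 2 f + frame_coord a 3 * d_ 3 f)).
  by move=> x; rewrite inE => Ux; rewrite LieE.
by do !apply: smoothD; apply: smoothM; (exact: smooth_frame_coord || exact: smooth_derive).
Qed.

Section rules.
Variables (a : 'I_3) (x : E4).
Hypothesis Ux : U0 x.

Lemma LieD f g : smooth f -> smooth g -> Lie a (f + g) x = Lie a f x + Lie a g x.
Proof. by move=> sf sg; rewrite /Lie deriveD//; exact: smooth_derivable. Qed.

Lemma LieN f : smooth f -> Lie a (- f) x = - Lie a f x.
Proof. by move=> sf; rewrite /Lie deriveN//; exact: smooth_derivable. Qed.

Lemma LieM f g : smooth f -> smooth g ->
  Lie a (f * g) x = f x * Lie a g x + g x * Lie a f x.
Proof. by move=> sf sg; rewrite /Lie deriveM//; exact: smooth_derivable. Qed.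

Lemma Lie_cst (c : R) : Lie a (cst c) x = 0.
Proof. by rewrite /Lie derive_cst. Qed.

Lemma Lie_coord i : Lie a (coord4 i) x = frame_coord a i x.
Proof. by have [] := is_derive_coord4 i x (frame a x). Qed.

End rules.

(** The second order terms of the commutator cancel by [derive_commute]; what remains is the
    derivative along the bracket of the two fields. *)
Lemma Lie_comm_aux a b f x : smooth f -> U0 x ->
  Lie a (Lie b f) x - Lie b (Lie a f) x =
  (Lie a (frame_coord b 0) x - Lie b (frame_coord a 0) x) * d_ 0 f x +
  (Lie a (frame_coord b 1) x - Lie b (frame_coord a 1) x) * d_ 1 f x +
  (Lie a (frame_coord b 2) x - Lie b (frame_coord a 2) x) * d_ 2 f x +
  (Lie a (frame_coord b 3) x - Lie b (frame_coord a 3) x) * d_ 3 f x.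
Proof.
move=> sf Ux.
have LL c e : Lie c (Lie e f) x = Lie c (frame_coord e 0 * d_ 0 f + frame_coord e 1 * d_ 1 f
   + frame_coord e 2 * d_ 2 f + frame_coord e 3 * d_ 3 f) x.
  by apply: Lie_eq => // y; rewrite inE => Uy; rewrite LieE.
have sd i : smooth (d_ i f) by exact: smooth_derive.
have sc c i : smooth (frame_coord c i) by exact: smooth_frame_coord.
have sm c i : smooth (frame_coord c i * d_ i f) by exact: smoothM.
have sm2 c i j : smooth (frame_coord c i * d_ i f + frame_coord c j * d_ j f) by exact: smoothD.
have sm3 c i j k :
    smooth (frame_coord c i * d_ i f + frame_coord c j * d_ j f + frame_coord c k * d_ k f).
  exact: smoothD.
have dd i j : d_ i (d_ j f) x = d_ j (d_ i f) x.
  exact: (@derive_commute R E4 U0 f x (ebase i) (ebase j) open_U0 Ux (sf 2%N)).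
have LE c e : Lie c (Lie e f) x =
    (frame_coord e 0 x * Lie c (d_ 0 f) x + d_ 0 f x * Lie c (frame_coord e 0) x) +
    (frame_coord e 1 x * Lie c (d_ 1 f) x + d_ 1 f x * Lie c (frame_coord e 1) x) +
    (frame_coord e 2 x * Lie c (d_ 2 f) x + d_ 2 f x * Lie c (frame_coord e 2) x) +
    (frame_coord e 3 x * Lie c (d_ 3 f) x + d_ 3 f x * Lie c (frame_coord e 3) x).
  rewrite LL (LieD _ Ux (sm3 e 0 1 2) (sm e 3)) (LieD _ Ux (sm2 e 0 1) (sm e 2)).
  rewrite (LieD _ Ux (sm e 0) (sm e 1)).
  by do !congr (_ + _); rewrite LieM//.
have Ld c i : Lie c (d_ i f) x =
    frame_coord c 0 x * d_ 0 (d_ i f) x + frame_coord c 1 x * d_ 1 (d_ i f) x +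
    frame_coord c 2 x * d_ 2 (d_ i f) x + frame_coord c 3 x * d_ 3 (d_ i f) x.
  by rewrite LieE.
(* The same computation with all derivatives replaced by variables, so that [ring] works on plain
   polynomials; [H] is the Hessian. *)
have key (D : 'I_4 -> R) (LF : 'I_3 -> 'I_3 -> 'I_4 -> R) (F DD : 'I_3 -> 'I_4 -> R)
    (H : 'I_4 -> 'I_4 -> R) (L : 'I_3 -> 'I_3 -> R) :
    (forall i j, H i j = H j i) ->
    (forall c i, DD c i = F c 0 * H 0 i + F c 1 * H 1 i + F c 2 * H 2 i + F c 3 * H 3 i) ->
    (forall c e, L c e = (F e 0 * DD c 0 + D 0 * LF c e 0) +
      (F e 1 * DD c 1 + D 1 * LF c e 1) + (F e 2 * DD c 2 + D 2 * LF c e 2) +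
      (F e 3 * DD c 3 + D 3 * LF c e 3)) ->
    L a b - L b a = (LF a b 0 - LF b a 0) * D 0 + (LF a b 1 - LF b a 1) * D 1 +
      (LF a b 2 - LF b a 2) * D 2 + (LF a b 3 - LF b a 3) * D 3.
  move=> Hs DDE LE'; rewrite !LE' !DDE.
  rewrite (Hs 1 0) (Hs 2 0) (Hs 3 0) (Hs 2 1) (Hs 3 1) (Hs 3 2); ring.
exact: (key (fun i => d_ i f x) (fun c e i => Lie c (frame_coord e i) x)
  (fun c i => frame_coord c i x) (fun c i => Lie c (d_ i f) x)
  (fun i j => d_ i (d_ j f) x) (fun c e => Lie c (Lie e f) x) dd Ld LE).
Qed.

(** The linear fields x -> A x and x -> B x have bracket x -> (B A - A B) x; for the quaternions i
    and j this is (j i - i j) x = - 2 k x. *)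
Lemma Lie_comm01 f x : smooth f -> U0 x ->
  Lie 0 (Lie 1 f) x - Lie 1 (Lie 0 f) x = - 2 * Lie 2 f x.
Proof.
move=> sf Ux; rewrite Lie_comm_aux// [Lie 2 f x]LieE// !frame_coordE !LieN//;
  try exact: smooth_coord.
rewrite !Lie_coord !frame_coordE !fctE.
by move: (d_ 0 f x) (d_ 1 f x) (d_ 2 f x) (d_ 3 f x) => *; ring.
Qed.

Lemma Lie_comm12 f x : smooth f -> U0 x ->
  Lie 1 (Lie 2 f) x - Lie 2 (Lie 1 f) x = - 2 * Lie 0 f x.
Proof.
move=> sf Ux; rewrite Lie_comm_aux// [Lie 0 f x]LieE// !frame_coordE !LieN//;
  try exact: smooth_coord.
rewrite !Lie_coord !frame_coordE !fctE.
by move: (d_ 0 f x) (d_ 1 f x) (d_ 2 f x) (d_ 3 f x) => *; ring.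
Qed.

Lemma Lie_comm20 f x : smooth f -> U0 x ->
  Lie 2 (Lie 0 f) x - Lie 0 (Lie 2 f) x = - 2 * Lie 1 f x.
Proof.
move=> sf Ux; rewrite Lie_comm_aux// [Lie 1 f x]LieE// !frame_coordE !LieN//;
  try exact: smooth_coord.
rewrite !Lie_coord !frame_coordE !fctE.
by move: (d_ 0 f x) (d_ 1 f x) (d_ 2 f x) (d_ 3 f x) => *; ring.
Qed.

End SmoothFun.

(** * Radial extension of functions on the sphere *)

Section Retract.
Context {R : realType}.
Local Notation E4 := 'cV[R]_4.
Local Notation U0 := (@U0 R).
Implicit Types (f g : E4 -> R) (x v : E4).

Lemma scalerE (a b : R) : a *: (b : R) = a * b. Proof. by []. Qed.

Lemma dot_ge0 x : 0 <= dot x x.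
Proof. by rewrite dot4 -!expr2 !addr_ge0// sqr_ge0. Qed.

Lemma dot_gt0 x : U0 x -> 0 < dot x x.
Proof.
move=> x0; rewrite lt_neqAle dot_ge0 andbT eq_sym; apply: contra x0.
rewrite dot4 -!expr2 => /eqP d0; apply/eqP/E4_eq; rewrite mxE;
  apply/eqP; rewrite -sqrf_eq0; apply/eqP; move: d0;
  have := sqr_ge0 (x 0 0); have := sqr_ge0 (x 1 0);
  have := sqr_ge0 (x 2 0); have := sqr_ge0 (x 3 0); lra.
Qed.

Lemma dotZr (a : R) x v : dot x (a *: v) = a * dot x v.
Proof. by rewrite dotC dotZl dotC. Qed.

Lemma dotDr x y v : dot x (y + v) = dot x y + dot x v.
Proof. by rewrite dotC dotDl !(dotC x). Qed.

Lemma dotNr x y : dot x (- y) = - dot x y.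
Proof. by rewrite -scaleN1r dotZr mulN1r. Qed.

Lemma S3_U0 x : S3 x -> U0 x.
Proof. by rewrite /S3/= => dx; apply/eqP => x0; move/eqP: dx; rewrite x0 dot0l eq_sym oner_eq0. Qed.

Definition dotf (F G : E4 -> E4) : E4 -> R :=
  \sum_i (coord4 i \o F) * (coord4 i \o G).

Lemma dotfE F G x : dotf F G x = dot (F x) (G x).
Proof. by rewrite /dotf fct_sumE. Qed.

Definition invnorm : E4 -> R := fun x => (Num.sqrt (dot x x))^-1.

Lemma smooth_dotid : smooth (dotf id id).
Proof.
by move=> k; apply: Ck_sum => [|i]; [exact: open_U0|]; apply: smoothM; exact: smooth_coord.
Qed.

Lemma is_derive_dotid x v : is_derive x v (dotf id id) (2 * dot x v).
Proof.
have dc i := is_derive_coord4 i x v.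
rewrite /dotf; apply: is_derive_eq.
by rewrite /dot mulr_sumr; apply: eq_bigr => i _; rewrite /coord4 !fctE !scalerE; ring.
Qed.

Lemma is_derive_invsqrt (t : R) : 0 < t ->
  is_derive t 1 (fun s => (Num.sqrt s)^-1) (- 2^-1 * (Num.sqrt t)^-1 ^+ 3).
Proof.
move=> t0; have [dsq vsq] := is_derive1_sqrt t0.
have st0 : Num.sqrt t != 0 by rewrite sqrtr_eq0 -ltNge.
apply: DeriveDef; first exact: derivableV st0 dsq.
rewrite (deriveV st0 dsq) vsq !scalerE; field; by [].
Qed.

Lemma is_derive_invnorm x v : U0 x ->
  is_derive x v invnorm (- dot x v * invnorm x ^+ 3).
Proof.
move=> Ux.
have -> : invnorm = (fun s => (Num.sqrt s)^-1) \o dotf id id.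
  by apply/funext => y; rewrite /= dotfE.
have dq : differentiable (dotf id id) x by apply: smooth_differentiable => //; exact: smooth_dotid.
have [di vi] := is_derive_invsqrt (dot_gt0 Ux).
have dsq : differentiable (fun s : R => (Num.sqrt s)^-1) (dotf id id x).
  by apply/derivable1_diffP; rewrite dotfE; exact: di.
apply: DeriveDef; first by apply: diff_derivable; exact: differentiable_comp.
rewrite deriveE; last exact: differentiable_comp.
have dqE : 'd (dotf id id) x v = 2 * dot x v.
  by rewrite -deriveE//; have [] := is_derive_dotid x v.
rewrite diff_comp//= dqE.
rewrite diff1E; last exact: dsq.
rewrite derive1E dotfE vi !scalerE; field.
by rewrite sqrtr_eq0 -ltNge dot_gt0.
Qed.

(** By [is_derive_invnorm] the derivatives of [invnorm] are polynomials in the coordinates and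
    [invnorm] itself, so each order of regularity yields the next one. *)
Lemma smooth_invnorm : smooth invnorm.
Proof.
have dd x : U0 x -> differentiable invnorm x.
  move=> Ux.
  have -> : invnorm = (fun s => (Num.sqrt s)^-1) \o dotf id id.
    by apply/funext => y; rewrite /= dotfE.
  apply: differentiable_comp.
    by apply: smooth_differentiable => //; exact: smooth_dotid.
  apply/derivable1_diffP; rewrite dotfE.
  by have [] := is_derive_invsqrt (dot_gt0 Ux).
elim=> [|k IH]; first by move=> x Ux; apply: differentiable_continuous; exact: dd.
split=> // v.
apply: (@Ck_eq _ _ _ _ _ (- dotf id (cst v) * (invnorm * (invnorm * invnorm)))).
- exact: open_U0.
- move=> x; rewrite inE => Ux; have [_ ->] := is_derive_invnorm v Ux.
  by rewrite !fctE dotfE; ring.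
have oU := @open_U0 R.
apply: CkM => //; last by do !apply: CkM.
suff : smooth (- dotf id (cst v)) by exact.
apply: smoothN => j; apply: Ck_sum => // i.
by apply: CkM => //; [exact: Ck_coord4|exact: Ck_cst].
Qed.

Lemma retractE x : retract x = invnorm x *: x. Proof. by []. Qed.

Lemma S3_retract x : U0 x -> S3 (retract x).
Proof.
move=> Ux; rewrite /S3/= retractE dotZl dotZr mulrA -expr2 exprVn sqr_sqrtr ?dot_ge0//.
by rewrite mulVf// gt_eqF// dot_gt0.
Qed.

Lemma retract_S3 x : S3 x -> retract x = x.
Proof. by rewrite /S3/= retractE /invnorm => ->; rewrite sqrtr1 invr1 scale1r. Qed.

Lemma retractZ (l : R) x : 0 < l -> retract (l *: x) = retract x.
Proof.
move=> l0; rewrite !retractE /invnorm dotZl dotZr mulrA -expr2 sqrtrM ?sqr_ge0//.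
rewrite sqrtr_sqr gtr0_norm// invfM scalerA mulrAC mulVf ?mul1r// gt_eqF//.
Qed.

Lemma coord_retract i : coord4 i \o retract = invnorm * coord4 i.
Proof. by apply/funext => x; rewrite /coord4/= retractE mxE. Qed.

(** The local extensions that define [smoothS3] are turned into a single global one: near [x] the
    radial extension coincides with [F \o retract], for a local extension [F] at [retract x]. *)
Lemma smooth_retract f : smoothS3 f -> smooth (f \o retract).
Proof.
move=> sf k; apply: Ck_local => x Ux.
have [V [F [oV Vx sF Ff]]] := sf _ (S3_retract Ux).
have Ckr U' i : U' `<=` U0 -> Ck k U' (coord4 i \o retract).
  rewrite coord_retract => U'U; apply: Ck_subset U'U _.
  by apply: smoothM; [exact: smooth_invnorm|exact: smooth_coord].
have cr y : U0 y -> {for y, continuous (@retract R)}.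
  move=> Uy; apply: continuous_mxP => i; rewrite coord_retract.
  by apply: smooth_continuous => //; apply: smoothM; [exact: smooth_invnorm|exact: smooth_coord].
pose U' := U0 `&` retract @^-1` V.
have oU' : open U'.
  rewrite openE => y [Uy Vy]; apply: filterI.
    by apply: open_nbhs_nbhs; split => //; exact: open_U0.
  by apply: (cr _ Uy); apply: open_nbhs_nbhs.
exists U'; split; first by [].
apply: (@Ck_eq _ _ _ _ _ (F \o retract)) => //.
  by move=> y; rewrite inE => -[Uy Vy] /=; rewrite Ff//; exact: S3_retract.
apply: (@Ck_comp _ _ _ _ V) => //; first by move=> y [].
by move=> i; apply: Ckr => y [].
Qed.

Lemma Ck_coord_comp k (U : set E4) (F : E4 -> E4) i : open U ->
  Ck k U F -> Ck k U (coord4 i \o F).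
Proof.
move=> oU; elim: k F => [|k IH] F.
  move=> cF x Ux; apply: continuous_comp; first exact: cF.
  by apply: differentiable_continuous; exact: differentiable_coord.
move=> [dF DF]; split=> [x Ux|v].
  by apply: differentiable_comp; [exact: dF|exact: differentiable_coord].
apply: (@Ck_eq _ _ _ _ _ (coord4 i \o 'D_v F)) => //; last exact: IH (DF v).
move=> x; rewrite inE => Ux; rewrite /= (@derive_mx _ _ _ _ F x v).
  by rewrite /coord4 mxE.
exact: diff_derivable (dF x Ux).
Qed.

Lemma smoothS3_dot (F G : E4 -> E4) : smoothS3 F -> smoothS3 G ->
  smoothS3 (fun x => dot (F x) (G x)).
Proof.
move=> sF sG p Sp; have [U [F' [oU Up sF' FE]]] := sF p Sp.
have [V [G' [oV Vp sG' GE]]] := sG p Sp.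
exists (U `&` V), (dotf F' G'); split => //.
- exact: openI.
- move=> k; apply: Ck_sum => [|i]; first exact: openI.
  apply: CkM; first exact: openI.
    by apply: Ck_coord_comp; [exact: openI|apply: Ck_subset (sF' k) => x []].
  by apply: Ck_coord_comp; [exact: openI|apply: Ck_subset (sG' k) => x []].
by move=> x [Ux Vx] Sx; rewrite dotfE FE// GE.
Qed.

Lemma Ck_mx k (U : set E4) (F : E4 -> E4) : open U ->
  (forall i, Ck k U (coord4 i \o F)) -> Ck k U F.
Proof.
move=> oU; elim: k F => [|k IH] F CF.
  by move=> x Ux; apply: continuous_mxP => i; exact: CF.
have dF x : U x -> differentiable F x.
  by move=> Ux; apply: differentiable_mxP => i; have [+ _] := CF i; apply.
split=> // v; apply: IH => i.
apply: (@Ck_eq _ _ _ _ _ ('D_v (coord4 i \o F))) => //.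
  move=> x; rewrite inE => Ux; rewrite /= (@derive_mx _ _ _ _ F x v).
    by rewrite /coord4 mxE.
  exact: diff_derivable (dF x Ux).
by have [_] := CF i; apply.
Qed.

Lemma smoothS3_coords (F : E4 -> E4) : (forall i, smooth (coord4 i \o F)) -> smoothS3 F.
Proof.
move=> sF p Sp; exists U0, F; split => //.
- exact: open_U0.
- exact: S3_U0.
- by move=> k; apply: Ck_mx => [|i]; [exact: open_U0|exact: sF].
Qed.

Lemma smoothS3_frame a : smoothS3 (@frame R a).
Proof. by apply: smoothS3_coords => i; exact: smooth_frame_coord. Qed.

(** The property of radial extensions that survives differentiation: the frame being homogeneous of
    degree 1, [Lie] preserves it, and such functions are determined on the punctured space by their
    values on the sphere. *)
Definition hom0 f := forall (l : R) x, 0 < l -> f (l *: x) = f x.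

Lemma hom0_retract f : hom0 (f \o retract).
Proof. by move=> l x l0 /=; rewrite retractZ. Qed.

Lemma frameZ a (l : R) x : frame a (l *: x) = l *: frame a x.
Proof.
move: a; apply: I3P; apply: E4_eq;
  rewrite ?frame0E ?frame1E ?frame2E /imul /jmul /kmul !mxE/= ?mulrN//.
Qed.

Lemma hom0_Lie a f : hom0 f -> hom0 (Lie a f).
Proof.
move=> hf l x l0; rewrite /Lie frameZ /derive.
suff -> : (fun h : R => h^-1 *: ((f \o shift (l *: x)) (h *: (l *: frame a x)) - f (l *: x)))
  = (fun h => h^-1 *: ((f \o shift x) (h *: frame a x) - f x)) by [].
by apply/funext => h /=; rewrite (hf l x l0) scalerA mulrC -scalerA -scalerDr hf.
Qed.

Lemma hom0_U0 f x : hom0 f -> U0 x -> f (retract x) = f x.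
Proof.
move=> hf Ux; rewrite retractE hf// invr_gt0 sqrtr_gt0; exact: dot_gt0.
Qed.

(* x and the frame at x form a basis of E4. *)
Lemma derive_frame_eq0 f x v : smooth f -> hom0 f -> U0 x ->
  (forall a, Lie a f x = 0) -> 'D_v f x = 0.
Proof.
move=> sf hf Ux L0.
have D0 : 'D_x f x = 0.
  rewrite /derive; apply: lim_near_cst => //; near=> h.
  have hE : h *: x + x = (h + 1) *: x by rewrite scalerDl scale1r.
  rewrite /= hE hf ?subrr ?scaler0//.
  have : `|h| < 1 by near: h; exact: dnbhs0_lt.
  by rewrite ltr_norml => /andP[]; rewrite -subr_gt0 opprK.
have n0 : dot x x != 0 by rewrite gt_eqF// dot_gt0.
have vE : dot x x *: v = dot v x *: x + dot v (frame 0 x) *: frame 0 x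
    + dot v (frame 1 x) *: frame 1 x + dot v (frame 2 x) *: frame 2 x.
  by apply: E4_eq; rewrite frame0E frame1E frame2E !mxE !dot4 !vec4E/= -?[nth _ _ _]/(- _);
    ring.
have -> : v = (dot x x)^-1 *: (dot x x *: v) by rewrite scalerA mulVf ?scale1r.
have df : differentiable f x := smooth_differentiable sf Ux.
have L0' a : 'd f x (frame a x) = 0 by rewrite -deriveE//; exact: L0.
have D0' : 'd f x x = 0 by rewrite -deriveE.
rewrite vE deriveE// !(linearD, linearZ)/= !L0' D0'.
by rewrite !scaler0 !addr0 scaler0.
Unshelve. all: by end_near. Qed.

(** The mean value theorem applies along segments that avoid the origin, which is the case when the
    endpoints have a nonnegative inner product. Two arbitrary points are joined through [frame 0 x]
    or its opposite: both are orthogonal to [x], and one of them has a nonnegative inner product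
    with [y]. *)
Lemma cst_of_Lie f : smooth f -> hom0 f ->
  (forall a x, U0 x -> Lie a f x = 0) -> forall x y, U0 x -> U0 y -> f x = f y.
Proof.
move=> sf hf L0.
have D0 x v : U0 x -> 'D_v f x = 0.
  by move=> Ux; apply: derive_frame_eq0 => // a; exact: L0.
have seg x y : (forall s : R, 0 <= s <= 1 -> U0 (x + s *: (y - x))) -> f y = f x.
  move=> Us; have [|c cE] := @line_mvt R E4 f x (y - x) 1 ltr01.
    by move=> s /Us; exact: smooth_differentiable.
  by rewrite scale1r (addrC x) subrK D0 ?mulr0; [move/subr0_eq|exact: Us].
have nperp x y : U0 x -> U0 y -> 0 <= dot x y -> f y = f x.
  move=> Ux Uy xy; apply: seg => s /andP[s0 s1].
  rewrite /U0/=; apply/eqP => e0.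
  have : dot (x + s *: (y - x)) (x + s *: (y - x)) = 0 by rewrite e0 dot0l.
  rewrite -[y - x]/(y + - x) !(dotDl, dotDr, dotZl, dotZr, dotNr) !(dotC (- x)) !dotNr.
  rewrite [dot y x]dotC.
  have := dot_gt0 Ux; have := dot_gt0 Uy; move: xy s0 s1.
  move: (dot x x) (dot y y) (dot x y) => p q r r0 s0 s1 q0 p0 E.
  have E2 : (1 - s) ^+ 2 * p + 2 * (s * (1 - s)) * r + s ^+ 2 * q = 0 by rewrite -[RHS]E; ring.
  have A : 0 <= 2 * (s * (1 - s)) * r by rewrite !mulr_ge0// subr_ge0.
  have B : 0 <= (1 - s) ^+ 2 * p by rewrite mulr_ge0 ?sqr_ge0// ltW.
  have C : 0 <= s ^+ 2 * q by rewrite mulr_ge0 ?sqr_ge0// ltW.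
  have /eqP : s ^+ 2 * q = 0 by lra.
  rewrite mulf_eq0 (gt_eqF q0) orbF sqrf_eq0 => /eqP s00.
  by move: E2; rewrite s00; lra.
move=> x y Ux Uy.
have Fx : dot x (frame 0 x) = 0.
  by rewrite dot4 frame0E /imul !vec4E; ring.
have Fxx : dot (frame 0 x) (frame 0 x) = dot x x.
  by rewrite !dot4 frame0E /imul !vec4E; ring.
have UF : U0 (frame 0 x).
  by rewrite /U0/=; apply: contraTneq (dot_gt0 Ux) => F0; rewrite -Fxx F0 dot0l ltxx.
have UNF : U0 (- frame 0 x) by rewrite /U0/= oppr_eq0.
have [yF|yF] := leP 0 (dot (frame 0 x) y).
  by rewrite (nperp _ _ UF Uy yF) (nperp _ _ Ux UF)// Fx.
have yF' : 0 <= dot (- frame 0 x) y by rewrite dotC dotNr dotC oppr_ge0 ltW.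
by rewrite (nperp _ _ UNF Uy yF') (nperp _ _ Ux UNF)// dotNr Fx oppr0.
Qed.

End Retract.

(** * The Levi-Civita connection in the frame *)

Section LeviCivita.
Context {R : realType}.
Local Notation E4 := 'cV[R]_4.
Local Notation U0 := (@U0 R).
Implicit Types (f g : E4 -> R) (x v p : E4).

(** The point [p] and the frame at [p] are pairwise orthogonal of common length |p|; the factor
    [dot p p] makes this a polynomial identity valid for all [p]. *)
Lemma parseval p v w : dot p p * dot v w = dot v p * dot w p
  + dot v (frame 0 p) * dot w (frame 0 p)
  + dot v (frame 1 p) * dot w (frame 1 p)
  + dot v (frame 2 p) * dot w (frame 2 p).
Proof. by rewrite frame0E frame1E frame2E !dot4 !vec4E; ring. Qed.

Lemma frame_tangent p a : dot p (frame a p) = 0.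
Proof.
by move: a; apply: I3P; rewrite ?frame0E ?frame1E ?frame2E dot4 !vec4E; ring.
Qed.

Lemma vector_field_frame a : vector_field (@frame R a).
Proof. by split; [exact: smoothS3_frame|move=> p _; exact: frame_tangent]. Qed.

Lemma Lie_invnorm a x : U0 x -> Lie a invnorm x = 0.
Proof.
move=> Ux; have [_] := is_derive_invnorm (frame a x) Ux.
by rewrite frame_tangent oppr0 mul0r.
Qed.

Lemma derive_invnormM f p v : smooth f -> S3 p -> tangent p v ->
  'D_v (invnorm * f) p = 'D_v f p.
Proof.
move=> sf Sp tv; have Up := S3_U0 Sp.
have [di vi] := is_derive_invnorm v Up.
rewrite (deriveM di (@smooth_derivable _ f p v sf Up)).
by rewrite vi tv oppr0 mul0r scaler0 addr0 /invnorm Sp sqrtr1 invr1 scale1r.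
Qed.

Lemma dS3_coord i p v : S3 p -> tangent p v -> dS3 (coord4 i) p v = v i 0.
Proof.
move=> Sp tv; rewrite /dS3 coord_retract derive_invnormM//; last exact: smooth_coord.
by have [] := is_derive_coord4 i p v.
Qed.

Lemma smoothS3_coord i : smoothS3 (@coord4 R i).
Proof.
move=> p Sp; exists U0, (coord4 i); split => //.
- exact: open_U0.
- exact: S3_U0.
- exact: smooth_coord.
Qed.

Lemma Lie_frame_coord a b i x : U0 x ->
  Lie a (frame_coord b i) x = frame_coord b i (frame a x).
Proof.
move=> Ux; move: b i; apply: I3P; apply: I4P; rewrite !frame_coordE ?LieN ?Lie_coord//;
  exact: smooth_coord.
Qed.

Lemma dS3_dS3_coord i a b p : S3 p ->
  dS3 (fun x => dS3 (coord4 i) x (frame b x)) p (frame a p) = frame b (frame a p) i 0.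
Proof.
move=> Sp; have Up := S3_U0 Sp.
rewrite -[RHS]/(frame_coord b i (frame a p)) -Lie_frame_coord//.
rewrite /Lie -(derive_invnormM (smooth_frame_coord b i) Sp (frame_tangent _ _)).
apply: near_eq_derive; apply: (open_near_eq (@open_U0 R) Up) => x; rewrite inE => Ux.
have Sx := S3_retract Ux.
rewrite /= dS3_coord//; last exact: frame_tangent.
by rewrite retractE frameZ mxE.
Qed.

(** The permutation symbol, given by cases so that it computes on concrete indices. *)
Definition eps (a b c : 'I_3) : R :=
  match val a, val b, val c with
  | 0%N, 1%N, 2%N | 1%N, 2%N, 0%N | 2%N, 0%N, 1%N => 1
  | 0%N, 2%N, 1%N | 2%N, 1%N, 0%N | 1%N, 0%N, 2%N => -1
  | _, _, _ => 0
  end.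

Lemma frame_bracket a b d p : S3 p ->
  dot (frame b (frame a p) - frame a (frame b p)) (frame d p) = - 2 * eps a b d.
Proof.
move=> Sp; transitivity (- 2 * eps a b d * dot p p); last by rewrite Sp mulr1.
rewrite dotDl -scaleN1r dotZl; move: a b d {Sp}.
by apply: I3P; apply: I3P; apply: I3P; rewrite /eps/= ?frame0E ?frame1E ?frame2E
   !dot4 /imul /jmul /kmul !vec4E; ring.
Qed.

Variable nabla : @connection R.
Hypothesis nablaLC : levi_civita nabla.

Let nablaC : is_connection nabla. Proof. by case: nablaLC. Qed.

Lemma nabla_tangent a p Y : S3 p -> vector_field Y ->
  dot p (nabla p (frame a p) Y) = 0.
Proof.
move=> Sp vY; have [_] := conn_field nablaC (vector_field_frame a) vY.
exact.
Qed.

Definition christoffel p a b d := dot (nabla p (frame a p) (frame b)) (frame d p).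

(** The inner products of the frame fields are constant, so metric compatibility gives 0 on the
    left. *)
Lemma christoffel_skew p a b d : S3 p -> christoffel p a b d = - christoffel p a d b.
Proof.
move=> Sp; have [_ mc _] := nablaLC.
have := mc p (frame a p) _ _ Sp (frame_tangent _ _) (vector_field_frame b)
  (vector_field_frame d).
have -> : dS3 (fun x => dot (frame b x) (frame d x)) p (frame a p) = 0.
  rewrite -(derive_cst ((b == d)%:R : R) p (frame a p)).
  apply: near_eq_derive; apply: (open_near_eq (@open_U0 R) (S3_U0 Sp)) => x.
  rewrite inE => Ux /=; have [_] := frame_orthonormal (S3_retract Ux).
  exact.
rewrite /christoffel [dot (frame b p) _]dotC => /esym/eqP.
by rewrite addr_eq0 => /eqP.
Qed.

(** The absence of torsion is tested on the four coordinate functions: [dS3 (coord4 i)] returns the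
    i-th component of a tangent vector, which turns an equality of derivations into one of
    vectors. *)
Lemma christoffel_bracket p a b d : S3 p ->
  christoffel p a b d - christoffel p b a d = - 2 * eps a b d.
Proof.
move=> Sp; have [_ _ tf] := nablaLC.
rewrite -(frame_bracket a b d Sp) /christoffel.
have -> : nabla p (frame a p) (frame b) =
    (nabla p (frame a p) (frame b) - nabla p (frame b p) (frame a))
    + nabla p (frame b p) (frame a) by rewrite subrK.
rewrite dotDl addrK; congr (dot _ _); apply/matrixP => i j; rewrite ord1 => {j}.
have := tf p _ _ _ Sp (vector_field_frame a) (vector_field_frame b) (smoothS3_coord i).
rewrite !dS3_dS3_coord// dS3_coord// => [->|]; first by rewrite !mxE.
rewrite /tangent dotDr dotNr !nabla_tangent ?subr0//; exact: vector_field_frame.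
Qed.

(** Koszul's argument: skewness and the bracket relations for the cyclic permutations of the indices
    form a linear system with a unique solution, here half of the bracket coefficients because these
    are totally skew. *)
Lemma christoffelE p a b d : S3 p -> christoffel p a b d = - eps a b d.
Proof.
move=> Sp; have sk a' b' d' := christoffel_skew a' b' d' Sp.
have br a' b' d' := christoffel_bracket a' b' d' Sp.
have e : forall i j k, eps j k i = eps i j k by do 3!apply: I3P; rewrite /eps/=; lra.
have := br a b d; have := br b d a; have := br d a b.
have := sk a b d; have := sk b d a; have := sk d a b.
rewrite (e a b d) -(e d a b); lra.
Qed.

Section field.
Variable sigma : E4 -> E4.
Hypothesis vs : vector_field sigma.

Definition fcomp (c : 'I_3) : E4 -> R :=
  (fun x => dot (sigma x) (frame c x)) \o @retract R.

Lemma smooth_fcomp c : smooth (fcomp c).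
Proof.
by apply: smooth_retract; apply: smoothS3_dot; [exact: vs.1|exact: smoothS3_frame].
Qed.

Lemma fcomp_S3 c p : S3 p -> fcomp c p = dot (sigma p) (frame c p).
Proof. by move=> Sp; rewrite /fcomp/= retract_S3. Qed.

(** Metric compatibility moves the derivative onto the frame field, whose covariant derivative is
    given by [christoffelE]. From here on the connection enters only through this formula. *)
Lemma nabla_fcomp a c p : S3 p -> dot (nabla p (frame a p) sigma) (frame c p) =
  Lie a (fcomp c) p + eps a c 0 * fcomp 0 p + eps a c 1 * fcomp 1 p + eps a c 2 * fcomp 2 p.
Proof.
move=> Sp; have [_ mc _] := nablaLC.
have := mc p (frame a p) _ _ Sp (frame_tangent _ _) vs (vector_field_frame c).
rewrite -[dS3 _ _ _]/(Lie a (fcomp c) p) => ->.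
have := parseval p (sigma p) (nabla p (frame a p) (frame c)).
rewrite Sp mul1r => ->; rewrite [dot (sigma p) p]dotC vs.2// mul0r add0r.
rewrite -!/(christoffel _ _ _ _) !christoffelE// !fcomp_S3//; ring.
Qed.

Lemma normsq_covE3 p : S3 p -> normsq_cov nabla sigma p =
  \sum_(a < 3) \sum_(c < 3) (dot (nabla p (frame a p) sigma) (frame c p)) ^+ 2.
Proof.
move=> Sp; apply: eq_bigr => a _; rewrite sum3E.
have := parseval p (nabla p (frame a p) sigma) (nabla p (frame a p) sigma).
rewrite Sp mul1r [dot _ p]dotC nabla_tangent// mul0r add0r => ->.
by rewrite !expr2.
Qed.

End field.

End LeviCivita.

(** * Integration over a box of R^3 *)

Lemma continuous_pair (T U V : topologicalType) (f : T -> U) (g : T -> V) x :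
  {for x, continuous f} -> {for x, continuous g} ->
  {for x, continuous (fun y => (f y, g y))}.
Proof. by move=> cf cg; apply: (@cvg_pair _ _ _ (nbhs x) (nbhs (f x)) (nbhs (g x)) _ _ _ f g). Qed.

Lemma continuous_pairl (T U : topologicalType) (t : U) : continuous (fun x : T => (x, t)).
Proof. by move=> x; apply: continuous_pair; [exact: cvg_id|exact: cvg_cst]. Qed.

Lemma continuous_pairr (T U : topologicalType) (t : U) : continuous (fun x : T => (t, x)).
Proof. by move=> x; apply: continuous_pair; [exact: cvg_cst|exact: cvg_id]. Qed.

(** * Measurability of continuous functions for the product sigma-algebra *)

Section Caratheodory.
Context {R : realType} {d : measure_display} {X : measurableType d}.
Local Notation mR := (measurableTypeR R).

(** [h] is the pointwise limit of the functions [hn n] in which [t] is rounded down to a multiple of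
    1/(n+1). These are countable gluings of slices of [h] over intervals of [t], hence
    measurable. *)
Lemma caratheodory_measurable (h : X * mR -> R) :
  (forall t : R, measurable_fun setT (fun x => h (x, t))) ->
  (forall x, continuous (fun t : R => h (x, t))) ->
  measurable_fun setT h.
Proof.
move=> mh ch.
pose q n (k : int) : R := k%:~R / n.+1%:R.
pose hn n (p : X * mR) := h (p.1, q n (Num.floor (n.+1%:R * (p.2 : R)))).
apply: (@measurable_fun_cvg _ _ _ setT hn).
  move=> n _ B mB; rewrite setTI.
  have -> : hn n @^-1` B = \bigcup_(k : int)
     ((fun x => h (x, q n k)) @^-1` B `*` [set t : mR | Num.floor (n.+1%:R * (t : R)) = k]).
    apply/seteqP; split=> [[x t] /= Bh|[x t] [k _] [/= Bh fk]]; last by rewrite /= /hn/= fk.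
    by exists (Num.floor (n.+1%:R * (t : R))).
  apply: countable_bigcupT_measurable => [|k]; first exact: countableP.
  apply: measurableX; first by rewrite -[X in measurable X]setTI; exact: mh.
  have -> : [set t : mR | Num.floor (n.+1%:R * (t : R)) = k] =
      `[q n k, q n (k + 1)[%classic.
    apply/seteqP; split=> t /=; rewrite in_itv/= /q ler_pdivrMr// ltr_pdivlMr//
      ![t * _]mulrC.
      by move=> <-; exact: floor_itv.
    by move=> tk; exact: floor_def.
  exact: measurable_itv.
move=> [x t] _; rewrite /hn/=.
apply: (cvg_comp (fun n => q n (Num.floor (n.+1%:R * t))) (fun t => h (x, t))); last exact: ch.
apply/cvgrPdist_le => e e0.
move/cvgrPdist_le : (@cvg_harmonic R) => /(_ _ e0) He; near=> n.
have n0 : 0 < n.+1%:R :> R by [].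
have : n.+1%:R^-1 <= e.
  have : `|0 - harmonic n| <= e :> R.
    by near: n; exact: He.
  by rewrite sub0r normrN ger0_norm ?harmonic_ge0.
apply: le_trans; have /andP[f1 f2] := floor_itv (n.+1%:R * t).
rewrite /q ger0_norm; last by rewrite subr_ge0 ler_pdivrMr// [t * _]mulrC.
rewrite lerBlDl -[X in _ + X]mul1r -mulrDl ler_pdivlMr// [t * _]mulrC ltW//.
by move: f2; rewrite intrD.
Unshelve. all: by end_near. Qed.

End Caratheodory.

Section Fubini_rect.
Context {d1 d2 : measure_display} {T1 : measurableType d1} {T2 : measurableType d2}
  {R : realType}.
Variables (m1 : {sigma_finite_measure set T1 -> \bar R})
  (m2 : {sigma_finite_measure set T2 -> \bar R}).
Variables (A1 : set T1) (A2 : set T2) (G : T1 * T2 -> \bar R).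
Hypotheses (mA1 : measurable A1) (mA2 : measurable A2).
Hypothesis iG : (m1 \x m2)%E.-integrable (A1 `*` A2) G.

Let iG' : (m1 \x m2)%E.-integrable setT (G \_ (A1 `*` A2)).
Proof. exact/(integrable_mkcond _ (measurableX mA1 mA2)). Qed.

(** Fubini for the extension of [G] by 0: its slice at [x] is the extension of the slice of [G] if
    [x] is in [A1], and is 0 otherwise. *)
Lemma fubini_rect12 : (\int[m1 \x m2]_(z in A1 `*` A2) G z =
  \int[m1]_(x in A1) \int[m2]_(y in A2) G (x, y))%E.
Proof.
rewrite [LHS]integral_mkcond -(integral12_prod_meas1 iG') [RHS]integral_mkcond.
apply: eq_integral => x _; rewrite [RHS]patchE; case: ifPn => [xA|xA].
  rewrite [RHS]integral_mkcond; apply: eq_integral => y _; rewrite !patchE.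
  by congr (if _ then _ else _); apply/idP/idP; rewrite !inE/=; [case|move=> yA; split=> //; exact: set_mem].
rewrite /fubini_F integral0_eq// => y _; rewrite patchE ifF//.
by apply/negP; rewrite inE => -[/= /mem_set]; rewrite (negbTE xA).
Qed.

Lemma fubini_rect21 : (\int[m1 \x m2]_(z in A1 `*` A2) G z =
  \int[m2]_(y in A2) \int[m1]_(x in A1) G (x, y))%E.
Proof.
rewrite [LHS]integral_mkcond -(integral21_prod_meas1 iG') [RHS]integral_mkcond.
apply: eq_integral => y _; rewrite [RHS]patchE; case: ifPn => [yA|yA].
  rewrite [RHS]integral_mkcond; apply: eq_integral => x _; rewrite !patchE.
  by congr (if _ then _ else _); apply/idP/idP; rewrite !inE/=; [case|move=> xA; split=> //; exact: set_mem].
rewrite /fubini_G integral0_eq// => x _; rewrite patchE ifF//.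
by apply/negP; rewrite inE => -[/= _ /mem_set]; rewrite (negbTE yA).
Qed.

End Fubini_rect.

(* Redeclared because in the library the canonical structure of sub-probability
   measure on products shadows the one of sigma-finite measure. *)
Section Lebesgue2.
Context {R : realType}.
Local Notation mR := (measurableTypeR R).

Definition lebesgue2 : set (mR * mR) -> \bar R :=
  (@lebesgue_measure R \x @lebesgue_measure R)%E.

HB.instance Definition _ := Measure.on lebesgue2.

Let lebesgue2_sigma_finite : sigma_finite setT lebesgue2.
Proof.
have /sigma_finiteP[F [TF ndF Foo]] := sigma_finiteT (@lebesgue_measure R).
exists (fun n => F n `*` F n).
  apply/seteqP; split=> // -[x y] _.
  have [n _ Fx] : (\bigcup_n F n) x by rewrite -TF.
  have [m _ Fy] : (\bigcup_n F n) y by rewrite -TF.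
  exists (maxn n m) => //; split.
    by move: x Fx; exact/subsetPset/ndF/leq_maxl.
  by move: y Fy; exact/subsetPset/ndF/leq_maxr.
move=> k; have [mF Fk] := Foo k; split; first exact: measurableX.
rewrite [X in (X < _)%E](_ : _ = (@lebesgue_measure R (F k) * @lebesgue_measure R (F k))%E).
  by rewrite lte_mul_pinfty// ge0_fin_numE.
exact: product_measure1E.
Qed.

HB.instance Definition _ := @Measure_isSigmaFinite.Build _ _ _ lebesgue2
  lebesgue2_sigma_finite.

End Lebesgue2.

Section Box.
Context {R : realType}.
Local Notation leb := (@lebesgue_measure R).
Local Notation mR := (measurableTypeR R).

Lemma measurable_continuous2 (G : R * R -> R) : continuous G ->
  measurable_fun setT (G : mR * mR -> R).
Proof.
move=> cG; apply: caratheodory_measurable => [t|x].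
  apply: continuous_measurable_fun => x.
  exact: (continuous_comp (@continuous_pairl R R t x) (cG (x, t))).
by move=> t; exact: (continuous_comp (@continuous_pairr R R x t) (cG (x, t))).
Qed.

Lemma measurable_continuous3 (G : R * R * R -> R) : continuous G ->
  measurable_fun setT (G : mR * mR * mR -> R).
Proof.
move=> cG; apply: caratheodory_measurable => [t|x].
  apply: measurable_continuous2 => x.
  exact: (continuous_comp (@continuous_pairl _ R t x) (cG (x, t))).
by move=> t; exact: (continuous_comp (@continuous_pairr R _ x t) (cG (x, t))).
Qed.

Variables (a b : 'I_3 -> R).
Hypothesis ab : forall i, a i < b i.

Definition box : set (R * R * R) :=
  `]a 0, b 0[ `*` `]a 1, b 1[ `*` `]a 2, b 2[.

Definition mu3 := (leb \x leb \x leb)%E.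

Let J (i : 'I_3) : set mR := `]a i, b i[%classic.
Let mi (i : 'I_3) : measurable (`]a i, b i[%classic : set mR).
Proof. exact: measurable_itv. Qed.

Lemma measurable_box : measurable (box : set (mR * mR * mR)).
Proof. by rewrite /box; apply: measurableX; [apply: measurableX|]; exact: mi. Qed.

Lemma lebesgue_itvoo (x y : R) : x < y -> leb `]x, y[%classic = (y - x)%:E.
Proof. by move=> xy; rewrite lebesgue_measure_itv/= lte_fin xy EFinB. Qed.

Let lebJ i : leb (J i) = (b i - a i)%:E. Proof. exact: lebesgue_itvoo. Qed.

Lemma mu3_box : mu3 box = ((b 0 - a 0) * (b 1 - a 1) * (b 2 - a 2))%:E.
Proof.
rewrite /mu3 /box.
transitivity ((leb \x leb) (J 0%R `*` J 1%R : set (mR * mR))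
   * leb (J 2%R))%E.
  by apply: product_measure1E; [apply: measurableX|]; exact: mi.
transitivity ((leb (J 0%R) * leb (J 1%R))
   * leb (J 2%R))%E.
  congr (_ * _)%E; apply: product_measure1E; exact: mi.
by rewrite /J !lebesgue_itvoo.
Qed.

Lemma bounded_box (G : R * R * R -> R) : continuous G -> [bounded G x | x in box].
Proof.
move=> cG.
have cB : compact (`[a 0, b 0]%classic `*` `[a 1, b 1]%classic `*` `[a 2, b 2]%classic).
  by apply: compact_setX; [apply: compact_setX|]; exact: segment_compact.
have := compact_bounded (@continuous_compact _ _ G _ (continuous_subspaceT cG) cB).
move=> [M [Mr MP]]; exists M; split=> // x Mx y [[y1 y2] y3]/=.
by apply: MP Mx _ _; exists y => //; split; [split|]; exact: subset_itv_oo_cc.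
Qed.

Lemma integrable_box (G : R * R * R -> R) : continuous G ->
  mu3.-integrable box (EFin \o G).
Proof.
move=> cG; apply: measurable_bounded_integrable.
- exact: measurable_box.
- by have := congr1 (fun z => z < +oo)%E mu3_box; rewrite ltry; exact: id.
- by apply: measurable_funTS; exact: measurable_continuous3.
- exact: bounded_box.
Qed.

Let J01 : set (mR * mR) := J 0 `*` J 1.

Let mJ01 : measurable J01. Proof. by apply: measurableX; exact: mi. Qed.

Let integrable_J01 (G : R * R -> R) : continuous G ->
  (@lebesgue2 R).-integrable J01 (EFin \o G).
Proof.
move=> cG; apply: measurable_bounded_integrable => //.
- have E : @lebesgue2 R J01 = (leb (J 0%R) * leb (J 1%R))%E.
    by apply: product_measure1E; exact: mi.
  have := congr1 (fun z => z < +oo)%E E.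
  by rewrite /J !lebesgue_itvoo// ltry; exact: id.
- by apply: measurable_funTS; exact: measurable_continuous2.
have cB : compact (`[a 0, b 0]%classic `*` `[a 1, b 1]%classic).
  by apply: compact_setX; exact: segment_compact.
have := compact_bounded (@continuous_compact _ _ G _ (continuous_subspaceT cG) cB).
move=> [M [Mr MP]]; exists M; split=> // x Mx y [y1 y2]/=.
by apply: MP Mx _ _; exists y => //; split; exact: subset_itv_oo_cc.
Qed.

Lemma integral_oo (F f : R -> R) (x y : R) : x < y ->
  (forall t : R, is_derive t 1 F (f t)) -> continuous f ->
  (\int[leb]_(t in `]x, y[) (f t)%:E = (F y - F x)%:E)%E.
Proof.
move=> xy dF cf.
have cF : continuous F.
  by move=> t; apply: differentiable_continuous; apply/derivable1_diffP; case: (dF t).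
have mf : measurable_fun setT (EFin \o f).
  by apply/measurable_EFinP; exact: continuous_measurable_fun.
rewrite integral_itv_obnd_cbnd; last exact: measurable_funTS.
rewrite integral_itv_bndo_bndc; last exact: measurable_funTS.
rewrite EFinB; apply: continuous_FTC2 => //.
- exact: continuous_subspaceT.
- split.
  + by move=> t _; case: (dF t).
  + exact/cvg_at_right_filter/cF.
  + exact/cvg_at_left_filter/cF.
- by move=> t _; rewrite derive1E; case: (dF t).
Qed.

(** Here and in the two variants below, Fubini is arranged so that the differentiated variable is
    innermost; the inner integral is then a difference of equal boundary values. *)
Lemma box_integral_derive2 (F G : R * R * R -> R) : continuous G ->
  (forall p (t : R), is_derive t 1 (fun t => F (p, t)) (G (p, t))) ->
  (forall p, F (p, b 2) = F (p, a 2)) ->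
  (\int[mu3]_(y in box) (G y)%:E = 0)%E.
Proof.
move=> cG dF Fab.
have -> := @fubini_rect12 _ _ _ _ R (@lebesgue2 R) leb J01 (J 2) (EFin \o G) mJ01 (mi 2) (integrable_box cG).
apply: integral0_eq => p _; rewrite (@integral_oo (fun t => F (p, t))) ?Fab ?subrr//.
by move=> t; exact: (continuous_comp (@continuous_pairr R _ p t) (cG (p, t))).
Qed.

Lemma box_integral_derive1 (F G : R * R * R -> R) : continuous G ->
  (forall x z (t : R), is_derive t 1 (fun t => F (x, t, z)) (G (x, t, z))) ->
  (forall x z, F (x, b 1, z) = F (x, a 1, z)) ->
  (\int[mu3]_(y in box) (G y)%:E = 0)%E.
Proof.
move=> cG dF Fab.
have -> := @fubini_rect21 _ _ _ _ R (@lebesgue2 R) leb J01 (J 2) (EFin \o G) mJ01 (mi 2) (integrable_box cG).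
apply: integral0_eq => z _.
have cz : continuous (fun p => G (p, z)).
  by move=> t; exact: (continuous_comp (@continuous_pairl _ _ z t) (cG (t, z))).
have -> := @fubini_rect12 _ _ _ _ R leb leb (J 0) (J 1) (EFin \o (fun p => G (p, z))) (mi 0) (mi 1) (integrable_J01 cz).
apply: integral0_eq => x _; rewrite (@integral_oo (fun t => F (x, t, z))) ?Fab ?subrr//.
by move=> t; exact: (continuous_comp (@continuous_pairr _ _ x t) (cz (x, t))).
Qed.

Lemma box_integral_derive0 (F G : R * R * R -> R) : continuous G ->
  (forall y z (t : R), is_derive t 1 (fun t => F (t, y, z)) (G (t, y, z))) ->
  (forall y z, F (b 0, y, z) = F (a 0, y, z)) ->
  (\int[mu3]_(y in box) (G y)%:E = 0)%E.
Proof.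
move=> cG dF Fab.
have -> := @fubini_rect21 _ _ _ _ R (@lebesgue2 R) leb J01 (J 2) (EFin \o G) mJ01 (mi 2) (integrable_box cG).
apply: integral0_eq => z _.
have cz : continuous (fun p => G (p, z)).
  by move=> t; exact: (continuous_comp (@continuous_pairl _ _ z t) (cG (t, z))).
have -> := @fubini_rect21 _ _ _ _ R leb leb (J 0) (J 1) (EFin \o (fun p => G (p, z))) (mi 0) (mi 1) (integrable_J01 cz).
apply: integral0_eq => y _; rewrite (@integral_oo (fun t => F (t, y, z))) ?Fab ?subrr//.
by move=> t; exact: (continuous_comp (@continuous_pairl _ _ y t) (cz (t, y))).
Qed.

Lemma box_integral_fst (F f : R -> R) :
  (forall t : R, is_derive t 1 F (f t)) -> continuous f ->
  (\int[mu3]_(y in box) (f y.1.1)%:E =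
   ((F (b 0%R) - F (a 0%R)) * (b 1%R - a 1%R) * (b 2%R - a 2%R))%:E)%E.
Proof.
move=> dF cf.
have c1 : continuous (fun p : R * R => f p.1).
  by move=> p; exact: (continuous_comp (@cvg_fst _ _ _ _ _) (cf p.1)).
have c2 : continuous (fun y : R * R * R => f y.1.1).
  by move=> p; exact: (continuous_comp (@cvg_fst _ _ _ _ _) (c1 p.1)).
have -> := @fubini_rect12 _ _ _ _ R (@lebesgue2 R) leb J01 (J 2) (EFin \o (fun y => f y.1.1)) mJ01 (mi 2) (integrable_box c2).
rewrite (eq_integral (fun p : mR * mR => (b 2%R - a 2%R)%:E * (f p.1)%:E)%E); last first.
  by move=> p _; rewrite /= (integral_cst _ (mi _)) [LHS]muleC; congr (_ * _)%E; exact: lebJ.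
rewrite integralZl//; last exact: (integrable_J01 c1).
have -> := @fubini_rect12 _ _ _ _ R leb leb (J 0) (J 1) (EFin \o (fun y => f y.1)) (mi 0) (mi 1) (integrable_J01 c1).
rewrite (eq_integral (fun x : mR => (b 1%R - a 1%R)%:E * (f x)%:E)%E); last first.
  by move=> p _; rewrite /= (integral_cst _ (mi _)) [LHS]muleC; congr (_ * _)%E; exact: lebJ.
have iE : leb.-integrable (`[a 0, b 0]%classic : set mR) (EFin \o f).
  by apply: continuous_compact_integrable; [exact: segment_compact|exact: continuous_subspaceT].
have iJ : leb.-integrable (J 0) (EFin \o f).
  by apply: integrableS iE; [exact: measurable_itv|exact: mi|exact: subset_itv_oo_cc].
rewrite (integralZl (mi 0) iJ) (@integral_oo F)// -!EFinM; congr (_%:E); ring.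
Qed.

(** A vanishing integral makes [G] zero almost everywhere. If [G] were positive at a point, it would
    be so on a product of three balls inside the box, whose measure is positive. *)
Lemma box_integral_eq0 (G : R * R * R -> R) : continuous G ->
  (forall y, box y -> 0 <= G y) ->
  (\int[mu3]_(y in box) (G y)%:E = 0)%E -> forall y, box y -> G y = 0.
Proof.
move=> cG G0 IG [[x y] z] [[/= bx by_] bz].
apply/eqP; rewrite eq_le G0 ?andbT; last by split; [split|].
rewrite leNgt; apply/negP => Gp.
have mG : measurable_fun box (EFin \o G : mR * mR * mR -> \bar R).
  by apply/measurable_EFinP; apply: measurable_funTS; exact: measurable_continuous3.
have ae0 : ae_eq mu3 box (EFin \o G) (cst 0%E).
  apply/(ae_eq_integral_abs _ measurable_box mG).
  rewrite -[RHS]IG; apply: eq_integral => u; rewrite inE => bu /=.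
  by rewrite ger0_norm// G0.
have Np : nbhs (x, y, z) (box `&` [set u | 0 < G u]).
  apply: filterI.
    exists (`]a 0, b 0[%classic `*` `]a 1, b 1[%classic, `]a 2, b 2[%classic) => //=.
    split; last by apply: open_nbhs_nbhs; split => //; exact: interval_open.
    exists (`]a 0, b 0[%classic, `]a 1, b 1[%classic) => //=.
    by split; apply: open_nbhs_nbhs; split => //; exact: interval_open.
  exact: (cG (x, y, z) [set t | 0 < t] (lt_nbhsr Gp)).
case: Np => -[N12 N3] /= [[[N1 N2] /= [n1 n2] N12P] n3] NP.
have [e1 /= e10 B1] := (nbhs_ballP _ _).1 n1.
have [e2 /= e20 B2] := (nbhs_ballP _ _).1 n2.
have [e3 /= e30 B3] := (nbhs_ballP _ _).1 n3.
pose B : set (mR * mR * mR) := ball x e1 `*` ball y e2 `*` ball z e3.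
have BP u : B u -> box u /\ 0 < G u.
  move=> [[/= u1 u2] u3]; apply: NP => /=; split; last exact: B3.
  by apply: N12P; split; [exact: B1|exact: B2].
have mB : measurable B.
  by apply: measurableX; [apply: measurableX|]; exact: measurable_ball.
have muB : mu3 B = ((e1 *+ 2) * (e2 *+ 2) * (e3 *+ 2))%:E.
  transitivity (lebesgue2 (ball x e1 `*` ball y e2 : set (mR * mR)) * leb (ball z e3 : set mR))%E.
    by apply: product_measure1E; [apply: measurableX|]; exact: measurable_ball.
  transitivity ((leb (ball x e1 : set mR) * leb (ball y e2 : set mR)) * leb (ball z e3 : set mR))%E.
    by congr (_ * _)%E; apply: product_measure1E; exact: measurable_ball.
  by rewrite !lebesgue_measure_ball ?ltW.
have : mu3 B = 0%E.
  have [N [mN N0 NB]] := ae0.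
  apply: (subset_measure0 mB mN) N0 => u Bu; apply: NB => /= h.
  have [bu Gu] := BP _ Bu; move: (h bu) => /= [G00].
  by rewrite G00 ltxx in Gu.
by rewrite muB => -[] /eqP; rewrite gt_eqF// !mulr_gt0// pmulrn_lgt0.
Qed.

End Box.

(** * Hopf coordinates and integration over the sphere *)

Section DeriveLambda.
Context {R : realType}.

Section derive.
Context {V : normedModType R}.
Implicit Types (f g : V -> R).

Lemma is_derive_mul f g (x v : V) df dg : is_derive x v f df -> is_derive x v g dg ->
  is_derive x v (fun y => f y * g y) (f x * dg + g x * df).
Proof. exact: is_deriveM. Qed.

Lemma is_derive_add f g (x v : V) df dg : is_derive x v f df -> is_derive x v g dg ->
  is_derive x v (fun y => f y + g y) (df + dg).
Proof. exact: is_deriveD. Qed.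

Lemma is_derive_opp f (x v : V) df : is_derive x v f df ->
  is_derive x v (fun y => - f y) (- df).
Proof. exact: is_deriveN. Qed.

Lemma is_derive_const (c : R) (x v : V) : is_derive x v (fun=> c) 0.
Proof. exact: is_derive_cst. Qed.

End derive.
End DeriveLambda.

(** The derivative is synthesized in an existential variable; [is_derive_eq] then leaves its
    comparison with the claimed value as an algebraic goal. *)
Ltac isd := repeat first [exact: is_derive_cos | exact: is_derive_sin
  | exact: is_derive_const | eapply is_derive_mul | eapply is_derive_opp
  | eapply is_derive_add].

Section LambdaRules.
Context {R : realType}.

Lemma is_derive_cosD (t z : R) : is_derive t 1 (fun s => cos (s + z)) (- sin (t + z)).
Proof.
have -> : (fun s => cos (s + z)) = (fun s => cos s * cos z + - (sin s * sin z)).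
  by apply/funext => s; rewrite cosD.
eapply is_derive_eq; first isd.
by rewrite sinD; ring.
Qed.

Lemma is_derive_sinD (t z : R) : is_derive t 1 (fun s => sin (s + z)) (cos (t + z)).
Proof.
have -> : (fun s => sin (s + z)) = (fun s => sin s * cos z + cos s * sin z).
  by apply/funext => s; rewrite sinD.
eapply is_derive_eq; first isd.
by rewrite cosD; ring.
Qed.

Section continuous.
Context {T : topologicalType}.
Implicit Types (f g : T -> R).

Lemma continuous_mul f g : continuous f -> continuous g -> continuous (fun y => f y * g y).
Proof. by move=> cf cg x; apply: continuousM; [exact: cf|exact: cg]. Qed.

Lemma continuous_add f g : continuous f -> continuous g -> continuous (fun y => f y + g y).
Proof. by move=> cf cg x; apply: continuousD; [exact: cf|exact: cg]. Qed.

Lemma continuous_opp f : continuous f -> continuous (fun y => - f y).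
Proof. by move=> cf x; apply: continuousN; exact: cf. Qed.

Lemma continuous_cosf f : continuous f -> continuous (fun y => cos (f y)).
Proof. by move=> cf x; apply: continuous_comp; [exact: cf|exact: continuous_cos]. Qed.

Lemma continuous_sinf f : continuous f -> continuous (fun y => sin (f y)).
Proof. by move=> cf x; apply: continuous_comp; [exact: cf|exact: continuous_sin]. Qed.

Lemma continuous_const (c : R) : continuous (fun _ : T => c).
Proof. exact: cst_continuous. Qed.

End continuous.
End LambdaRules.

Section Projections.
Context {R : realType}.
Local Notation R3 := (R * R * R)%type.

Lemma continuous_eta : continuous (fun y : R3 => y.1.1).
Proof. by move=> y; exact: (continuous_comp (@cvg_fst _ _ _ _ _) (@cvg_fst _ _ _ _ _)). Qed.

Lemma continuous_xi1 : continuous (fun y : R3 => y.1.2).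
Proof. by move=> y; exact: (continuous_comp (@cvg_fst _ _ _ _ _) (@cvg_snd _ _ _ _ _)). Qed.

Lemma continuous_xi2 : continuous (fun y : R3 => y.2).
Proof. by move=> y; exact: cvg_snd. Qed.

End Projections.

Ltac cont := repeat lazymatch goal with
  | |- continuous (fun y => y.1.1) => exact: continuous_eta
  | |- continuous (fun y => y.1.2) => exact: continuous_xi1
  | |- continuous (fun y => y.2) => exact: continuous_xi2
  | |- continuous (fun y => (_ + _)%R) => apply: continuous_add
  | |- continuous (fun y => (_ * _)%R) => apply: continuous_mul
  | |- continuous (fun y => (- _)%R) => apply: continuous_opp
  | |- continuous (fun y => cos _) => apply: continuous_cosf
  | |- continuous (fun y => sin _) => apply: continuous_sinf
  | |- _ => first [exact: continuous_eta | exact: continuous_xi1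
      | exact: continuous_xi2 | exact: continuous_const]
  end.

Section Chart.
Context {R : realType}.
Local Notation E4 := 'cV[R]_4.
Local Notation U0 := (@U0 R).
Local Notation R3 := (R * R * R)%type.

Lemma hopf_chartE (y : R3) : hopf_chart y =
  vec4 (cos y.1.1 * cos y.1.2) (cos y.1.1 * sin y.1.2)
       (sin y.1.1 * cos y.2) (sin y.1.1 * sin y.2).
Proof. by case: y => -[]. Qed.

Lemma coord_vec4 (T : Type) (a b c d : T -> R) i :
  coord4 i \o (fun x => vec4 (a x) (b x) (c x) (d x)) =
  nth (fun=> 0) [:: a; b; c; d] i.
Proof. by move: i; apply: I4P; apply/funext => x; rewrite /coord4/= vec4E. Qed.

Lemma continuous_vec4 (T : topologicalType) (a b c d : T -> R) :
  continuous a -> continuous b -> continuous c -> continuous d ->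
  continuous (fun x => vec4 (a x) (b x) (c x) (d x)).
Proof.
move=> ca cb cc cd x; apply: continuous_mxP => i; rewrite coord_vec4.
by move: i; apply: I4P; [exact: ca|exact: cb|exact: cc|exact: cd].
Qed.

Lemma continuous_hopf_chart : continuous (@hopf_chart R).
Proof.
have -> : @hopf_chart R = fun y => vec4 (cos y.1.1 * cos y.1.2) (cos y.1.1 * sin y.1.2)
    (sin y.1.1 * cos y.2) (sin y.1.1 * sin y.2).
  by apply/funext => y; rewrite hopf_chartE.
by apply: continuous_vec4; cont.
Qed.

Lemma S3_hopf (y : R3) : S3 (hopf_chart y).
Proof.
case: y => -[x1 x2] x3; rewrite /S3/= dot4 !vec4E.
have := cos2Dsin2 x1; have := cos2Dsin2 x2; have := cos2Dsin2 x3.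
move: (cos x3) (sin x3) (cos x2) (sin x2) (cos x1) (sin x1) => c3 s3 c2 s2 c1 s1 e3 e2 e1.
transitivity (c1 ^+ 2 * (c2 ^+ 2 + s2 ^+ 2) + s1 ^+ 2 * (c3 ^+ 2 + s3 ^+ 2)); first by ring.
by rewrite e3 e2 !mulr1.
Qed.

Lemma U0_hopf (y : R3) : U0 (hopf_chart y).
Proof. exact/S3_U0/S3_hopf. Qed.

Lemma is_derive_vec4 (V : normedModType R) (a b c d : V -> R) (x v : V) (da db dc dd : R) :
  is_derive x v a da -> is_derive x v b db -> is_derive x v c dc -> is_derive x v d dd ->
  is_derive x v (fun y => vec4 (a y) (b y) (c y) (d y)) (vec4 da db dc dd).
Proof.
move=> [Da Ea] [Db Eb] [Dc Ec] [Dd Ed].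
have cE i : (fun y => vec4 (a y) (b y) (c y) (d y) i 0) = nth (fun=> 0) [:: a; b; c; d] i.
  exact: (coord_vec4 a b c d i).
have D : derivable (fun y => vec4 (a y) (b y) (c y) (d y)) x v.
  by apply/derivable_mxP => i j; rewrite ord1 cE; move: i; apply: I4P;
    [exact: Da|exact: Db|exact: Dc|exact: Dd].
apply: DeriveDef => //; rewrite derive_mx//; apply/matrixP => i j; rewrite ord1 mxE cE.
by move: i; apply: I4P; rewrite vec4E; [exact: Ea|exact: Eb|exact: Ec|exact: Ed].
Qed.

(** With the next two, the coordinate fields of the chart, that is, the partial derivatives of
    [hopf_chart] in eta, xi1 and xi2. *)
Definition chart_eta (y : R3) : E4 :=
  vec4 (- sin y.1.1 * cos y.1.2) (- sin y.1.1 * sin y.1.2)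
       (cos y.1.1 * cos y.2) (cos y.1.1 * sin y.2).
Definition chart_xi1 (y : R3) : E4 :=
  vec4 (- (cos y.1.1 * sin y.1.2)) (cos y.1.1 * cos y.1.2) 0 0.
Definition chart_xi2 (y : R3) : E4 :=
  vec4 0 0 (- (sin y.1.1 * sin y.2)) (sin y.1.1 * cos y.2).

Lemma is_derive_chart_eta (t x1 x2 : R) :
  is_derive t 1 (fun t => hopf_chart (t, x1, x2)) (chart_eta (t, x1, x2)).
Proof.
by apply: is_derive_vec4; (eapply is_derive_eq; [isd|rewrite /=; ring]).
Qed.

Lemma is_derive_chart_xi1 (t x1 x2 : R) :
  is_derive t 1 (fun t => hopf_chart (x1, t, x2)) (chart_xi1 (x1, t, x2)).
Proof.
by apply: is_derive_vec4; (eapply is_derive_eq; [isd|rewrite /=; ring]).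
Qed.

Lemma is_derive_chart_xi2 (t x1 x2 : R) :
  is_derive t 1 (fun t => hopf_chart (x1, x2, t)) (chart_xi2 (x1, x2, t)).
Proof.
by apply: is_derive_vec4; (eapply is_derive_eq; [isd|rewrite /=; ring]).
Qed.

Lemma derive_basis3 (f : R3 -> E4) (x1 x2 x3 : R) :
  ('D_(basis3 0) f (x1, x2, x3) = 'D_1 (fun t => f (t, x2, x3)) x1) *
  ('D_(basis3 1) f (x1, x2, x3) = 'D_1 (fun t => f (x1, t, x3)) x2) *
  ('D_(basis3 2) f (x1, x2, x3) = 'D_1 (fun t => f (x1, x2, t)) x3).
Proof.
have s1 (h : R) : h *: (1 : R) = h by exact: mulr1.
have s0 (h : R) : h *: (0 : R) = 0 by exact: mulr0.
have E0 (h : R) : h *: basis3 0 + (x1, x2, x3) = (h + x1, x2, x3).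
  by congr (_, _, _); rewrite /= ?s1 ?s0 ?add0r.
have E1 (h : R) : h *: basis3 1 + (x1, x2, x3) = (x1, h + x2, x3).
  by congr (_, _, _); rewrite /= ?s1 ?s0 ?add0r.
have E2 (h : R) : h *: basis3 2 + (x1, x2, x3) = (x1, x2, h + x3).
  by congr (_, _, _); rewrite /= ?s1 ?s0 ?add0r.
split; [split|]; rewrite /derive.
- suff -> : (fun h => h^-1 *: ((f \o shift (x1, x2, x3)) (h *: basis3 0) - f (x1, x2, x3))) =
    (fun h => h^-1 *: (((fun t => f (t, x2, x3)) \o shift x1) (h *: 1) - f (x1, x2, x3))) by [].
  by apply/funext => h; rewrite /= E0 s1.
- suff -> : (fun h => h^-1 *: ((f \o shift (x1, x2, x3)) (h *: basis3 1) - f (x1, x2, x3))) =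
    (fun h => h^-1 *: (((fun t => f (x1, t, x3)) \o shift x2) (h *: 1) - f (x1, x2, x3))) by [].
  by apply/funext => h; rewrite /= E1 s1.
- suff -> : (fun h => h^-1 *: ((f \o shift (x1, x2, x3)) (h *: basis3 2) - f (x1, x2, x3))) =
    (fun h => h^-1 *: (((fun t => f (x1, x2, t)) \o shift x3) (h *: 1) - f (x1, x2, x3))) by [].
  by apply/funext => h; rewrite /= E2 s1.
Qed.

(** Hopf coordinates are orthogonal: the metric is diagonal with entries 1, cos^2 eta and sin^2
    eta. *)
Lemma det_metric_matrix (y : R3) :
  \det (metric_matrix y) = (cos y.1.1 * sin y.1.1) ^+ 2.
Proof.
case: y => -[x1 x2] x3.
have [_ D0] := is_derive_chart_eta x1 x2 x3.
have [_ D1] := is_derive_chart_xi1 x2 x1 x3.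
have [_ D2] := is_derive_chart_xi2 x3 x1 x2.
pose v (i : 'I_3) := nth 0 [:: chart_eta (x1, x2, x3); chart_xi1 (x1, x2, x3); chart_xi2 (x1, x2, x3)] i.
have -> : metric_matrix (x1, x2, x3) = diag_mx (\row_j dot (v j) (v j)).
  have vE : forall i, 'D_(basis3 i) (@hopf_chart R) (x1, x2, x3) = v i.
    by apply: I3P; rewrite derive_basis3.
  apply/matrixP => i j; rewrite !mxE !vE.
  by move: i j; apply: I3P; apply: I3P; rewrite /= ?mulr1n ?mulr0n// dot4
    /v/= /chart_eta /chart_xi1 /chart_xi2 !vec4E/=; ring.
rewrite det_diag !big_ord_recl big_ord0 /= !mxE mulr1.
have -> : v (lift ord0 ord0) = chart_xi1 (x1, x2, x3) by [].
have -> : v (lift ord0 (lift ord0 ord0)) = chart_xi2 (x1, x2, x3) by [].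
rewrite [v ord0]/(chart_eta (x1, x2, x3)) !dot4 /chart_eta /chart_xi1 /chart_xi2 !vec4E/=.
have := cos2Dsin2 x1; have := cos2Dsin2 x2; have := cos2Dsin2 x3.
move: (cos x3) (sin x3) (cos x2) (sin x2) => c3 s3 c2 s2.
move: (cos x1) (sin x1) => c1 s1 e3 e2 e1.
transitivity ((s1 ^+ 2 * (c2 ^+ 2 + s2 ^+ 2) + c1 ^+ 2 * (c3 ^+ 2 + s3 ^+ 2)) *
  (c1 ^+ 2 * (c2 ^+ 2 + s2 ^+ 2) * (s1 ^+ 2 * (c3 ^+ 2 + s3 ^+ 2)))); first by ring.
by rewrite e2 e3 !mulr1 [s1 ^+ 2 + _]addrC e1 mul1r exprMn.
Qed.

Definition chart_lo (i : 'I_3) : R := 0.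
Definition chart_hi (i : 'I_3) : R := if i == 0 then pi / 2 else 2 * pi.

Lemma chart_lo_hi i : chart_lo i < chart_hi i.
Proof.
by rewrite /chart_lo /chart_hi; case: ifP => _;
  [rewrite divr_gt0|rewrite mulr_gt0]; rewrite ?pi_gt0.
Qed.

(** The Riemannian density on the chart domain, where it is positive. Written without a square root
    it is smooth everywhere, and it vanishes at both ends of the eta interval. *)
Definition weight (y : R3) : R := cos y.1.1 * sin y.1.1.

Lemma continuous_weight : continuous weight.
Proof. by rewrite /weight; cont. Qed.

Lemma weight_gt0 y : chart_domain y -> 0 < weight y.
Proof.
case: y => -[x1 x2] x3 [[/= + _] _]; rewrite /weight/= in_itv/= => /andP[x0 xpi].
rewrite mulr_gt0 ?cos_gt0_pihalf ?sin_gt0_pihalf ?x0 ?xpi ?andbT//.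
by rewrite (lt_trans _ x0)// oppr_lt0 divr_gt0 ?pi_gt0.
Qed.

Lemma sqrt_det_metric y : chart_domain y -> Num.sqrt (\det (metric_matrix y)) = weight y.
Proof. by move=> Dy; rewrite det_metric_matrix sqrtr_sqr ger0_norm// ltW// weight_gt0. Qed.

End Chart.

(** * The integral over the sphere and the divergence theorem *)

Section SphereIntegral.
Context {R : realType}.
Local Notation E4 := 'cV[R]_4.
Local Notation U0 := (@U0 R).
Local Notation R3 := (R * R * R)%type.
Implicit Types f g : E4 -> R.

Lemma is_derive_curve f (c : R -> E4) (t : R) (c' : E4) : smooth f -> U0 (c t) ->
  is_derive t 1 c c' -> is_derive t 1 (fun s => f (c s)) ('D_c' f (c t)).
Proof.
move=> sf Uc [dc vc].
have df := smooth_differentiable sf Uc.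
have dc' : differentiable c t by apply/derivable1_diffP.
have D : differentiable (f \o c) t by exact: differentiable_comp.
apply: DeriveDef; first by apply: diff_derivable; exact: D.
rewrite -[LHS]/('D_1 (f \o c) t) deriveE// diff_comp//= -(@deriveE _ _ _ c t (1 : R) dc') vc.
by rewrite deriveE.
Qed.

Lemma is_derive_fun_eta f (t x1 x2 : R) : smooth f ->
  is_derive t 1 (fun t => f (hopf_chart (t, x1, x2)))
    ('D_(chart_eta (t, x1, x2)) f (hopf_chart (t, x1, x2))).
Proof.
move=> sf; exact: (@is_derive_curve f (fun t => hopf_chart (t, x1, x2)) t _ sf
  (U0_hopf _) (is_derive_chart_eta t x1 x2)).
Qed.

Lemma is_derive_fun_xi1 f (t x1 x2 : R) : smooth f ->
  is_derive t 1 (fun t => f (hopf_chart (x1, t, x2)))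
    ('D_(chart_xi1 (x1, t, x2)) f (hopf_chart (x1, t, x2))).
Proof.
move=> sf; exact: (@is_derive_curve f (fun t => hopf_chart (x1, t, x2)) t _ sf
  (U0_hopf _) (is_derive_chart_xi1 t x1 x2)).
Qed.

Lemma is_derive_fun_xi2 f (t x1 x2 : R) : smooth f ->
  is_derive t 1 (fun t => f (hopf_chart (x1, x2, t)))
    ('D_(chart_xi2 (x1, x2, t)) f (hopf_chart (x1, x2, t))).
Proof.
move=> sf; exact: (@is_derive_curve f (fun t => hopf_chart (x1, x2, t)) t _ sf
  (U0_hopf _) (is_derive_chart_xi2 t x1 x2)).
Qed.

Lemma continuous_chart f : smooth f -> continuous (fun y : R3 => f (hopf_chart y)).
Proof.
move=> sf y; apply: continuous_comp; first exact: continuous_hopf_chart.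
by apply: smooth_continuous => //; exact: U0_hopf.
Qed.

Lemma continuous_derive_chart f (H : R3 -> E4) : smooth f ->
  (forall i, continuous (fun y => H y i 0)) ->
  continuous (fun y => 'D_(H y) f (hopf_chart y)).
Proof.
move=> sf cH.
have -> : (fun y => 'D_(H y) f (hopf_chart y)) = (fun y =>
    H y 0 0 * 'D_(ebase 0) f (hopf_chart y) + H y 1 0 * 'D_(ebase 1) f (hopf_chart y)
    + H y 2 0 * 'D_(ebase 2) f (hopf_chart y) + H y 3 0 * 'D_(ebase 3) f (hopf_chart y)).
  by apply/funext => y; rewrite derive4E//; exact: U0_hopf.
have cd i := continuous_chart (smooth_derive (ebase i) sf).
have cm i := continuous_mul (cH i) (cd i).
exact: continuous_add (continuous_add (continuous_add (cm 0) (cm 1)) (cm 2)) (cm 3).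
Qed.

Definition lintegral f : \bar R :=
  (\int[mu3]_(y in @chart_domain R) (f (hopf_chart y) * weight y)%:E)%E.

(** On smooth functions the integral is finite, so [fine] loses nothing there ([sintE]). *)
Definition sint f : R := fine (lintegral f).

Lemma continuous_integrand f : smooth f -> continuous (fun y => f (hopf_chart y) * @weight R y).
Proof.
by move=> sf; apply: continuous_mul; [exact: continuous_chart|exact: continuous_weight].
Qed.

Lemma integrable_chart (G : R3 -> R) : continuous G ->
  mu3.-integrable (@chart_domain R) (EFin \o G).
Proof. by move=> cG; exact: (integrable_box (@chart_lo_hi R) cG). Qed.

Lemma measurable_chart_domain : measurable
  (@chart_domain R : set (measurableTypeR R * measurableTypeR R * measurableTypeR R)).
Proof. exact: (measurable_box chart_lo chart_hi). Qed.

Lemma sintE f : smooth f -> lintegral f = (sint f)%:E.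
Proof.
move=> sf; rewrite /sint fineK//.
apply: integrable_fin_num; first exact: measurable_chart_domain.
exact: (integrable_chart (continuous_integrand sf)).
Qed.

Lemma sintD f g : smooth f -> smooth g -> sint (f + g) = sint f + sint g.
Proof.
move=> sf sg; apply: EFin_inj; rewrite EFinD -!sintE//; last exact: smoothD.
rewrite /lintegral.
rewrite -(integralD measurable_chart_domain (integrable_chart (continuous_integrand sf))
  (integrable_chart (continuous_integrand sg))).
by apply: eq_integral => y _; rewrite /= -EFinD -mulrDl.
Qed.

Lemma sintZ (c : R) f : smooth f -> sint (cst c * f) = c * sint f.
Proof.
move=> sf; apply: EFin_inj; rewrite EFinM -!sintE//; last by apply: smoothM => //; exact: smooth_cst.
rewrite /lintegral -(integralZl measurable_chart_domain (integrable_chart (continuous_integrand sf))).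
by apply: eq_integral => y _; rewrite /= -EFinM (mulrA c).
Qed.

Lemma sint_eq f g : (forall p, S3 p -> f p = g p) -> sint f = sint g.
Proof.
by move=> fg; rewrite /sint /lintegral; congr fine; apply: eq_integral => y _;
  rewrite fg//; exact: S3_hopf.
Qed.

Lemma sint_ge0 f : smooth f -> (forall p, S3 p -> 0 <= f p) -> 0 <= sint f.
Proof.
move=> sf f0; rewrite -lee_fin -sintE//; apply: integral_ge0 => y Dy.
by rewrite lee_fin mulr_ge0 ?f0 ?(ltW (weight_gt0 Dy))//; exact: S3_hopf.
Qed.

(** The density depends on eta alone and has the primitive sin^2 / 2, whence 1/2 times (2 pi)^2. *)
Lemma sint1 : sint (cst 1) = 2 * pi ^+ 2.
Proof.
apply: EFin_inj; rewrite -sintE; last exact: smooth_cst.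
rewrite /lintegral.
have dF (t : R) : is_derive t 1 (fun s => 2^-1 * (sin s * sin s)) (cos t * sin t).
  by eapply is_derive_eq; [isd|rewrite /=; field].
have cf : continuous (fun t : R => cos t * sin t).
  by apply: continuous_mul => t; [exact: continuous_cos|exact: continuous_sin].
transitivity (\int[mu3]_(y in @chart_domain R) (weight y)%:E)%E.
  by apply: eq_integral => y _; rewrite /= mul1r.
apply: etrans (box_integral_fst (@chart_lo_hi R) dF cf) _.
by rewrite /chart_lo /chart_hi/= sin_pihalf sin0; congr (_%:E); field.
Qed.

Lemma integralS3E (g : E4 -> R) f : smooth f -> (forall p, S3 p -> g p = f p) ->
  integralS3 g = (sint f)%:E.
Proof.
move=> sf gf; rewrite -sintE// /integralS3 /lintegral.
apply: eq_integral => y; rewrite inE => Dy.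
by rewrite sqrt_det_metric// gf//; exact: S3_hopf.
Qed.

Lemma continuous_chart_vectors i :
  [/\ continuous (fun y : R3 => chart_eta y i 0), continuous (fun y : R3 => chart_xi1 y i 0)
    & continuous (fun y : R3 => chart_xi2 y i 0)].
Proof.
pose F (a b c d : R3 -> R) := fun y => vec4 (a y) (b y) (c y) (d y).
have cF a b c d : continuous a -> continuous b -> continuous c -> continuous d ->
    continuous (fun y => F a b c d y i 0).
  move=> ca cb cc cd; rewrite -[X in continuous X]/(coord4 i \o F a b c d) coord_vec4.
  by move: i; apply: I4P; [exact: ca|exact: cb|exact: cc|exact: cd].
by split; apply: cF; cont.
Qed.

Lemma chart_integralD0 (G1 G2 : R3 -> R) : continuous G1 -> continuous G2 ->
  (\int[mu3]_(y in @chart_domain R) (G1 y)%:E = 0)%E ->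
  (\int[mu3]_(y in @chart_domain R) (G2 y)%:E = 0)%E ->
  (\int[mu3]_(y in @chart_domain R) (G1 y + G2 y)%:E = 0)%E.
Proof.
move=> c1 c2 I1 I2.
apply: etrans (integralD measurable_chart_domain (integrable_chart c1) (integrable_chart c2)) _.
rewrite -[RHS]adde0; congr (_ + _)%E; [exact: I1|exact: I2].
Qed.

Lemma imul_chart (y : R3) : imul (hopf_chart y) = chart_xi1 y + chart_xi2 y.
Proof.
case: y => -[x1 x2] x3.
by apply: E4_eq; rewrite /imul /chart_xi1 /chart_xi2 !mxE/= ?addr0 ?add0r.
Qed.

Lemma derive_lin f x (u v : E4) (a b : R) : smooth f -> U0 x ->
  'D_(a *: u + b *: v) f x = a * 'D_u f x + b * 'D_v f x.
Proof.
move=> sf Ux; have df := smooth_differentiable sf Ux.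
by rewrite !deriveE// linearD !linearZ.
Qed.

(** In Hopf coordinates [imul] is the sum of the two angular coordinate fields. The density does not
    depend on the angles, so the integrand is a sum of an xi1-derivative and an xi2-derivative of
    periodic functions. *)
Lemma sint_Lie0 f : smooth f -> sint (Lie 0 f) = 0.
Proof.
move=> sf; apply: EFin_inj; rewrite -sintE; last exact: smooth_Lie.
have c1 := continuous_derive_chart sf (fun i => let: And3 _ h _ := continuous_chart_vectors i in h).
have c2 := continuous_derive_chart sf (fun i => let: And3 _ _ h := continuous_chart_vectors i in h).
pose G1 := fun y : R3 => weight y * 'D_(chart_xi1 y) f (hopf_chart y).
pose G2 := fun y : R3 => weight y * 'D_(chart_xi2 y) f (hopf_chart y).
have cG1 : continuous G1 by exact: continuous_mul continuous_weight c1.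
have cG2 : continuous G2 by exact: continuous_mul continuous_weight c2.
have GE y : Lie 0 f (hopf_chart y) * weight y = G1 y + G2 y.
  rewrite /Lie frame0E imul_chart /G1 /G2 -mulrDr mulrC; congr (_ * _).
  by rewrite -[chart_xi1 y in LHS]scale1r -[chart_xi2 y in LHS]scale1r
    (derive_lin _ _ _ _ sf (U0_hopf y)) !mul1r.
have I1 : (\int[mu3]_(x in @chart_domain R) (G1 x)%:E = 0)%E.
  apply: (@box_integral_derive1 _ _ _ (@chart_lo_hi R) (fun y => weight y * f (hopf_chart y))) => //.
    move=> x z t; have D := is_derive_fun_xi1 t x z sf.
    eapply is_derive_eq; first by eapply is_derive_mul; [exact: (is_derive_const (weight (x, t, z)))|exact: D].
    by rewrite /G1 mulr0 addr0.
  move=> x z; rewrite /chart_hi /chart_lo/= /hopf_chart mulr_natl -[pi *+ 2]add0r.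
  by rewrite cosD2pi sinD2pi.
have I2 : (\int[mu3]_(x in @chart_domain R) (G2 x)%:E = 0)%E.
  apply: (@box_integral_derive2 _ _ _ (@chart_lo_hi R) (fun y => weight y * f (hopf_chart y))) => //.
    move=> [x z] t; have D := is_derive_fun_xi2 t x z sf.
    eapply is_derive_eq; first by eapply is_derive_mul; [exact: (is_derive_const (weight (x, z, t)))|exact: D].
    by rewrite /G2 mulr0 addr0.
  move=> [x z]; rewrite /chart_hi /chart_lo/= /hopf_chart mulr_natl -[pi *+ 2]add0r.
  by rewrite cosD2pi sinD2pi.
transitivity (\int[mu3]_(y in @chart_domain R) (G1 y + G2 y)%:E)%E.
  by apply: eq_integral => y _; rewrite GE.
exact: chart_integralD0 cG1 cG2 I1 I2.
Qed.

(* [cc] and [ss] stand for [cos] and [sin] (for the field [jmul]) or for [sin]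
   and [- cos] (for the field [kmul]), evaluated at xi1 + xi2. *)
Lemma sint_Lie_aux (cc ss : R -> R) a f : smooth f ->
  (forall z t : R, is_derive t 1 (fun s => cc (s + z)) (- ss (t + z))) ->
  (forall z t : R, is_derive t 1 (fun s => ss (s + z)) (cc (t + z))) ->
  continuous cc -> continuous ss ->
  (forall t, cc (t + 2 * pi) = cc t) -> (forall t, ss (t + 2 * pi) = ss t) ->
  (forall y : R3, weight y *: frame a (hopf_chart y) =
    (cc (y.1.2 + y.2) * weight y) *: chart_eta y
    + (ss (y.1.2 + y.2) * sin y.1.1 ^+ 2) *: chart_xi1 y
    - (ss (y.1.2 + y.2) * cos y.1.1 ^+ 2) *: chart_xi2 y) ->
  sint (Lie a f) = 0.
Proof.
move=> sf dcc dss ccc css pcc pss aE.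
apply: EFin_inj; rewrite -sintE; last exact: smooth_Lie.
have c0 := continuous_derive_chart sf (fun i => let: And3 h _ _ := continuous_chart_vectors i in h).
have c1 := continuous_derive_chart sf (fun i => let: And3 _ h _ := continuous_chart_vectors i in h).
have c2 := continuous_derive_chart sf (fun i => let: And3 _ _ h := continuous_chart_vectors i in h).
have cch := continuous_chart sf.
have ccc' : continuous (fun y : R3 => cc (y.1.2 + y.2)).
  by move=> y; apply: continuous_comp; last exact: ccc;
    exact: (continuous_add continuous_xi1 continuous_xi2).
have css' : continuous (fun y : R3 => ss (y.1.2 + y.2)).
  by move=> y; apply: continuous_comp; last exact: css;
    exact: (continuous_add continuous_xi1 continuous_xi2).
pose h (y : R3) : R := f (hopf_chart y).
(* [G0], [G1], [G2] are the derivatives in eta, xi1, xi2 of [f] times the components of the weighted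
   field. They add up to the weighted [Lie a f] because the coefficients of [h] cancel: cos^2 -
   sin^2, sin^2 and - cos^2, all times [cc]. *)
pose G0 (y : R3) : R := cc (y.1.2 + y.2) * ((cos y.1.1 * cos y.1.1 + - (sin y.1.1 * sin y.1.1)) * h y
  + (cos y.1.1 * sin y.1.1) * 'D_(chart_eta y) f (hopf_chart y)).
pose G1 (y : R3) : R := (sin y.1.1 * sin y.1.1) * (cc (y.1.2 + y.2) * h y
  + ss (y.1.2 + y.2) * 'D_(chart_xi1 y) f (hopf_chart y)).
pose G2 (y : R3) : R := - (cos y.1.1 * cos y.1.1) * (cc (y.1.2 + y.2) * h y
  + ss (y.1.2 + y.2) * 'D_(chart_xi2 y) f (hopf_chart y)).
have cE := continuous_cosf (@continuous_eta R).
have sE := continuous_sinf (@continuous_eta R).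
have cG0 : continuous G0.
  exact: continuous_mul ccc' (continuous_add (continuous_mul (continuous_add
    (continuous_mul cE cE) (continuous_opp (continuous_mul sE sE))) cch)
    (continuous_mul (continuous_mul cE sE) c0)).
have cG1 : continuous G1.
  exact: continuous_mul (continuous_mul sE sE) (continuous_add (continuous_mul ccc' cch)
    (continuous_mul css' c1)).
have cG2 : continuous G2.
  exact: continuous_mul (continuous_opp (continuous_mul cE cE)) (continuous_add
    (continuous_mul ccc' cch) (continuous_mul css' c2)).
have GE y : Lie a f (hopf_chart y) * weight y = G0 y + G1 y + G2 y.
  have U := U0_hopf y.
  have E : 'D_(weight y *: frame a (hopf_chart y)) f (hopf_chart y) = weight y * Lie a f (hopf_chart y).
    have := derive_lin (frame a (hopf_chart y)) 0 (weight y) 0 sf U.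
    by rewrite scaler0 addr0 mul0r addr0.
  rewrite mulrC -E aE -scaleNr -[X in X + _]scale1r !derive_lin// mul1r.
  rewrite /G0 /G1 /G2 /weight /h; ring.
have cG01 : continuous (fun y => G0 y + G1 y) by exact: continuous_add cG0 cG1.
have I0 : (\int[mu3]_(x in @chart_domain R) (G0 x)%:E = 0)%E.
  apply: (@box_integral_derive0 _ _ _ (@chart_lo_hi R)
    (fun y => cc (y.1.2 + y.2) * ((cos y.1.1 * sin y.1.1) * h y))) => //.
    move=> y z t; have D := is_derive_fun_eta t y z sf.
    eapply is_derive_eq.
      eapply is_derive_mul; first exact: (is_derive_const (cc (y + z))).
      eapply is_derive_mul; last exact: D.
      by eapply is_derive_mul; [exact: is_derive_cos|exact: is_derive_sin].
    by rewrite /G0 /h /=; ring.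
  (* There is no periodicity in eta; the boundary terms vanish with the density. *)
  by move=> y z; rewrite /chart_hi /chart_lo/= cos_pihalf sin0 !(mul0r, mulr0).
have I1 : (\int[mu3]_(x in @chart_domain R) (G1 x)%:E = 0)%E.
  apply: (@box_integral_derive1 _ _ _ (@chart_lo_hi R)
    (fun y => (sin y.1.1 * sin y.1.1) * (ss (y.1.2 + y.2) * h y))) => //.
    move=> x z t; have D := is_derive_fun_xi1 t x z sf.
    eapply is_derive_eq.
      eapply is_derive_mul; first exact: (is_derive_const (sin x * sin x)).
      by eapply is_derive_mul; [exact: dss|exact: D].
    by rewrite /G1 /h /=; ring.
  move=> x z; rewrite /chart_hi /chart_lo/= /h /hopf_chart.
  rewrite [2 * pi + z]addrC pss add0r mulr_natl -[pi *+ 2]add0r.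
  by rewrite cosD2pi sinD2pi.
have I2 : (\int[mu3]_(x in @chart_domain R) (G2 x)%:E = 0)%E.
  apply: (@box_integral_derive2 _ _ _ (@chart_lo_hi R)
    (fun y => - (cos y.1.1 * cos y.1.1) * (ss (y.2 + y.1.2) * h y))) => //.
    move=> [x z] t; have D := is_derive_fun_xi2 t x z sf.
    eapply is_derive_eq.
      eapply is_derive_mul; first exact: (is_derive_const (- (cos x * cos x))).
      by eapply is_derive_mul; [exact: dss|exact: D].
    by rewrite /G2 /h /= [z + t]addrC; ring.
  move=> [x z]; rewrite /chart_hi /chart_lo/= /h /hopf_chart.
  rewrite [2 * pi + z]addrC pss add0r mulr_natl -[pi *+ 2]add0r.
  by rewrite cosD2pi sinD2pi.
transitivity (\int[mu3]_(y in @chart_domain R) (G0 y + G1 y + G2 y)%:E)%E.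
  by apply: eq_integral => y _; rewrite GE.
exact: chart_integralD0 cG01 cG2 (chart_integralD0 cG0 cG1 I0 I1) I2.
Qed.

(** Homogenizes a trigonometric identity: with [k] = cos^2 + sin^2, the product [u * k] equals [v]
    as a polynomial. *)
Lemma mul1_eq (k u v : R) : k = 1 -> u * k = v -> u = v.
Proof. by move=> ->; rewrite mulr1. Qed.

(** The frame fields generate isometries, hence are divergence free; expanding them in the
    coordinate fields makes this explicit. *)
Lemma sint_Lie a f : smooth f -> sint (Lie a f) = 0.
Proof.
move=> sf; move: a; apply: I3P.
- exact: sint_Lie0.
- apply: (@sint_Lie_aux cos sin) => //.
  + by move=> z t; exact: is_derive_cosD.
  + by move=> z t; exact: is_derive_sinD.
  + by move=> t; exact: continuous_cos.
  + by move=> t; exact: continuous_sin.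
  + by move=> t; rewrite mulr_natl cosD2pi.
  + by move=> t; rewrite mulr_natl sinD2pi.
  case=> -[x1 x2] x3; rewrite frame1E /weight/= cosD sinD.
  have := cos2Dsin2 x2; have := cos2Dsin2 x3; rewrite /jmul /chart_eta /chart_xi1 /chart_xi2.
  move: (cos x1) (sin x1) (cos x2) (sin x2) (cos x3) (sin x3) => c1 s1 c2 s2 c3 s3 e3 e2.
  by apply: E4_eq; rewrite !mxE/=; (apply: (mul1_eq e2); ring) || (apply: (mul1_eq e3); ring).
- apply: (@sint_Lie_aux sin (fun t => - cos t)) => //.
  + by move=> z t; rewrite opprK; exact: is_derive_sinD.
  + by move=> z t; have := is_derive_opp (is_derive_cosD t z); rewrite opprK.
  + by move=> t; exact: continuous_sin.
  + by apply: continuous_opp => t; exact: continuous_cos.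
  + by move=> t; rewrite mulr_natl sinD2pi.
  + by move=> t; rewrite mulr_natl cosD2pi.
  case=> -[x1 x2] x3; rewrite frame2E /weight/= cosD sinD.
  have := cos2Dsin2 x2; have := cos2Dsin2 x3; rewrite /kmul /chart_eta /chart_xi1 /chart_xi2.
  move: (cos x1) (sin x1) (cos x2) (sin x2) (cos x3) (sin x3) => c1 s1 c2 s2 c3 s3 e3 e2.
  by apply: E4_eq; rewrite !mxE/=; (apply: (mul1_eq e2); ring) || (apply: (mul1_eq e3); ring).
Qed.

Lemma polar (a b : R) : exists r t, [/\ 0 <= r, r ^+ 2 = a ^+ 2 + b ^+ 2,
  0 <= t <= 2 * pi & (a = r * cos t) * (b = r * sin t)].
Proof.
pose r := Num.sqrt (a ^+ 2 + b ^+ 2).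
have n0 : 0 <= a ^+ 2 + b ^+ 2 by rewrite addr_ge0 ?sqr_ge0.
have rr : r ^+ 2 = a ^+ 2 + b ^+ 2 by rewrite sqr_sqrtr.
have r0 : 0 <= r by exact: sqrtr_ge0.
have pi0 := pi_ge0 R.
have [rz|rn] := eqVneq r 0.
  exists 0, 0; split=> //; first by rewrite -rz rr.
    by rewrite lexx mulr_ge0.
  move: rr; rewrite rz expr0n/= => /esym/eqP; rewrite paddr_eq0 ?sqr_ge0// !sqrf_eq0.
  by move=> /andP[/eqP-> /eqP->]; rewrite !mul0r.
have rp : 0 < r by rewrite lt_neqAle eq_sym rn.
have ab1 : (a / r) ^+ 2 + (b / r) ^+ 2 = 1.
  by rewrite !expr_div_n -mulrDl -rr divff// sqrf_eq0.
have ar1 : -1 <= a / r <= 1.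
  rewrite -ler_norml -(@ler_pXn2r _ 2)// ?nnegrE// expr1n real_normK ?num_real//.
  by rewrite -ab1 lerDl sqr_ge0.
have cK : cos (acos (a / r)) = a / r by apply: acosK; rewrite in_itv.
have sK : sin (acos (a / r)) = `|b / r|.
  by rewrite sin_acos// -ab1 addrC addKr sqrtr_sqr.
have aE : a = r * (a / r) by rewrite mulrC divfK.
have bE : b = r * (b / r) by rewrite mulrC divfK.
have ac0 := acos_ge0 ar1; have acpi := acos_lepi ar1.
have [b0|b0] := leP 0 b.
  exists r, (acos (a / r)); split=> //.
    by rewrite ac0/= (le_trans acpi)// mulr_natl mulr2n lerDl.
  by rewrite cK sK ger0_norm ?divr_ge0//; split.
exists r, (2 * pi - acos (a / r)); split=> //.
  rewrite subr_ge0 gerBl ac0 andbT (le_trans acpi)// mulr_natl mulr2n lerDl//.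
rewrite cosB sinB mulr_natl cos2pi sin2pi cK sK ltr0_norm ?pmulr_llt0 ?invr_gt0//.
by rewrite !mul1r !mul0r addr0 sub0r opprK; split.
Qed.

(** Polar coordinates in the two complex planes give the angles, and eta is the arc cosine of the
    first radius. The closed ranges also reach the points outside the image of the open chart
    domain. *)
Lemma hopf_chart_surj p : S3 p -> exists y : R3,
  [/\ 0 <= y.1.1 <= pi / 2, 0 <= y.1.2 <= 2 * pi, 0 <= y.2 <= 2 * pi & hopf_chart y = p].
Proof.
rewrite /S3/= dot4 => Sp.
have [r1 [t1 [r10 r1E t1P [p0 p1]]]] := polar (p 0 0) (p 1 0).
have [r2 [t2 [r20 r2E t2P [p2 p3]]]] := polar (p 2 0) (p 3 0).
have rr : r1 ^+ 2 + r2 ^+ 2 = 1 by rewrite r1E r2E -Sp; ring.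
have r11 : r1 <= 1.
  by rewrite -(@ler_pXn2r _ 2)// ?nnegrE// expr1n -rr lerDl sqr_ge0.
have rI : -1 <= r1 <= 1 by rewrite r11 andbT (le_trans _ r10)// lerN10.
have cK : cos (acos r1) = r1 by apply: acosK; rewrite in_itv.
have sK : sin (acos r1) = r2.
  by rewrite sin_acos// -rr addrC addKr sqrtr_sqr ger0_norm.
exists (acos r1, t1, t2); split=> //=; last first.
  by apply: E4_eq; rewrite /= vec4E ?cK ?sK.
rewrite acos_ge0//= leNgt; apply/negP => api.
have : cos (acos r1) < 0.
  rewrite -[acos r1](subrK pi) cosDpi oppr_lt0 cos_gt0_pihalf//.
  rewrite ltrBrDr ltrBlDr; have := acos_lepi rI; have := pi_gt0 R; move: api.
  by move: (acos r1) pi => u v ? ? ?; apply/andP; split; lra.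
by rewrite cK ltNge r10.
Qed.

(** On the open chart domain this is [box_integral_eq0]. Any other point has coordinates on the
    boundary of the box; moving them towards the interior point (pi/4, pi, pi) enters the open box
    at once, and continuity at time 0 concludes. *)
Lemma sint_eq0 f : smooth f -> (forall p, S3 p -> 0 <= f p) -> sint f = 0 ->
  forall p, S3 p -> f p = 0.
Proof.
move=> sf f0 If p Sp.
have D0 y : chart_domain y -> f (hopf_chart y) = 0.
  move=> Dy; have I0 : (\int[mu3]_(y in box chart_lo chart_hi) (f (hopf_chart y) * weight y)%:E = 0)%E.
    by rewrite -[RHS]/((0 : R)%:E) -If -sintE.
  have /eqP : f (hopf_chart y) * weight y = 0.
    apply: (box_integral_eq0 (continuous_integrand sf) _ I0 Dy) => z Dz.
    by rewrite mulr_ge0 ?f0 ?(ltW (weight_gt0 Dz))//; exact: S3_hopf.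
  by rewrite mulf_eq0 (gt_eqF (weight_gt0 Dy)) orbF => /eqP.
have [[[x1 x2] x3] [/= X1 X2 X3 <-]] := hopf_chart_surj Sp.
pose c : R -> R3 := fun t => (x1 + t * (pi / 4 - x1), x2 + t * (pi - x2), x3 + t * (pi - x3)).
pose g t := f (hopf_chart (c t)).
have g0 t : 0 < t -> t <= 1 -> g t = 0.
  move=> t0 t1; apply: D0; have := pi_gt0 R => pi0.
  have K (x m M : R) : 0 < m -> m < M -> 0 <= x <= M -> x + t * (m - x) \in `]0, M[.
    move=> m0 mM /andP[x0 xM]; rewrite in_itv/=; apply/andP; split.
      have -> : x + t * (m - x) = (1 - t) * x + t * m by ring.
      by rewrite ltr_wpDl ?mulr_gt0// mulr_ge0// subr_ge0.
    rewrite -subr_gt0.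
    have -> : M - (x + t * (m - x)) = (1 - t) * (M - x) + t * (M - m) by ring.
    by rewrite ltr_wpDl ?mulr_gt0 ?subr_gt0// mulr_ge0// subr_ge0.
  split; [split|] => /=; apply: K => //; lra.
have cg : continuous g.
  have cc : continuous c.
    have cl (x m : R) : continuous (fun t : R => x + t * (m - x)).
      apply: continuous_add; first exact: continuous_const.
      by apply: continuous_mul; [move=> ?; exact: cvg_id|exact: continuous_const].
    by move=> t; exact: (continuous_pair (continuous_pair (cl x1 _ t) (cl x2 _ t)) (cl x3 _ t)).
  move=> t; apply: (@continuous_comp _ _ _ c (fun y => f (hopf_chart y)) t (cc t)).
  exact: continuous_chart.
have -> : f (hopf_chart (x1, x2, x3)) = g 0 by rewrite /g /c !mul0r !addr0.
apply/eqP; apply/negPn/negP => gn.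
have on : open [set u : R | u != 0].
  have -> : [set u : R | u != 0] = ~` [set 0] by apply/seteqP; split => x /eqP.
  by rewrite openC; apply: accessible_closed_set1; exact/hausdorff_accessible/norm_hausdorff.
have N : nbhs (0 : R) [set t | g t != 0].
  by apply: (cg 0 [set u | u != 0]); apply: open_nbhs_nbhs.
have [e /= e0 eP] := (nbhs_ballP _ _).1 N.
pose t := Num.min (e / 2) 1.
have t0 : 0 < t by rewrite lt_min divr_gt0//= ltr01.
have : g t != 0.
  apply: eP; rewrite /ball/= sub0r normrN gtr0_norm// (le_lt_trans (_ : t <= e / 2))//.
    by rewrite ge_min lexx.
  by rewrite ltr_pdivrMr// ltr_pMr// ltr1n.
by rewrite g0 ?eqxx// ge_min lexx orbT.
Qed.

End SphereIntegral.

(** * The Bochner formula *)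

Section RealAlgebra.
Context {R : realType}.

(* The defect of the Bochner inequality: [a] is the acceleration sum_i s_i N_i
   and [N - s a] restricts to the shape operator on the plane orthogonal to [s];
   the second sum is the squared norm of its trace-free symmetric part. *)
Lemma bochner_defect (n00 n01 n02 n10 n11 n12 n20 n21 n22 s0 s1 s2 : R) :
  s0 * s0 + s1 * s1 + s2 * s2 = 1 ->
  n00 * s0 + n01 * s1 + n02 * s2 = 0 ->
  n10 * s0 + n11 * s1 + n12 * s2 = 0 ->
  n20 * s0 + n21 * s1 + n22 * s2 = 0 ->
  let t := n00 + n11 + n22 in
  let a0 := s0 * n00 + s1 * n10 + s2 * n20 in
  let a1 := s0 * n01 + s1 * n11 + s2 * n21 in
  let a2 := s0 * n02 + s1 * n12 + s2 * n22 in
  n00 * n00 + n01 * n01 + n02 * n02 + n10 * n10 + n11 * n11 + n12 * n12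
  + n20 * n20 + n21 * n21 + n22 * n22
  - (t * t - (n00 * n00 + n11 * n11 + n22 * n22
       + 2 * (n01 * n10 + n02 * n20 + n12 * n21))) =
  a0 ^+ 2 + a1 ^+ 2 + a2 ^+ 2
  + 2^-1 * ((2 * (n00 - s0 * a0) - t * (1 - s0 * s0)) ^+ 2
    + (2 * (n11 - s1 * a1) - t * (1 - s1 * s1)) ^+ 2
    + (2 * (n22 - s2 * a2) - t * (1 - s2 * s2)) ^+ 2)
  + (n01 - s0 * a1 + (n10 - s1 * a0) + t * (s0 * s1)) ^+ 2
  + (n02 - s0 * a2 + (n20 - s2 * a0) + t * (s0 * s2)) ^+ 2
  + (n12 - s1 * a2 + (n21 - s2 * a1) + t * (s1 * s2)) ^+ 2.
Proof.
move=> q e0 e1 e2 t a0 a1 a2.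
set n0 := n00 * s0 + _ + _ in e0; set n1 := n10 * s0 + _ + _ in e1.
set n2 := n20 * s0 + _ + _ in e2; set Q := _ + _ in q.
pose g := s0 * n0 + s1 * n1 + s2 * n2.
set rhs := RHS; set lhs := LHS.
(* An identity free of hypotheses: the correction lies in the ideal generated by [Q - 1], [n0], [n1]
   and [n2], which all vanish. *)
have E : rhs = lhs + ((Q - 1) * (a0 ^+ 2 + a1 ^+ 2 + a2 ^+ 2)
   - 2 * (a0 * n0 + a1 * n1 + a2 * n2) + g ^+ 2 + 2 * t * g * (2 - Q)
   + t ^+ 2 * (Q - 1) ^+ 2 / 2).
  by rewrite /rhs /lhs /g /n0 /n1 /n2 /Q /a0 /a1 /a2 /t; field.
by rewrite E /g e0 e1 e2 q; field.
Qed.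

Lemma sum_sqr9_ge0 (a0 a1 a2 b0 b1 b2 c0 c1 c2 : R) :
  0 <= a0 ^+ 2 + a1 ^+ 2 + a2 ^+ 2 + 2^-1 * (b0 ^+ 2 + b1 ^+ 2 + b2 ^+ 2)
  + c0 ^+ 2 + c1 ^+ 2 + c2 ^+ 2.
Proof.
have := sqr_ge0 a0; have := sqr_ge0 a1; have := sqr_ge0 a2.
have := sqr_ge0 b0; have := sqr_ge0 b1; have := sqr_ge0 b2.
have := sqr_ge0 c0; have := sqr_ge0 c1; have := sqr_ge0 c2.
lra.
Qed.

Lemma sum_sqr9_eq0 (a0 a1 a2 b0 b1 b2 c0 c1 c2 : R) :
  a0 ^+ 2 + a1 ^+ 2 + a2 ^+ 2 + 2^-1 * (b0 ^+ 2 + b1 ^+ 2 + b2 ^+ 2)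
  + c0 ^+ 2 + c1 ^+ 2 + c2 ^+ 2 = 0 ->
  [/\ [/\ a0 = 0, a1 = 0 & a2 = 0], [/\ b0 = 0, b1 = 0 & b2 = 0]
    & [/\ c0 = 0, c1 = 0 & c2 = 0]].
Proof.
have z0 (x : R) : x ^+ 2 <= 0 -> x = 0.
  by move=> x0; apply/eqP; rewrite -sqrf_eq0 eq_le x0 sqr_ge0.
have := sqr_ge0 a0; have := sqr_ge0 a1; have := sqr_ge0 a2.
have := sqr_ge0 b0; have := sqr_ge0 b1; have := sqr_ge0 b2.
have := sqr_ge0 c0; have := sqr_ge0 c1; have := sqr_ge0 c2.
by do ![split]; apply: z0; lra.
Qed.

(* Vanishing of the defect: [N] is conformal on the plane orthogonal to [s]. *)
Lemma bochner_equality (n00 n01 n02 n10 n11 n12 n20 n21 n22 s0 s1 s2 : R) :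
  s0 * s0 + s1 * s1 + s2 * s2 = 1 ->
  n00 * s0 + n01 * s1 + n02 * s2 = 0 ->
  n10 * s0 + n11 * s1 + n12 * s2 = 0 ->
  n20 * s0 + n21 * s1 + n22 * s2 = 0 ->
  let t := n00 + n11 + n22 in
  n00 * n00 + n01 * n01 + n02 * n02 + n10 * n10 + n11 * n11 + n12 * n12
  + n20 * n20 + n21 * n21 + n22 * n22
  - (t * t - (n00 * n00 + n11 * n11 + n22 * n22
       + 2 * (n01 * n10 + n02 * n20 + n12 * n21))) = 0 ->
  let k := 2^-1 * (s2 * (n01 - n10) + s0 * (n12 - n21) + s1 * (n20 - n02)) in
  let al := 2^-1 * t in
  [/\ n00 = al * (1 - s0 * s0), n11 = al * (1 - s1 * s1) & n22 = al * (1 - s2 * s2)] /\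
  [/\ n01 = - al * (s0 * s1) + k * s2, n10 = - al * (s0 * s1) - k * s2,
   n02 = - al * (s0 * s2) - k * s1, n20 = - al * (s0 * s2) + k * s1 &
   n12 = - al * (s1 * s2) + k * s0 /\ n21 = - al * (s1 * s2) - k * s0].
Proof.
move=> q e0 e1 e2 t; rewrite (bochner_defect q e0 e1 e2) -/t.
set a0 := s0 * n00 + _ + _; set a1 := s0 * n01 + _ + _; set a2 := s0 * n02 + _ + _.
move=> S0 k al.
have [[A0 A1 A2] [B0 B1 B2] [C0 C1 C2]] := sum_sqr9_eq0 S0.
rewrite A0 A1 A2 !mulr0 !subr0 in B0 B1 B2 C0 C1 C2.
pose w0 := 2^-1 * (n12 - n21); pose w1 := 2^-1 * (n20 - n02); pose w2 := 2^-1 * (n01 - n10).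
have [m01 m02 m12] : [/\ n01 = - al * (s0 * s1) + w2, n02 = - al * (s0 * s2) - w1 &
    n12 = - al * (s1 * s2) + w0] by rewrite /al /w0 /w1 /w2; split; lra.
have [m10 m20 m21] : [/\ n10 = - al * (s0 * s1) - w2, n20 = - al * (s0 * s2) + w1 &
    n21 = - al * (s1 * s2) - w0] by rewrite /al /w0 /w1 /w2; split; lra.
have [m00 m11 m22] : [/\ n00 = al * (1 - s0 * s0), n11 = al * (1 - s1 * s1) &
    n22 = al * (1 - s2 * s2)] by rewrite /al; split; lra.
have q0 x : x * (s0 * s0 + s1 * s1 + s2 * s2) = x by rewrite q mulr1.
(* N s = 0 now says that the axial vector w of the skew part of N has zero cross product with the
   unit vector s, so w = k s with k = s . w. *)
have h0 : w2 * s1 = w1 * s2.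
  by have := e0; rewrite m00 m01 m02; have := q0 (al * s0); lra.
have h1 : w0 * s2 = w2 * s0.
  by have := e1; rewrite m10 m11 m12; have := q0 (al * s1); lra.
have h2 : w1 * s0 = w0 * s1.
  by have := e2; rewrite m20 m21 m22; have := q0 (al * s2); lra.
have kE : k = s0 * w0 + s1 * w1 + s2 * w2 by rewrite /k /w0 /w1 /w2; ring.
have k0 : k * s0 = w0.
  rewrite kE -[RHS]q0; have := congr1 ( *%R s1) h2; have := congr1 ( *%R s2) h1; lra.
have k1 : k * s1 = w1.
  rewrite kE -[RHS]q0; have := congr1 ( *%R s0) h2; have := congr1 ( *%R s2) h0; lra.
have k2 : k * s2 = w2.
  rewrite kE -[RHS]q0; have := congr1 ( *%R s0) h1; have := congr1 ( *%R s1) h0; lra.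
by rewrite k0 k1 k2.
Qed.

(** The terms by which the covariant derivative differs from the frame derivative have the shape of
    the rotation term, and merely shift its coefficient from [k] to [k - 1]. *)
Lemma conformal_of_cov (l : 'I_3 -> 'I_3 -> R) (v : 'I_3 -> R) (A k : R) :
  let n a c := l a c + (eps a c 0 * v 0 + eps a c 1 * v 1 + eps a c 2 * v 2) in
  [/\ n 0 0 = A * (1 - v 0 * v 0), n 1 1 = A * (1 - v 1 * v 1) & n 2 2 = A * (1 - v 2 * v 2)] ->
  [/\ n 0 1 = - A * (v 0 * v 1) + k * v 2, n 1 0 = - A * (v 0 * v 1) - k * v 2,
   n 0 2 = - A * (v 0 * v 2) - k * v 1, n 2 0 = - A * (v 0 * v 2) + k * v 1 &
   n 1 2 = - A * (v 1 * v 2) + k * v 0 /\ n 2 1 = - A * (v 1 * v 2) - k * v 0] ->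
  forall a c, l a c = A * ((a == c)%:R - v a * v c)
    + (k - 1) * (eps a c 0 * v 0 + eps a c 1 * v 1 + eps a c 2 * v 2).
Proof.
rewrite /eps /= => -[e00 e11 e22] [e01 e10 e02 e20 [e12 e21]].
apply: I3P; apply: I3P; rewrite /=; lra.
Qed.

(* [dl b a c] stands for the second derivative E_b E_a s_c, computed from
   E_a s_c = al (delta_ac - s_a s_c) + ga eps_acd s_d; the hypotheses express
   that the frame satisfies [E_0, E_1] = - 2 E_2 and its circular permutations. *)
Lemma integrability (s : 'I_3 -> R) (A G : 'I_3 -> R) (al ga : R)
    (l : 'I_3 -> 'I_3 -> R) (dl : 'I_3 -> 'I_3 -> 'I_3 -> R) :
  s 0 * s 0 + s 1 * s 1 + s 2 * s 2 = 1 ->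
  (forall a c, l a c = al * ((a == c)%:R - s a * s c)
     + ga * (eps a c 0 * s 0 + eps a c 1 * s 1 + eps a c 2 * s 2)) ->
  (forall b a c, dl b a c = A b * ((a == c)%:R - s a * s c)
     - al * (s a * l b c + s c * l b a)
     + G b * (eps a c 0 * s 0 + eps a c 1 * s 1 + eps a c 2 * s 2)
     + ga * (eps a c 0 * l b 0 + eps a c 1 * l b 1 + eps a c 2 * l b 2)) ->
  (forall c, dl 0 1 c - dl 1 0 c = - 2 * l 2 c) ->
  (forall c, dl 1 2 c - dl 2 1 c = - 2 * l 0 c) ->
  (forall c, dl 2 0 c - dl 0 2 c = - 2 * l 1 c) ->
  let w := ga * ga - al * al + 2 * ga in
  s 0 * G 0 + s 1 * G 1 + s 2 * G 2 = - 2 * al * (ga + 1) /\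
  [/\ A 0 = w * s 0 - (s 1 * G 2 - s 2 * G 1),
     A 1 = w * s 1 - (s 2 * G 0 - s 0 * G 2) &
     A 2 = w * s 2 - (s 0 * G 1 - s 1 * G 0)].
Proof.
move=> q lE dlE c01 c12 c20 w.
have q0 x : x * (s 0 * s 0 + s 1 * s 1 + s 2 * s 2) = x by rewrite q mulr1.
have := c12 0; have := c12 1; have := c12 2.
have := c20 0; have := c20 1; have := c20 2.
have := c01 0; have := c01 1; have := c01 2.
rewrite !dlE !lE /eps/=.
move: (s 0) (s 1) (s 2) (A 0) (A 1) (A 2) (G 0) (G 1) (G 2) q0
  => s0 s1 s2 A0 A1 A2 G0 G1 G2 q0.
move=> r22 r21 r20 r12 r11 r10 r02 r01 r00.
have sG : s0 * G0 + s1 * G1 + s2 * G2 = - 2 * al * (ga + 1).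
  have := q0 (al * ga); have := q0 al; lra.
split=> //.
(* The commutation relations give A = - SA s - s x G + 2 w s, where SA = s . A; the product with s
   then yields SA = - SA + 2 w, so SA = w. *)
pose SA := s0 * A0 + s1 * A1 + s2 * A2.
have f0 : A0 = - s0 * SA - (s1 * G2 - s2 * G1) + 2 * w * s0.
  have := q0 A0; rewrite /SA /w; lra.
have f1 : A1 = - s1 * SA - (s2 * G0 - s0 * G2) + 2 * w * s1.
  have := q0 A1; rewrite /SA /w; lra.
have f2 : A2 = - s2 * SA - (s0 * G1 - s1 * G0) + 2 * w * s2.
  have := q0 A2; rewrite /SA /w; lra.
have SE : SA = s0 * A0 + s1 * A1 + s2 * A2 by [].
clearbody SA w.
have SAE : SA = w.
  have := congr1 ( *%R s0) f0; have := congr1 ( *%R s1) f1; have := congr1 ( *%R s2) f2.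
  have := q0 SA; have := q0 w; lra.
by rewrite SAE in f0 f1 f2; split; lra.
Qed.

End RealAlgebra.

(* The calculus of the frame is axiomatized as three derivations [D] of an
   algebra [sm] of functions on [U]. *)
Section FrameCalculus.
Context {R : realType} {T : Type}.
Variables (U : set T) (sm : (T -> R) -> Prop) (D : 'I_3 -> (T -> R) -> T -> R).
Hypotheses
  (smD : forall f g, sm f -> sm g -> sm (f + g))
  (smM : forall f g, sm f -> sm g -> sm (f * g))
  (smN : forall f, sm f -> sm (- f))
  (smc : forall c, sm (cst c))
  (smL : forall a f, sm f -> sm (D a f))
  (DD : forall a x, U x -> forall f g, sm f -> sm g -> D a (f + g) x = D a f x + D a g x)
  (DM : forall a x, U x -> forall f g, sm f -> sm g ->
    D a (f * g) x = f x * D a g x + g x * D a f x)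
  (DN : forall a x, U x -> forall f, sm f -> D a (- f) x = - D a f x)
  (Dc : forall a x, U x -> forall c, D a (cst c) x = 0)
  (Deq : forall a f g x, {in U, f =1 g} -> U x -> D a f x = D a g x)
  (comm01 : forall f x, sm f -> U x -> D 0 (D 1 f) x - D 1 (D 0 f) x = - 2 * D 2 f x)
  (comm12 : forall f x, sm f -> U x -> D 1 (D 2 f) x - D 2 (D 1 f) x = - 2 * D 0 f x)
  (comm20 : forall f x, sm f -> U x -> D 2 (D 0 f) x - D 0 (D 2 f) x = - 2 * D 1 f x).
Variable s : 'I_3 -> T -> R.
Hypotheses (sms : forall a, sm (s a))
  (s1 : forall x, U x -> s 0 x * s 0 x + s 1 x * s 1 x + s 2 x * s 2 x = 1).

Ltac smt := repeat lazymatch goal with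
  | |- sm (_ + _) => apply: smD
  | |- sm (_ * _) => apply: smM
  | |- sm (- _) => apply: smN
  | |- sm (cst _) => apply: smc
  | |- sm (D _ _) => apply: smL
  | |- _ => by []
  end.

Lemma unit_orthogonal a x : U x ->
  s 0 x * D a (s 0) x + s 1 x * D a (s 1) x + s 2 x * D a (s 2) x = 0.
Proof.
move=> Ux; have := @Deq a (s 0 * s 0 + s 1 * s 1 + s 2 * s 2) (cst 1) x.
rewrite Dc// !DD ?DM//; try smt.
move=> /(_ _ Ux) H.
have : s 0 x * D a (s 0) x + s 0 x * D a (s 0) x
  + (s 1 x * D a (s 1) x + s 1 x * D a (s 1) x)
  + (s 2 x * D a (s 2) x + s 2 x * D a (s 2) x) = 0.
  by apply: H => y; rewrite inE => Uy; exact: s1.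
lra.
Qed.

Definition cov a c x :=
  D a (s c) x + (eps a c 0 * s 0 x + eps a c 1 * s 1 x + eps a c 2 * s 2 x).

(** The derivative of |s|^2 = 1, the [eps] terms cancelling by skewness. *)
Lemma cov_unit a x : U x -> cov a 0 x * s 0 x + cov a 1 x * s 1 x + cov a 2 x * s 2 x = 0.
Proof.
move=> Ux; have := unit_orthogonal a Ux; rewrite /cov.
move: a; apply: I3P; rewrite /eps/=; lra.
Qed.

Definition divs := D 0 (s 0) + D 1 (s 1) + D 2 (s 2).

(** The field (div sigma) sigma - nabla_sigma sigma; in the second term the [eps] part of the
    covariant derivative cancels by skewness. *)
Definition bochner_field a :=
  s a * divs + - (s 0 * D 0 (s a) + s 1 * D 1 (s a) + s 2 * D 2 (s a)).

Lemma sm_bochner_field a : sm (bochner_field a).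
Proof. by rewrite /bochner_field /divs; smt. Qed.

Definition sigma2 x := divs x * divs x
  - (cov 0 0 x * cov 0 0 x + cov 1 1 x * cov 1 1 x + cov 2 2 x * cov 2 2 x
     + 2 * (cov 0 1 x * cov 1 0 x + cov 0 2 x * cov 2 0 x + cov 1 2 x * cov 2 1 x)).

(** Second derivatives occur in the divergence only through commutators of the frame. With the [eps]
    terms of [cov], these produce the Ricci term 2 |s|^2. *)
Lemma bochner_formula x : U x -> sigma2 x =
  2 + (D 0 (bochner_field 0) x + D 1 (bochner_field 1) x + D 2 (bochner_field 2) x).
Proof.
move=> Ux.
have DV a : D a (bochner_field a) x =
    s a x * (D a (D 0 (s 0)) x + D a (D 1 (s 1)) x + D a (D 2 (s 2)) x)
    + divs x * D a (s a) x
    - (s 0 x * D a (D 0 (s a)) x + D 0 (s a) x * D a (s 0) x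
       + (s 1 x * D a (D 1 (s a)) x + D 1 (s a) x * D a (s 1) x)
       + (s 2 x * D a (D 2 (s a)) x + D 2 (s a) x * D a (s 2) x)).
  rewrite /bochner_field DD//; try by rewrite /divs; smt.
  rewrite DN//; try smt.
  rewrite DM//; try by rewrite /divs; smt.
  rewrite {1}/divs !DD//; try smt.
  by rewrite !DM//; smt.
rewrite !DV /sigma2 /cov /eps/= /divs.
have := comm01 (sms 0) Ux; have := comm01 (sms 1) Ux; have := comm01 (sms 2) Ux.
have := comm12 (sms 0) Ux; have := comm12 (sms 1) Ux; have := comm12 (sms 2) Ux.
have := comm20 (sms 0) Ux; have := comm20 (sms 1) Ux; have := comm20 (sms 2) Ux.
have := s1 Ux; rewrite -![(_ + _) x]/(_ x + _ x).
move: (D 0 (D 0 (s 0)) x) (D 0 (D 1 (s 0)) x) (D 0 (D 2 (s 0)) x)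
  (D 1 (D 0 (s 0)) x) (D 1 (D 1 (s 0)) x) (D 1 (D 2 (s 0)) x)
  (D 2 (D 0 (s 0)) x) (D 2 (D 1 (s 0)) x) (D 2 (D 2 (s 0)) x)
  => a00 a01 a02 a10 a11 a12 a20 a21 a22.
move: (D 0 (D 0 (s 1)) x) (D 0 (D 1 (s 1)) x) (D 0 (D 2 (s 1)) x)
  (D 1 (D 0 (s 1)) x) (D 1 (D 1 (s 1)) x) (D 1 (D 2 (s 1)) x)
  (D 2 (D 0 (s 1)) x) (D 2 (D 1 (s 1)) x) (D 2 (D 2 (s 1)) x)
  => b00 b01 b02 b10 b11 b12 b20 b21 b22.
move: (D 0 (D 0 (s 2)) x) (D 0 (D 1 (s 2)) x) (D 0 (D 2 (s 2)) x)
  (D 1 (D 0 (s 2)) x) (D 1 (D 1 (s 2)) x) (D 1 (D 2 (s 2)) x)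
  (D 2 (D 0 (s 2)) x) (D 2 (D 1 (s 2)) x) (D 2 (D 2 (s 2)) x)
  => c00 c01 c02 c10 c11 c12 c20 c21 c22.
move: (D 0 (s 0) x) (D 1 (s 0) x) (D 2 (s 0) x) (D 0 (s 1) x) (D 1 (s 1) x) (D 2 (s 1) x)
  (D 0 (s 2) x) (D 1 (s 2) x) (D 2 (s 2) x) (s 0 x) (s 1 x) (s 2 x)
  => l00 l10 l20 l01 l11 l21 l02 l12 l22 t0 t1 t2.
move=> q r202 r201 r200 r122 r121 r120 r012 r011 r010.
have -> : a01 = a10 - 2 * l20 by lra.
have -> : b01 = b10 - 2 * l21 by lra.
have -> : b12 = b21 - 2 * l01 by lra.
have -> : c12 = c21 - 2 * l02 by lra.
have -> : a20 = a02 - 2 * l10 by lra.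
have -> : c20 = c02 - 2 * l12 by lra.
(* Once the constant is written as 2 |s|^2, the formula is a polynomial identity. *)
rewrite [X in _ = X + _](_ : 2 = 2 * (t0 * t0 + t1 * t1 + t2 * t2)); last by rewrite q mulr1.
ring.
Qed.

Variables al ga : T -> R.
Hypotheses (sal : sm al) (sga : sm ga)
  (conf : forall a c x, U x -> D a (s c) x = al x * ((a == c)%:R - s a x * s c x)
     + ga x * (eps a c 0 * s 0 x + eps a c 1 * s 1 x + eps a c 2 * s 2 x)).

Lemma conformal_integrability x : U x ->
  let w := ga x * ga x - al x * al x + 2 * ga x in
  s 0 x * D 0 ga x + s 1 x * D 1 ga x + s 2 x * D 2 ga x = - 2 * al x * (ga x + 1) /\
  [/\ D 0 al x = w * s 0 x - (s 1 x * D 2 ga x - s 2 x * D 1 ga x),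
     D 1 al x = w * s 1 x - (s 2 x * D 0 ga x - s 0 x * D 2 ga x) &
     D 2 al x = w * s 2 x - (s 0 x * D 1 ga x - s 1 x * D 0 ga x)].
Proof.
move=> Ux.
apply: (@integrability R (fun a => s a x) (fun a => D a al x) (fun a => D a ga x)
  (al x) (ga x) (fun a c => D a (s c) x) (fun b a c => D b (D a (s c)) x)).
- exact: s1.
- by move=> a c; exact: conf.
- move=> b a c.
  have -> : D b (D a (s c)) x = D b (al * (cst (a == c)%:R + - (s a * s c))
     + ga * (cst (eps a c 0) * s 0 + cst (eps a c 1) * s 1 + cst (eps a c 2) * s 2)) x.
    by apply: Deq => // y; rewrite inE => Uy; rewrite conf.
  rewrite DD//; try smt.
  rewrite DM//; try smt.
  rewrite (DM b Ux sga); last by smt.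
  rewrite !(DD, DN)//; try smt.
  rewrite !DM//; try smt.
  by rewrite !Dc// !fctE; ring.
- by move=> c; exact: comm01.
- by move=> c; exact: comm12.
- by move=> c; exact: comm20.
Qed.

(** This is the divergence of grad al = w s - s x grad ga. The terms in s . grad ga coming from grad
    w and from the curls of s and grad ga cancel; since div s = 2 al and s . grad al = w, what
    remains is 2 al w - 2 al w. *)
Lemma conformal_harmonic x : U x -> D 0 (D 0 al) x + D 1 (D 1 al) x + D 2 (D 2 al) x = 0.
Proof.
move=> Ux.
pose w := ga * ga + - (al * al) + cst 2 * ga.
have smw : sm w by rewrite /w; smt.
have A0 : D 0 (D 0 al) x = D 0 (w * s 0 + - (s 1 * D 2 ga + - (s 2 * D 1 ga))) x.
  by apply: Deq => // y; rewrite inE => Uy; have [_ [-> _ _]] := conformal_integrability Uy.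
have A1 : D 1 (D 1 al) x = D 1 (w * s 1 + - (s 2 * D 0 ga + - (s 0 * D 2 ga))) x.
  by apply: Deq => // y; rewrite inE => Uy; have [_ [_ -> _]] := conformal_integrability Uy.
have A2 : D 2 (D 2 al) x = D 2 (w * s 2 + - (s 0 * D 1 ga + - (s 1 * D 0 ga))) x.
  by apply: Deq => // y; rewrite inE => Uy; have [_ [_ _ ->]] := conformal_integrability Uy.
have E a (i j k l m : T -> R) : sm i -> sm j -> sm k -> sm l -> sm m ->
    D a (w * i + - (j * k + - (l * m))) x =
    w x * D a i x + i x * D a w x - (j x * D a k x + k x * D a j x
      - (l x * D a m x + m x * D a l x)).
  move=> si sj sk sl sm'; rewrite DD//; try smt.
  rewrite DN//; try smt.
  rewrite DD//; try smt.
  rewrite DN//; try smt.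
  by rewrite !DM.
rewrite A0 A1 A2 !E//; try smt.
have Dw a : D a w x = 2 * ga x * D a ga x - 2 * al x * D a al x + 2 * D a ga x.
  rewrite /w DD//; try smt.
  rewrite DD//; try smt.
  rewrite DN//; try smt.
  by rewrite !DM// ?Dc//; try smt; rewrite /cst; ring.
have [sG [B0 B1 B2]] := conformal_integrability Ux.
rewrite !Dw !conf// /eps/= /w !fctE.
have := comm01 sga Ux; have := comm12 sga Ux; have := comm20 sga Ux.
have := s1 Ux; move: sG B0 B1 B2.
move: (D 0 (D 1 ga) x) (D 0 (D 2 ga) x) (D 1 (D 0 ga) x) (D 1 (D 2 ga) x)
  (D 2 (D 0 ga) x) (D 2 (D 1 ga) x) => g01 g02 g10 g12 g20 g21.
move: (D 0 ga x) (D 1 ga x) (D 2 ga x) (D 0 al x) (D 1 al x) (D 2 al x)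
  (s 0 x) (s 1 x) (s 2 x) (al x) (ga x) => G0 G1 G2 A0' A1' A2' t0 t1 t2 a g.
move=> sG B0 B1 B2 q e20 e12 e01.
have -> : g01 = g10 - 2 * G2 by lra.
have -> : g12 = g21 - 2 * G0 by lra.
have -> : g20 = g02 - 2 * G1 by lra.
pose W := g * g - a * a + 2 * g.
have sA : t0 * A0' + t1 * A1' + t2 * A2' = W.
  transitivity (W * (t0 * t0 + t1 * t1 + t2 * t2)); first by rewrite B0 B1 B2 /W; ring.
  by rewrite q mulr1.
transitivity (W * a * (3 - (t0 * t0 + t1 * t1 + t2 * t2))
  - 2 * a * (t0 * A0' + t1 * A1' + t2 * A2')); first by rewrite /W; ring.
by rewrite q sA; ring.
Qed.

End FrameCalculus.

(** * The energy and the case of equality *)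

Section SmoothHom.
Context {R : realType}.
Local Notation E4 := 'cV[R]_4.
Implicit Types f g : E4 -> R.

Lemma hom0D f g : hom0 f -> hom0 g -> hom0 (f + g).
Proof. by move=> hf hg l x l0; rewrite !fctE hf// hg. Qed.

Lemma hom0M f g : hom0 f -> hom0 g -> hom0 (f * g).
Proof. by move=> hf hg l x l0; rewrite !fctE hf// hg. Qed.

Lemma hom0N f : hom0 f -> hom0 (- f).
Proof. by move=> hf l x l0; rewrite !fctE hf. Qed.

Lemma hom0c (c : R) : hom0 (cst c).
Proof. by []. Qed.

Lemma sint_div (V : 'I_3 -> E4 -> R) : (forall a, smooth (V a)) ->
  sint (Lie 0 (V 0) + Lie 1 (V 1) + Lie 2 (V 2)) = 0.
Proof. move=> sV; have sL a : smooth (Lie a (V a)) by exact: smooth_Lie.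
by rewrite !sintD ?sint_Lie ?addr0//; exact: smoothD. Qed.

End SmoothHom.

Ltac smooth_hom := repeat lazymatch goal with
  | |- smooth (_ + _) => apply: smoothD
  | |- smooth (_ * _) => apply: smoothM
  | |- smooth (- _) => apply: smoothN
  | |- smooth (cst _) => apply: smooth_cst
  | |- smooth (Lie _ _) => apply: smooth_Lie
  | |- hom0 (_ + _) => apply: hom0D
  | |- hom0 (_ * _) => apply: hom0M
  | |- hom0 (- _) => apply: hom0N
  | |- hom0 (cst _) => apply: hom0c
  | |- hom0 (Lie _ _) => apply: hom0_Lie
  | |- _ => by []
  end.

(** * Rigidity of conformal geodesic unit fields *)

Section Rigidity.
Context {R : realType}.
Local Notation E4 := 'cV[R]_4.
Local Notation U0 := (@U0 R).
Variables (s : 'I_3 -> E4 -> R) (al ga : E4 -> R).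
Hypotheses (sms : forall a, smooth (s a)) (sal : smooth al) (sga : smooth ga)
  (hal : hom0 al) (hga : hom0 ga)
  (s1 : forall x, U0 x -> s 0 x * s 0 x + s 1 x * s 1 x + s 2 x * s 2 x = 1)
  (conf : forall a c x, U0 x -> Lie a (s c) x = al x * ((a == c)%:R - s a x * s c x)
     + ga x * (eps a c 0 * s 0 x + eps a c 1 * s 1 x + eps a c 2 * s 2 x)).

(** As [al] is harmonic, the divergence of al grad al is |grad al|^2, which therefore has integral
    0. *)
Lemma conformal_Lie_al a x : U0 x -> Lie a al x = 0.
Proof.
have smL b : smooth (Lie b al) by exact: smooth_Lie.
have smA b : smooth (al * Lie b al) by exact: smoothM.
have smQ b : smooth (Lie b al * Lie b al) by exact: smoothM.
pose q := Lie 0 al * Lie 0 al + Lie 1 al * Lie 1 al + Lie 2 al * Lie 2 al.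
have smq : smooth q by apply: smoothD; first exact: smoothD.
have q0 : sint q = 0.
  rewrite -(sint_div smA); apply: sint_eq => p Sp; have Up := S3_U0 Sp.
  rewrite -[RHS]/(Lie 0 (al * Lie 0 al) p + Lie 1 (al * Lie 1 al) p + Lie 2 (al * Lie 2 al) p).
  rewrite (LieM 0 Up sal (smL 0)) (LieM 1 Up sal (smL 1)) (LieM 2 Up sal (smL 2)).
  have := (@conformal_harmonic R _ U0 smooth (@Lie R) smoothD smoothM smoothN smooth_cst smooth_Lie
    (fun a x Ux f g => @LieD R a x Ux f g) (fun a x Ux f g => @LieM R a x Ux f g)
    (fun a x Ux f => @LieN R a x Ux f) (fun a x Ux c => @Lie_cst R a x c) (@Lie_eq R)
    (@Lie_comm01 R) (@Lie_comm12 R) (@Lie_comm20 R) s sms s1 al ga sal sga conf p Up) => H.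
  rewrite -[LHS]/(Lie 0 al p * Lie 0 al p + Lie 1 al p * Lie 1 al p + Lie 2 al p * Lie 2 al p).
  move: (Lie 0 (Lie 0 al) p) (Lie 1 (Lie 1 al) p) (Lie 2 (Lie 2 al) p) H.
  move: (Lie 0 al p) (Lie 1 al p) (Lie 2 al p) (al p) => A0 A1 A2 A h0 h1 h2 H.
  transitivity (A0 * A0 + A1 * A1 + A2 * A2 + A * (h0 + h1 + h2)); last ring.
  by rewrite H mulr0 addr0.
move=> Ux; rewrite -(hom0_U0 (hom0_Lie a hal) Ux).
have ge0 (A0 A1 A2 : R) : 0 <= A0 * A0 + A1 * A1 + A2 * A2.
  by rewrite -!expr2 !addr_ge0 ?sqr_ge0.
have : forall p, S3 p -> 0 <= q p.
  move=> p _; rewrite -[q p]/(Lie 0 al p * Lie 0 al p + Lie 1 al p * Lie 1 al p + Lie 2 al p * Lie 2 al p).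
  exact: ge0.
move=> /(sint_eq0 smq)/(_ q0 _ (S3_retract Ux)).
rewrite -[q _]/(Lie 0 al (retract x) * Lie 0 al (retract x)
  + Lie 1 al (retract x) * Lie 1 al (retract x) + Lie 2 al (retract x) * Lie 2 al (retract x)).
have key (A0 A1 A2 : R) : A0 * A0 + A1 * A1 + A2 * A2 = 0 -> [/\ A0 = 0, A1 = 0 & A2 = 0].
  move=> e; have z0 (y : R) : y * y <= 0 -> y = 0.
    by move=> y0; apply/eqP; rewrite -sqrf_eq0 eq_le expr2 y0 -expr2 sqr_ge0.
  have := sqr_ge0 A0; have := sqr_ge0 A1; have := sqr_ge0 A2.
  by rewrite !expr2; split; apply: z0; lra.
by move=> /key[]; move: a; apply: I3P.
Qed.

(** With [al] constant along the frame and div s = 2 al, the divergence of al s is 2 al^2, which has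
    integral 0. *)
Lemma conformal_al0 x : U0 x -> al x = 0.
Proof.
have smA b : smooth (al * s b) by exact: smoothM.
have smq : smooth (al * al) by exact: smoothM.
have q0 : sint (al * al) = 0.
  suff : 2 * sint (al * al) = 0 by move/eqP; rewrite mulf_eq0 pnatr_eq0 => /eqP.
  rewrite -(sintZ _ smq) -(sint_div smA); apply: sint_eq => p Sp; have Up := S3_U0 Sp.
  rewrite -[RHS]/(Lie 0 (al * s 0) p + Lie 1 (al * s 1) p + Lie 2 (al * s 2) p).
  rewrite -[LHS]/(2 * (al p * al p)).
  rewrite (LieM 0 Up sal (sms 0)) (LieM 1 Up sal (sms 1)) (LieM 2 Up sal (sms 2)).
  rewrite !conformal_Lie_al// !mulr0 !addr0 !conf// /eps/=.
  have := s1 Up; move: (s 0 p) (s 1 p) (s 2 p) (al p) (ga p) => t0 t1 t2 A g q.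
  transitivity (A * (A * (3 - (t0 * t0 + t1 * t1 + t2 * t2)))); last ring.
  by rewrite q; ring.
move=> Ux; rewrite -(hom0_U0 hal Ux); apply/eqP; rewrite -sqrf_eq0 expr2; apply/eqP.
have ge0 : forall p, S3 p -> 0 <= (al * al) p.
  by move=> p _; rewrite -[(al * al) p]/(al p * al p) -expr2 sqr_ge0.
exact: (sint_eq0 smq ge0 q0 (S3_retract Ux)).
Qed.

(** The integrability conditions for al = 0. Their product with t gives w = 0; then G is both
    parallel and orthogonal to the unit vector t, hence 0. *)
Lemma conformal_ga_algebra (t0 t1 t2 g G0 G1 G2 : R) :
  t0 * t0 + t1 * t1 + t2 * t2 = 1 -> t0 * G0 + t1 * G1 + t2 * G2 = 0 ->
  let w := g * g + 2 * g in
  [/\ 0 = w * t0 - (t1 * G2 - t2 * G1), 0 = w * t1 - (t2 * G0 - t0 * G2)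
    & 0 = w * t2 - (t0 * G1 - t1 * G0)] ->
  (g = 0 \/ g = -2) /\ [/\ G0 = 0, G1 = 0 & G2 = 0].
Proof.
move=> q sG w [B0 B1 B2].
have w0 : w = 0.
  transitivity (w * (t0 * t0 + t1 * t1 + t2 * t2)); first by rewrite q mulr1.
  have := congr1 ( *%R t0) B0; have := congr1 ( *%R t1) B1; have := congr1 ( *%R t2) B2; lra.
rewrite w0 in B0 B1 B2.
have q0 y : y = y * (t0 * t0 + t1 * t1 + t2 * t2) by rewrite q mulr1.
have [G00 G10 G20] : [/\ G0 = 0, G1 = 0 & G2 = 0].
  have := congr1 ( *%R t0) sG; have := congr1 ( *%R t1) sG; have := congr1 ( *%R t2) sG.
  have := congr1 ( *%R t0) B1; have := congr1 ( *%R t0) B2; have := congr1 ( *%R t1) B0.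
  have := congr1 ( *%R t1) B2; have := congr1 ( *%R t2) B0; have := congr1 ( *%R t2) B1.
  by have := q0 G0; have := q0 G1; have := q0 G2; split; lra.
split=> //; have : g * (g + 2) = 0 by move: w0; rewrite /w; lra.
by move/eqP; rewrite mulf_eq0 => /orP[/eqP->|/eqP e]; [left|right; lra].
Qed.

Lemma conformal_ga x : U0 x ->
  (ga x = 0 \/ ga x = -2) /\ forall a, Lie a ga x = 0.
Proof.
move=> Ux.
have := (@conformal_integrability R _ U0 smooth (@Lie R) smoothD smoothM smoothN smooth_cst
    (fun a x Ux f g => @LieD R a x Ux f g) (fun a x Ux f g => @LieM R a x Ux f g)
    (fun a x Ux f => @LieN R a x Ux f) (fun a x Ux c => @Lie_cst R a x c) (@Lie_eq R)
    (@Lie_comm01 R) (@Lie_comm12 R) (@Lie_comm20 R) s sms s1 al ga sal sga conf x Ux).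
cbv zeta; rewrite !conformal_Lie_al// conformal_al0// mulr0 mul0r mulr0 subr0 => -[sG B].
have [h [G0 G1 G2]] := conformal_ga_algebra (s1 Ux) sG B.
by split; [exact: h|exact: I3P G0 G1 G2].
Qed.

(** Since [ga] is constant, its value at one point selects the same alternative everywhere. *)
Lemma conformal_rigidity :
  (forall a c x, U0 x -> Lie a (s c) x = 0) \/
  (forall a c x, U0 x -> Lie a (s c) x =
     -2 * (eps a c 0 * s 0 x + eps a c 1 * s 1 x + eps a c 2 * s 2 x)).
Proof.
pose e : E4 := vec4 1 0 0 0.
have Ue : U0 e by apply: S3_U0; rewrite /S3/= dot4 /e !vec4E; ring.
have gaE x : U0 x -> ga x = ga e.
  by move=> Ux; apply: cst_of_Lie => // a y Uy; have [_] := conformal_ga Uy.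
have [[g0|g2] _] := conformal_ga Ue; [left|right] => a c x Ux.
  by rewrite conf// conformal_al0// gaE// g0 !mul0r addr0.
by rewrite conf// conformal_al0// gaE// g2 mul0r add0r.
Qed.

End Rigidity.

Section Energy.
Context {R : realType}.
Local Notation E4 := 'cV[R]_4.
Local Notation U0 := (@U0 R).
Implicit Types f g : E4 -> R.

Variable nabla : @connection R.
Hypothesis nablaLC : levi_civita nabla.
Variable sigma : E4 -> E4.
Hypothesis us : unit_vector_field sigma.

Let vs : vector_field sigma. Proof. exact: us.1. Qed.
Let s : 'I_3 -> E4 -> R := fcomp sigma.
Let sms a : smooth (s a). Proof. exact: smooth_fcomp. Qed.
Let hs a : hom0 (s a). Proof. exact: hom0_retract. Qed.

Lemma fcomp_unit x : U0 x -> s 0 x * s 0 x + s 1 x * s 1 x + s 2 x * s 2 x = 1.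
Proof.
move=> Ux; have Sp := S3_retract Ux.
have := parseval (retract x) (sigma (retract x)) (sigma (retract x)).
by rewrite Sp mul1r us.2// dotC vs.2// mul0r add0r => <-.
Qed.

Definition covf a c : E4 -> R :=
  Lie a (s c) + (cst (eps a c 0) * s 0 + cst (eps a c 1) * s 1 + cst (eps a c 2) * s 2).

Lemma smooth_covf a c : smooth (covf a c). Proof. by rewrite /covf; smooth_hom. Qed.
Lemma hom0_covf a c : hom0 (covf a c). Proof. by rewrite /covf; smooth_hom. Qed.

Lemma covfE a c p : S3 p -> dot (nabla p (frame a p) sigma) (frame c p) = covf a c p.
Proof. by move=> Sp; rewrite (nabla_fcomp nablaLC vs)// /covf !fctE !addrA. Qed.

Let covE a c x : covf a c x = cov (@Lie R) s a c x.
Proof. by rewrite /covf /cov !fctE. Qed.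

Lemma covf_unit a x : U0 x ->
  covf a 0 x * s 0 x + covf a 1 x * s 1 x + covf a 2 x * s 2 x = 0.
Proof.
move=> Ux; rewrite !covE; exact: (cov_unit smoothD smoothM
  (fun a x Ux f g => @LieD R a x Ux f g) (fun a x Ux f g => @LieM R a x Ux f g)
  (fun a x Ux c => @Lie_cst R a x c) (@Lie_eq R) sms fcomp_unit).
Qed.

Definition energy_density : E4 -> R :=
  covf 0 0 * covf 0 0 + covf 0 1 * covf 0 1 + covf 0 2 * covf 0 2
  + covf 1 0 * covf 1 0 + covf 1 1 * covf 1 1 + covf 1 2 * covf 1 2
  + covf 2 0 * covf 2 0 + covf 2 1 * covf 2 1 + covf 2 2 * covf 2 2.

Let tr : E4 -> R := covf 0 0 + covf 1 1 + covf 2 2.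

Definition sigma2f : E4 -> R := tr * tr
  + - (covf 0 0 * covf 0 0 + covf 1 1 * covf 1 1 + covf 2 2 * covf 2 2
     + cst 2 * (covf 0 1 * covf 1 0 + covf 0 2 * covf 2 0 + covf 1 2 * covf 2 1)).

Definition defect := energy_density + - sigma2f.

Let smc := smooth_covf.
Let hc := hom0_covf.

Let trE x : tr x = divs (@Lie R) s x.
Proof.
rewrite -[LHS]/(covf 0 0 x + covf 1 1 x + covf 2 2 x) !covE.
rewrite -[RHS]/(Lie 0 (s 0) x + Lie 1 (s 1) x + Lie 2 (s 2) x) /cov /eps/=.
by rewrite !mul0r !addr0.
Qed.

Lemma smooth_energy_density : smooth energy_density.
Proof. by rewrite /energy_density; smooth_hom. Qed.
Lemma smooth_sigma2f : smooth sigma2f.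
Proof. by rewrite /sigma2f /tr; smooth_hom. Qed.
Lemma smooth_defect : smooth defect.
Proof. by apply: smoothD; [exact: smooth_energy_density|apply: smoothN; exact: smooth_sigma2f]. Qed.
Lemma hom0_defect : hom0 defect.
Proof. by rewrite /defect /energy_density /sigma2f /tr; smooth_hom. Qed.

Lemma normsq_density p : S3 p -> normsq_cov nabla sigma p = energy_density p.
Proof.
move=> Sp; rewrite (normsq_covE3 nablaLC vs)// !sum3E !covfE// !expr2.
by rewrite /energy_density !fctE !addrA.
Qed.

Lemma sint_sigma2f : sint sigma2f = 4 * pi ^+ 2.
Proof.
pose V a := bochner_field (@Lie R) s a.
have sV a : smooth (V a).
  exact: (sm_bochner_field smoothD smoothM smoothN smooth_Lie sms).
have -> : sint sigma2f = sint (cst 2 * cst 1 + (Lie 0 (V 0) + Lie 1 (V 1) + Lie 2 (V 2))).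
  apply: sint_eq => p Sp.
  rewrite -[RHS]/(2 * 1 + (Lie 0 (V 0) p + Lie 1 (V 1) p + Lie 2 (V 2) p)) mulr1.
  rewrite -(bochner_formula smoothD smoothM smoothN smooth_Lie
    (fun a x Ux f g => @LieD R a x Ux f g) (fun a x Ux f g => @LieM R a x Ux f g)
    (fun a x Ux f => @LieN R a x Ux f) (@Lie_comm01 R) (@Lie_comm12 R) (@Lie_comm20 R)
    sms fcomp_unit (S3_U0 Sp)).
  by rewrite /sigma2f /sigma2 !fctE trE !covE.
rewrite sintD; [|by smooth_hom|by smooth_hom].
rewrite sint_div// addr0 sintZ ?sint1; last exact: smooth_cst.
by rewrite mulrA -natrM.
Qed.

(** The excess over the bound is isolated as the integral of a nonnegative function, which serves
    both the inequality and its equality case. *)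
Lemma energyE : vertical_energy nabla sigma = (2 * pi ^+ 2 + 2^-1 * sint defect)%:E.
Proof.
rewrite /vertical_energy (integralS3E smooth_energy_density normsq_density) -EFinM.
congr (_%:E).
have -> : sint energy_density = sint defect + sint sigma2f.
  rewrite -sintD; [|exact: smooth_defect|exact: smooth_sigma2f].
  by apply: sint_eq => p _; rewrite /defect !fctE subrK.
by rewrite sint_sigma2f mulrDr addrC; congr (_ + _); field.
Qed.

Lemma defect_ge0 x : U0 x -> 0 <= defect x.
Proof.
move=> Ux.
have := bochner_defect (fcomp_unit Ux) (covf_unit 0 Ux) (covf_unit 1 Ux) (covf_unit 2 Ux).
rewrite /defect /energy_density /sigma2f /tr !fctE => ->.
exact: sum_sqr9_ge0.
Qed.

Lemma energy_ge : ((2 * pi ^+ 2)%:E <= vertical_energy nabla sigma)%E.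
Proof.
rewrite energyE lee_fin lerDl; apply: mulr_ge0; first by rewrite invr_ge0.
apply: sint_ge0; first exact: smooth_defect.
by move=> p /S3_U0; exact: defect_ge0.
Qed.

Section equality.
Hypothesis emin : vertical_energy nabla sigma = (2 * pi ^+ 2)%:E.

Lemma defect_eq0 x : U0 x -> defect x = 0.
Proof.
move=> Ux; rewrite -(hom0_U0 hom0_defect Ux).
apply: sint_eq0 (S3_retract Ux); first exact: smooth_defect.
  by move=> p /S3_U0; exact: defect_ge0.
move: emin; rewrite energyE => -[] /eqP; rewrite eq_sym -subr_eq0 opprD addrA subrr.
by rewrite sub0r oppr_eq0 mulf_eq0 invr_eq0 pnatr_eq0 /= => /eqP.
Qed.

(** [al] and [ga] are the coefficients supplied pointwise by [bochner_equality], the summand - 1 of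
    [ga] being the shift of [conformal_of_cov]. These explicit formulas make them smooth and
    homogeneous. *)
Let al : E4 -> R := cst 2^-1 * tr.
Let ga : E4 -> R := cst 2^-1 * (s 2 * (covf 0 1 + - covf 1 0) + s 0 * (covf 1 2 + - covf 2 1)
  + s 1 * (covf 2 0 + - covf 0 2)) + - cst 1.

Let sal : smooth al. Proof. by rewrite /al /tr; smooth_hom. Qed.
Let sga : smooth ga. Proof. by rewrite /ga; smooth_hom. Qed.
Let hal : hom0 al. Proof. by rewrite /al /tr; smooth_hom. Qed.
Let hga : hom0 ga. Proof. by rewrite /ga; smooth_hom. Qed.

Lemma fcomp_conformal a c x : U0 x -> Lie a (s c) x =
  al x * ((a == c)%:R - s a x * s c x)
  + ga x * (eps a c 0 * s 0 x + eps a c 1 * s 1 x + eps a c 2 * s 2 x).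
Proof.
move=> Ux.
have d0 := defect_eq0 Ux; rewrite /defect /energy_density /sigma2f /tr !fctE in d0.
have [e f] := bochner_equality (fcomp_unit Ux) (covf_unit 0 Ux) (covf_unit 1 Ux) (covf_unit 2 Ux) d0.
exact: (@conformal_of_cov R (fun a c => Lie a (s c) x) (fun a => s a x) _ _ e f).
Qed.

Lemma fcomp_rigidity :
  (forall a c x, U0 x -> Lie a (s c) x = 0) \/
  (forall a c x, U0 x -> Lie a (s c) x =
     -2 * (eps a c 0 * s 0 x + eps a c 1 * s 1 x + eps a c 2 * s 2 x)).
Proof. exact: (conformal_rigidity sms sal sga hal hga fcomp_unit fcomp_conformal). Qed.

End equality.

End Energy.

(** * Hopf fields and orthogonal complex structures *)

Section ComplexStructure.
Context {R : realType}.
Local Notation E4 := 'cV[R]_4.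

Definition complex_structure (J : 'M[R]_4) := Defs.orthogonal J /\ J *m J = - 1%:M.

(* The matrix of the left (e = 1) or right (e = -1) multiplication by the
   quaternion q0 i + q1 j + q2 k. *)
Definition quat_mx (e q0 q1 q2 : R) : 'M[R]_4 := \matrix_(i < 4, j < 4)
  (nth [::] [:: [:: 0; - q0; - q1; - q2]; [:: q0; 0; - (e * q2); e * q1];
    [:: q1; e * q2; 0; - (e * q0)]; [:: q2; - (e * q1); e * q0; 0]] i)`_j.

Lemma quat_mxE e q0 q1 q2 (x : E4) : quat_mx e q0 q1 q2 *m x = vec4
  (- q0 * x 1 0 - q1 * x 2 0 - q2 * x 3 0)
  (q0 * x 0 0 - e * q2 * x 2 0 + e * q1 * x 3 0)
  (q1 * x 0 0 + e * q2 * x 1 0 - e * q0 * x 3 0)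
  (q2 * x 0 0 - e * q1 * x 1 0 + e * q0 * x 2 0).
Proof. by apply: E4_eq; rewrite vec4E mxE sum4E !mxE/=; ring. Qed.

Lemma quat_mx_complex e q0 q1 q2 : e = 1 \/ e = -1 ->
  q0 * q0 + q1 * q1 + q2 * q2 = 1 -> complex_structure (quat_mx e q0 q1 q2).
Proof.
move=> [] -> q; split; apply/matrixP; apply: I4P; apply: I4P;
  rewrite !mxE sum4E !mxE/=; lra.
Qed.

Lemma dot_mulmx (A B : 'M[R]_4) (x y : E4) : dot (A *m x) (B *m y) = dot x (A^T *m B *m y).
Proof.
have dE (v w : E4) : dot v w = (v^T *m w) 0 0.
  by rewrite mxE; apply: eq_bigr => i _; rewrite mxE.
by rewrite !dE trmx_mul !mulmxA.
Qed.

Lemma dot_orthogonal (A : 'M[R]_4) x y : Defs.orthogonal A -> dot (A *m x) (A *m y) = dot x y.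
Proof. by move=> oA; rewrite dot_mulmx oA mul1mx. Qed.

Section props.
Variable J : 'M[R]_4.
Hypothesis cJ : complex_structure J.

Lemma complex_structure_sqr (x : E4) : J *m (J *m x) = - x.
Proof. by rewrite mulmxA cJ.2 mulNmx mul1mx. Qed.

Lemma complex_structure_skew x y : dot (J *m x) y = - dot x (J *m y).
Proof.
by rewrite -[X in - X](dot_orthogonal _ _ cJ.1) complex_structure_sqr dotNr opprK.
Qed.

Lemma complex_structure_tangent x : dot x (J *m x) = 0.
Proof.
have := complex_structure_skew x x; rewrite dotC; lra.
Qed.

Lemma dot_complex_structure x y : dot (J *m x) (J *m y) = dot x y.
Proof. exact: dot_orthogonal cJ.1. Qed.

End props.

Lemma orthogonal_unitmx (A : 'M[R]_4) : Defs.orthogonal A -> A \in unitmx.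
Proof. by move=> /mulmx1_unit[]. Qed.

Lemma orthogonal_invmx (A : 'M[R]_4) : Defs.orthogonal A -> invmx A = A^T.
Proof.
move=> oA; have uA := orthogonal_unitmx oA.
by rewrite -[LHS]mul1mx -oA -mulmxA mulmxV// mulmx1.
Qed.

Lemma imulE (x : E4) : imul x = quat_mx 1 1 0 0 *m x.
Proof. by rewrite quat_mxE /imul; congr vec4; ring. Qed.

Lemma complex_structure_conj (A J : 'M[R]_4) : Defs.orthogonal A -> complex_structure J ->
  complex_structure (A *m J *m invmx A).
Proof.
move=> oA [oJ J2]; have uA := orthogonal_unitmx oA; split.
  rewrite /Defs.orthogonal orthogonal_invmx// !trmx_mul trmxK.
  rewrite !mulmxA -(mulmxA _ A^T A) oA mulmx1 -(mulmxA _ J^T J) oJ mulmx1.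
  by rewrite -orthogonal_invmx// mulmxV.
rewrite !mulmxA -(mulmxA _ (invmx A) A) mulVmx// mulmx1 -(mulmxA _ J J) J2.
by rewrite mulmxN mulNmx mulmx1 mulmxV.
Qed.

Lemma hopf_field_complex sigma : hopf_field sigma ->
  exists J, complex_structure J /\ forall x, S3 x -> sigma x = J *m x.
Proof.
move=> [A [oA sA]]; exists (A *m quat_mx 1 1 0 0 *m invmx A); split.
  by apply: complex_structure_conj => //; apply: quat_mx_complex; [left|ring].
by move=> x Sx; rewrite sA// /image_field imulE !mulmxA.
Qed.

(** Used to complete (1, 0, 0, 0) and its image under a complex structure to an adapted basis. A
    normalized quarter turn of (q_1, q_2) works, unless both vanish. *)
Lemma orthogonal_unit_vector (q : E4) : q 0 0 = 0 -> dot q q = 1 ->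
  exists w : E4, [/\ dot w w = 1, w 0 0 = 0 & dot w q = 0].
Proof.
move=> q0 q1; pose r := q 1 0 * q 1 0 + q 2 0 * q 2 0.
have r0 : 0 <= r by rewrite /r -!expr2 addr_ge0 ?sqr_ge0.
have [rz|rn] := eqVneq r 0.
  have [a b] : q 1 0 = 0 /\ q 2 0 = 0.
    have := sqr_ge0 (q 1 0); have := sqr_ge0 (q 2 0); rewrite !expr2 => h1 h2.
    by split; apply/eqP; rewrite -sqrf_eq0 expr2; apply/eqP; move: rz; rewrite /r; lra.
  exists (vec4 0 1 0 0); rewrite !dot4 !vec4E a; split; ring.
pose k := (Num.sqrt r)^-1.
have kk : k * k * r = 1 by rewrite /k -expr2 exprVn sqr_sqrtr// mulVf.
exists (vec4 0 (- k * q 2 0) (k * q 1 0) 0); rewrite !dot4 !vec4E; split; [|by []|ring].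
by rewrite -kk /r; ring.
Qed.

(** The matrix [A] with columns [u], [J u], [w], [J w] is orthogonal and carries multiplication by i
    on C^2 to [J]. *)
Lemma complex_hopf_field sigma J : complex_structure J ->
  (forall x, S3 x -> sigma x = J *m x) -> hopf_field sigma.
Proof.
move=> cJ sJ.
pose u : E4 := vec4 1 0 0 0.
have du x : dot x u = x 0 0 by rewrite dot4 !vec4E; ring.
have uu : dot u u = 1 by rewrite du vec4E.
have q00 : (J *m u) 0 0 = 0 by rewrite -du dotC complex_structure_tangent.
have qq : dot (J *m u) (J *m u) = 1 by rewrite dot_complex_structure.
have [w [ww w0 wq]] := orthogonal_unit_vector q00 qq.
pose A : 'M[R]_4 := \matrix_(i < 4, j < 4) (nth 0 [:: u; J *m u; w; J *m w] j) i 0.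
have AE y : A *m y = y 0 0 *: u + y 1 0 *: (J *m u) + y 2 0 *: w + y 3 0 *: (J *m w).
  by apply/matrixP => i j; rewrite ord1 mxE sum4E !mxE/= !(mulrC _ (y _ 0)).
have oA : Defs.orthogonal A.
  apply/matrixP => i j; rewrite !mxE.
  transitivity (dot (nth 0 [:: u; J *m u; w; J *m w] i) (nth 0 [:: u; J *m u; w; J *m w] j)).
    by apply: eq_bigr => k _; rewrite !mxE.
  have wu : dot w u = 0 by rewrite du.
  have uJw : dot u (J *m w) = 0.
    by rewrite -[LHS]opprK -complex_structure_skew// dotC wq oppr0.
  move: i j; apply: I4P; apply: I4P; rewrite /= ?dot_complex_structure//
    ?complex_structure_tangent// ?uJw// ?(dotC (J *m _)) ?dot_complex_structure//
    ?complex_structure_tangent// ?uJw//; by rewrite dotC.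
exists A; split => // x Sx; rewrite sJ// /image_field.
have {1}-> : x = A *m (invmx A *m x).
  by rewrite mulmxA mulmxV ?mul1mx// orthogonal_unitmx.
move: (invmx A *m x) => y; rewrite !AE /imul !vec4E !mulmxDr -!scalemxAr.
rewrite !complex_structure_sqr//; apply/matrixP => i j; rewrite !mxE; ring.
Qed.

End ComplexStructure.

(** * Quadratic functions on the sphere and the energy of a linear field *)

Section LinearField.
Context {R : realType}.
Local Notation E4 := 'cV[R]_4.
Local Notation U0 := (@U0 R).
Implicit Types A B J : 'M[R]_4.

Definition basis_quat_mx (e : R) (c : 'I_3) : 'M[R]_4 :=
  quat_mx e (c == 0)%:R (c == 1)%:R (c == 2)%:R.

Lemma frame_mx c (x : E4) : frame c x = basis_quat_mx 1 c *m x.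
Proof.
rewrite quat_mxE; move: c; apply: I3P; rewrite ?frame0E ?frame1E ?frame2E /=;
  congr vec4; ring.
Qed.

Definition bilf A B : E4 -> R := dotf (mulmx A) (mulmx B).

Lemma bilfE A B x : bilf A B x = dot (A *m x) (B *m x).
Proof. by rewrite /bilf dotfE. Qed.

Lemma coord_mulmx A i :
  coord4 i \o mulmx A = \sum_j (cst (A i j) * coord4 j) :> (E4 -> R).
Proof. by apply/funext => x; rewrite fct_sumE /= /coord4 mxE. Qed.

Lemma smooth_bilf A B : smooth (bilf A B).
Proof.
have sm C i : smooth (coord4 i \o mulmx C : E4 -> R).
  rewrite coord_mulmx => k; apply: Ck_sum => [|j]; first exact: open_U0.
  by apply: smoothM; [exact: smooth_cst|exact: smooth_coord].
by move=> k; apply: Ck_sum => [|i]; [exact: open_U0|apply: smoothM; exact: sm].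
Qed.

Lemma is_derive_bilf A B (x v : E4) :
  is_derive x v (bilf A B) (dot (A *m v) (B *m x) + dot (A *m x) (B *m v)).
Proof.
have dc C i : is_derive x v (coord4 i \o mulmx C : E4 -> R) ((C *m v) i 0).
  rewrite coord_mulmx; have dc j := is_derive_coord4 j x v.
  apply: is_derive_eq; rewrite mxE; apply: eq_bigr => j _.
  by rewrite /coord4 /cst !scalerE; ring.
rewrite /bilf /dotf; apply: is_derive_eq.
rewrite /dot -big_split; apply: eq_bigr => i _ /=.
by rewrite /coord4 /= !scalerE; ring.
Qed.

(** The radial extension of x -> (A x) . (B x). [Lie] passes through the factor |x|^-2 because the
    frame is tangent to the spheres. *)
Definition nbilf A B : E4 -> R := invnorm * invnorm * bilf A B.

Lemma smooth_nbilf A B : smooth (nbilf A B).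
Proof.
have si := @smooth_invnorm R.
by apply: smoothM; [exact: smoothM|exact: smooth_bilf].
Qed.

Lemma nbilfE A B x : nbilf A B x = dot (A *m retract x) (B *m retract x).
Proof. by rewrite /nbilf !fctE bilfE retractE -!scalemxAr dotZl dotZr mulrA. Qed.

Lemma Lie_nbilf A B a x : U0 x -> Lie a (nbilf A B) x =
  invnorm x * invnorm x * (dot (A *m frame a x) (B *m x) + dot (A *m x) (B *m frame a x)).
Proof.
move=> Ux; have si := @smooth_invnorm R.
rewrite /nbilf (LieM _ Ux (smoothM si si) (smooth_bilf A B)) (LieM _ Ux si si).
rewrite !Lie_invnorm// !mulr0 addr0 mulr0 addr0; congr (_ * _).
by have [_] := is_derive_bilf A B x (frame a x).
Qed.

Lemma frame_mul c a (x : E4) : frame c (frame a x) = - (a == c)%:R *: x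
  + eps c a 0 *: frame 0 x + eps c a 1 *: frame 1 x + eps c a 2 *: frame 2 x.
Proof.
by move: c a; apply: I3P; apply: I3P; rewrite /eps/= ?frame0E ?frame1E ?frame2E;
  apply: E4_eq; rewrite !mxE/= ?vec4E; ring.
Qed.

Lemma eps_swap (a b c : 'I_3) : eps a b c = - eps b a c :> R.
Proof. by move: a b c; do 3!apply: I3P; rewrite /eps/=; ring. Qed.

Variable nabla : @connection R.
Hypothesis nablaLC : levi_civita nabla.
Variables (sigma : E4 -> E4) (J : 'M[R]_4).
Hypotheses (us : unit_vector_field sigma) (cJ : complex_structure J)
  (sJ : forall x, S3 x -> sigma x = J *m x).

(** The covariant derivative of a linear field is the tangential part of its ordinary derivative: by
    the quaternion table [frame_mul], the term coming from the derivative of [frame c] cancels the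
    [eps] terms. *)
Lemma covf_complex a c p : S3 p ->
  covf sigma a c p = dot (J *m frame a p) (frame c p).
Proof.
move=> Sp; have Up := S3_U0 Sp.
have fE d x : U0 x -> fcomp sigma d x = nbilf J (basis_quat_mx 1 d) x.
  by move=> Ux; rewrite nbilfE -frame_mx -sJ//; exact: S3_retract.
rewrite /covf !fctE (@Lie_eq R a _ _ p (fun x => fun Ux : x \in U0 => fE c x (set_mem Ux)) Up).
rewrite Lie_nbilf// -!frame_mx frame_mul !dotDr !dotZr !fcomp_S3// !sJ//.
rewrite (dotC (J *m p) p) complex_structure_tangent// (eps_swap c a).
rewrite (eps_swap c a 1) (eps_swap c a 2).
rewrite /invnorm Sp sqrtr1 invr1.
move: (dot _ _) (dot _ _) (dot _ _) (dot _ _) => h0 h1 h2 h3; ring.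
Qed.

(** The density is the constant 3 - 1 = 2: the three vectors [J *m frame a p] are unit, and the
    squares of their components along [p] add up to the squared length of [J *m p]. *)
Lemma energy_complex : vertical_energy nabla sigma = (2 * pi ^+ 2)%:E.
Proof.
have nE p : S3 p -> normsq_cov nabla sigma p = (cst 2 * cst 1 : E4 -> R) p.
  move=> Sp; rewrite (normsq_density nablaLC us)// /energy_density !fctE !covf_complex//.
  have P v := parseval p v v.
  have tJ a : dot (J *m frame a p) p = - dot (J *m p) (frame a p).
    by rewrite complex_structure_skew// dotC.
  have := P (J *m p); have := P (J *m frame 0 p).
  have := P (J *m frame 1 p); have := P (J *m frame 2 p).
  have [_ ff] := frame_orthonormal Sp.
  rewrite !dot_complex_structure// !ff Sp !tJ (dotC (J *m p) p) complex_structure_tangent//.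
  rewrite !eqxx !mul1r.
  rewrite -![true%:R]/(1 : R).
  move: (dot (J *m p)) (fun a => dot (J *m frame a p)) => f g.
  lra.
have s2 : smooth (cst 2 * cst 1 : E4 -> R) by apply: smoothM; exact: smooth_cst.
rewrite /vertical_energy (integralS3E s2 nE) sintZ ?sint1; last exact: smooth_cst.
by rewrite -EFinM mulKf ?pnatr_eq0.
Qed.

End LinearField.

(** * Minimizers are linear fields *)

Section Minimizers.
Context {R : realType}.
Local Notation E4 := 'cV[R]_4.
Local Notation U0 := (@U0 R).

Let x0 : E4 := vec4 1 0 0 0.
Let S3_x0 : S3 x0. Proof. by rewrite /S3/= dot4 !vec4E; ring. Qed.

Variable nabla : @connection R.
Hypothesis nablaLC : levi_civita nabla.
Variable sigma : E4 -> E4.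
Hypothesis us : unit_vector_field sigma.
Let s := fcomp sigma.
Let sms a : smooth (s a). Proof. exact: smooth_fcomp us.1 a. Qed.

Lemma fcomp_sum p : S3 p -> sigma p = \sum_c s c p *: frame c p.
Proof.
move=> Sp; rewrite {1}(orthonormal_basis_expand Sp (frame_orthonormal Sp) (us.1.2 p Sp)).
by apply: eq_bigr => c _; rewrite /s fcomp_S3.
Qed.

Lemma quat_mx_sum e (q : 'I_3 -> R) (x : E4) :
  \sum_c q c *: (basis_quat_mx e c *m x) = quat_mx e (q 0) (q 1) (q 2) *m x.
Proof. by rewrite sum3E !quat_mxE; apply: E4_eq; rewrite !mxE/=; ring. Qed.

Lemma basis_quat_mx_complex (e : R) c : e = 1 \/ e = -1 -> complex_structure (basis_quat_mx e c).
Proof.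
by move=> e1; apply: quat_mx_complex => //; move: c; apply: I3P; rewrite /=; ring.
Qed.

Lemma quat_mx_comm (p0 p1 p2 q0 q1 q2 : R) (x : E4) :
  quat_mx (-1) q0 q1 q2 *m (quat_mx 1 p0 p1 p2 *m x)
  = quat_mx 1 p0 p1 p2 *m (quat_mx (-1) q0 q1 q2 *m x).
Proof. by rewrite !quat_mxE; apply: E4_eq; rewrite !vec4E; ring. Qed.

Lemma complex_of_quat e q0 q1 q2 : e = 1 \/ e = -1 ->
  (forall p, S3 p -> sigma p = quat_mx e q0 q1 q2 *m p) ->
  exists J, complex_structure J /\ forall p, S3 p -> sigma p = J *m p.
Proof.
move=> e1 sE; exists (quat_mx e q0 q1 q2); split=> //; apply: quat_mx_complex => //.
have := us.2 _ S3_x0; rewrite sE// quat_mxE dot4 !vec4E => <-; ring.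
Qed.

Lemma left_invariant_complex : (forall a c x, U0 x -> Lie a (s c) x = 0) ->
  exists J, complex_structure J /\ forall p, S3 p -> sigma p = J *m p.
Proof.
move=> L0; apply: (@complex_of_quat 1 (s 0 x0) (s 1 x0) (s 2 x0)); first by left.
move=> p Sp; rewrite fcomp_sum// -(quat_mx_sum 1 (fun c => s c x0)).
apply: eq_bigr => c _; rewrite -frame_mx; congr (_ *: _).
have hs : hom0 (s c) by exact: hom0_retract.
exact: (cst_of_Lie (sms c) hs (fun a => L0 a c) (S3_U0 Sp) (S3_U0 S3_x0)).
Qed.

(* The coefficients of the adjoint representation. *)
Definition adjf b c : E4 -> R := nbilf (basis_quat_mx 1 b) (basis_quat_mx (-1) c).

(** Right multiplications commute with the frame and e_a is skew, so the derivative pairs (e_b e_a -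
    e_a e_b) x with the right multiplication by e_c. For fixed [c] this is the system that the
    components of [sigma] satisfy when ga = -2. *)
Lemma Lie_adjf a b c x : U0 x -> Lie a (adjf b c) x =
  -2 * (eps a b 0 * adjf 0 c x + eps a b 1 * adjf 1 c x + eps a b 2 * adjf 2 c x).
Proof.
move=> Ux; rewrite Lie_nbilf// /adjf /nbilf !fctE !bilfE.
have J1 : complex_structure (basis_quat_mx (1 : R) a).
  by apply: basis_quat_mx_complex; left.
set r := basis_quat_mx (-1 : R) c.
have -> : r *m frame a x = frame a (r *m x).
  by rewrite !frame_mx; exact: quat_mx_comm.
rewrite [X in _ + X]dotC [frame a (r *m x)]frame_mx (complex_structure_skew J1) -!frame_mx !frame_mul.
rewrite (dotC (r *m x)) !dotDl !dotZl (eps_swap b a 0) (eps_swap b a 1) (eps_swap b a 2).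
rewrite (eq_sym b a).
move: (dot _ _) (dot _ _) (dot _ _) (dot _ _) => h0 h1 h2 h3; ring.
Qed.

(** [T c] is the component of [sigma] along the right multiplication field x -> x e_c. It pairs two
    solutions of the same linear system with skew coefficients, hence is constant. *)
Lemma right_invariant_complex :
  (forall a c x, U0 x -> Lie a (s c) x =
     -2 * (eps a c 0 * s 0 x + eps a c 1 * s 1 x + eps a c 2 * s 2 x)) ->
  exists J, complex_structure J /\ forall p, S3 p -> sigma p = J *m p.
Proof.
move=> L2.
have smA b c : smooth (adjf b c) by exact: smooth_nbilf.
pose T c : E4 -> R := s 0 * adjf 0 c + s 1 * adjf 1 c + s 2 * adjf 2 c.
have smT c : smooth (T c).
  by do !apply: smoothD; apply: smoothM.
have hT c : hom0 (T c).
  have hA b : hom0 (adjf b c).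
    by move=> l x l0; rewrite /adjf !nbilfE retractZ.
  have hs b : hom0 (s b) by exact: hom0_retract.
  by move=> l x l0; rewrite /T !fctE !hs// !hA.
have LT a c x : U0 x -> Lie a (T c) x = 0.
  move=> Ux; have m b := smoothM (sms b) (smA b c).
  rewrite /T (LieD _ Ux (smoothD (m 0) (m 1)) (m 2)) (LieD _ Ux (m 0) (m 1)).
  rewrite (LieM _ Ux (sms 0) (smA 0 c)) (LieM _ Ux (sms 1) (smA 1 c)) (LieM _ Ux (sms 2) (smA 2 c)).
  rewrite !L2// !Lie_adjf//.
  move: (s 0 x) (s 1 x) (s 2 x) (adjf 0 c x) (adjf 1 c x) (adjf 2 c x) => *.
  by move: a; apply: I3P; rewrite /eps/=; ring.
have TE c p : S3 p -> T c p = dot (sigma p) (basis_quat_mx (-1) c *m p).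
  move=> Sp; rewrite /T !fctE /adjf !nbilfE retract_S3// -!frame_mx /s !fcomp_S3//.
  have := parseval p (sigma p) (basis_quat_mx (-1) c *m p).
  rewrite Sp mul1r [dot (sigma p) p]dotC us.1.2// mul0r add0r => ->.
  by rewrite !(dotC (frame _ _)).
apply: (@complex_of_quat (-1) (T 0 x0) (T 1 x0) (T 2 x0)); first by right.
move=> p Sp; rewrite -(quat_mx_sum (-1) (fun c => T c x0)).
have on : orthonormal_basis p (fun c => basis_quat_mx (-1) c *m p).
  have cR c : complex_structure (basis_quat_mx (-1 : R) c).
    by apply: basis_quat_mx_complex; right.
  split=> [c|b c]; first by rewrite /tangent complex_structure_tangent.
  rewrite !quat_mxE dot4 !vec4E; move: Sp; rewrite /S3/= dot4 => Sp.
  by move: b c; apply: I3P; apply: I3P; rewrite /=; lra.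
rewrite {1}(orthonormal_basis_expand Sp on (us.1.2 p Sp)).
apply: eq_bigr => c _; congr (_ *: _); rewrite -TE//.
exact: (cst_of_Lie (smT c) (hT c) (fun a => LT a c) (S3_U0 Sp) (S3_U0 S3_x0)).
Qed.

Lemma minimizer_hopf_field :
  vertical_energy nabla sigma = (2 * pi ^+ 2)%:E -> hopf_field sigma.
Proof.
move=> emin; have [J [cJ sJ]] : exists J, complex_structure J /\ forall p, S3 p -> sigma p = J *m p.
  by case: (fcomp_rigidity nablaLC us emin); [exact: left_invariant_complex|exact: right_invariant_complex].
exact: complex_hopf_field cJ sJ.
Qed.

Lemma hopf_field_energy :
  hopf_field sigma -> vertical_energy nabla sigma = (2 * pi ^+ 2)%:E.
Proof.
by move=> /hopf_field_complex[J [cJ sJ]]; exact: (energy_complex nablaLC us cJ sJ).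
Qed.

End Minimizers.

Theorem mainTheorem1 (R : realType) (nabla : @connection R)
    (nablaLC : levi_civita nabla) :
  [/\ exists sigma : 'cV[R]_4 -> 'cV[R]_4, unit_vector_field sigma /\
        vertical_energy nabla sigma = (2 * pi ^+ 2)%:E,
      forall sigma : 'cV[R]_4 -> 'cV[R]_4, unit_vector_field sigma ->
        ((2 * pi ^+ 2)%:E <= vertical_energy nabla sigma)%E &
      forall sigma : 'cV[R]_4 -> 'cV[R]_4, unit_vector_field sigma ->
        (vertical_energy nabla sigma = (2 * pi ^+ 2)%:E <-> hopf_field sigma)].
Proof.
have uimul : unit_vector_field (@imul R).
  split; first exact: (vector_field_frame 0).
  by move=> p Sp; have [_ /(_ 0 0)] := frame_orthonormal Sp.
split=> [|sigma us|sigma us].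
- exists imul; split=> //; apply: (hopf_field_energy nablaLC uimul).
  exists 1%:M; split; first by rewrite /Defs.orthogonal trmx1 mul1mx.
  by move=> x _; rewrite /image_field invmx1 !mul1mx.
- exact: (energy_ge nablaLC us).
- by split; [exact: (minimizer_hopf_field nablaLC us)|exact: (hopf_field_energy nablaLC us)].
Qed.
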